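(* Let $n\geq2$ and $\alpha\in(0,1]$. (i) Let $f=(f_1,\dots,f_n)\in SS_\alpha^0(\mathbb{B}^n)$, where $\mathbb{B}^n$ is the Euclidean unit ball of $\mathbb{C}^n$. Then $$\left|\frac12\frac{\partial^2f_i}{\partial z_j^2}(0)\right|\leq\frac{3\sqrt3}{2}\sin\left(\frac{\alpha\pi}{2}\right)\quad\text{for }1\leq i\neq j\leq n.$$ These estimates are sharp for all $i\neq j$ (equality is attained by some element of $SS_\alpha^0(\mathbb{B}^n)$). (ii) For either choice of sign, let $\widetilde\Theta_{i,j}^\alpha:\mathbb{B}^n\to\mathbb{C}^n$ be given by $$\widetilde\Theta_{i,j}^\alpha(z)=z\pm\frac{3\sqrt3}{2}\sin\left(\frac{\alpha\pi}{2}\right)z_j^2e_i,\quad z=(z_1,\dots,z_n)\in\mathbb{B}^n,$$ for $1\leq i\neq j\leq n$. Then $\widetilde\Theta_{i,j}^\alpha\in SS_\alpha^*(\mathbb{B}^n)$, thus $\widetilde\Theta_{i,j}^\alpha\in SS_\alpha^0(\mathbb{B}^n)$, $1\leq i\neq j\leq n$. (iii) $\widetilde\Theta_{i,j}^\alpha\in SS_\alpha^*(\mathbb{B}^n)$ are bounded support points for the family $SS_\alpha^0(\mathbb{B}^n)$ and also bounded support points for the family $SS_\alpha^*(\mathbb{B}^n)$, for $1\leq i\neq j\leq n$.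
   Context: $\mathbb{U}$ is the open unit disc in $\mathbb{C}$; $e_1,\dots,e_n$ is the standard basis of $\mathbb{C}^n$, $\|\cdot\|$ the Euclidean norm. $H(\mathbb{B}^n)$ is the space of holomorphic maps $\mathbb{B}^n\to\mathbb{C}^n$ with locally uniform convergence; $f$ is normalized if $f(0)=0$, $Df(0)=I$. For $z\neq0$, $T(z)=\{l_z\in L(\mathbb{C}^n,\mathbb{C}):\|l_z\|=1,\ l_z(z)=\|z\|\}$ (for the Euclidean norm, $l_z=\langle\cdot,z\rangle/\|z\|$). $\mathcal{M}(\mathbb{B}^n)$ is the set of normalized $h\in H(\mathbb{B}^n)$ with $\Re l_z(h(z))>0$ for all $z\in\mathbb{B}^n\setminus\{0\}$, $l_z\in T(z)$. For a univalent $g:\mathbb{U}\to\mathbb{C}$ with $g(0)=1$, $\Re g>0$, $\mathcal{M}_g(\mathbb{B}^n)$ is the set of normalized $h\in H(\mathbb{B}^n)$ with $\frac1{\|z\|}l_z(h(z))\in g(\mathbb{U})$ for all $z\in\mathbb{B}^n\setminus\{0\}$, $l_z\in T(z)$. $S_g^*(\mathbb{B}^n)$ is the set of normalized locally biholomorphic $f\in H(\mathbb{B}^n)$ such that $z\mapsto[Df(z)]^{-1}f(z)$ belongs to $\mathcal{M}_g(\mathbb{B}^n)$. A Herglotz vector field is $h:\mathbb{B}^n\times[0,\infty)\to\mathbb{C}^n$ with $h(\cdot,t)\in\mathcal{M}(\mathbb{B}^n)$ for all $t\ge0$ and $h(z,\cdot)$ measurable for all $z$. $S_g^0(\mathbb{B}^n)$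 is the set of normalized $f\in H(\mathbb{B}^n)$ for which there is a Herglotz vector field $h$ with $h(\cdot,t)\in\mathcal{M}_g(\mathbb{B}^n)$ for a.e. $t\ge0$ and $f(z)=\lim_{t\to\infty}e^tv(z,t)$ locally uniformly on $\mathbb{B}^n$, where $v(z,\cdot)$ is the unique locally Lipschitz solution on $[0,\infty)$ of $\frac{\partial v}{\partial t}=-h(v,t)$ for a.e. $t\ge0$, $v(z,0)=z$. $SS_\alpha^0(\mathbb{B}^n)$ and $SS_\alpha^*(\mathbb{B}^n)$ denote $S_g^0(\mathbb{B}^n)$ and $S_g^*(\mathbb{B}^n)$ with $g(\zeta)=\left(\frac{1-\zeta}{1+\zeta}\right)^\alpha$, branch with $g(0)=1$. A support point of $E\subseteq H(\mathbb{B}^n)$ is $f\in E$ for which there is a continuous linear functional $\Lambda:H(\mathbb{B}^n)\to\mathbb{C}$ with $\Re\Lambda|_E$ not constant and $\Re\Lambda(f)=\max_{q\in E}\Re\Lambda(q)$. A support point is bounded if it is a bounded mapping on $\mathbb{B}^n$. *)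

(* Defs.v *)
From HB Require Import structures.
From mathcomp Require Import all_boot all_order all_algebra.
From mathcomp Require Import all_classical all_reals all_analysis.
From mathcomp Require Export complex.

Set Implicit Arguments.
Unset Strict Implicit.
Unset Printing Implicit Defensive.

Import Order.TTheory GRing.Theory Num.Theory.
Import numFieldTopology.Exports numFieldNormedType.Exports.

Local Open Scope classical_set_scope.
Local Open Scope ring_scope.
Local Open Scope complex_scope.

(* [R[i]] with the topology of its norm, as a normed module over itself, so
   that [differentiable] and ['D_v] on ['rV[R[i]]_n] are complex notions. *)
HB.instance Definition _ (R : rcfType) :=
  NormedModule.copy R[i] (Num.NumField.sort R[i]).

Notation "''C[' R ]_ n" := 'rV[R[i]]_n
  (at level 8, n at level 2, format "''C[' R ]_ n") : type_scope.

Section ComplexNumbers.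
Context {R : realType}.
Implicit Types (w : R[i]) (a : R).

Definition cmod w : R := Normc.normc w.

Definition disc : set R[i] := [set w | cmod w < 1].

(* principal argument, with values in ]-pi, pi] for w != 0 *)
Definition carg w : R :=
  let theta := acos (complex.Re w / cmod w) in
  if 0 <= complex.Im w then theta else - theta.

(* principal branch of w ^ a; on the right half-plane it is the continuous
   branch taking the value 1 at 1 *)
Definition cpow w a : R[i] :=
  (cmod w `^ a)%:C * (cos (a * carg w) +i* sin (a * carg w)).

Definition sector_map a (zeta : R[i]) : R[i] :=
  cpow ((1 - zeta) / (1 + zeta)) a.

End ComplexNumbers.

Section HolomorphicMaps.
Context {R : realType} {n : nat}.
Implicit Types (z : 'C[R]_n) (f h : 'C[R]_n -> 'C[R]_n).

(* The library norm on ['rV] is the sup norm; it has the same topology. *)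
Definition enorm z : R := Num.sqrt (\sum_(j < n) cmod (z 0 j) ^+ 2).

Definition eball : set 'C[R]_n := [set z | enorm z < 1].

Definition evec (j : 'I_n) : 'C[R]_n := delta_mx 0 j.

(* A map on the ball is represented by a total function, whose values off the
   ball are irrelevant; the space of holomorphic maps carries the (non
   separated) topology of uniform convergence on compact subsets of the ball,
   for which functions agreeing on the ball are indistinguishable. *)
Definition ballmaps := {family compactly_in eball, 'C[R]_n -> 'C[R]_n}.

Definition Hol : set ('C[R]_n -> 'C[R]_n) :=
  [set f | forall z, eball z -> differentiable f z].

(* In the row-vector convention 'd f z u = u *m 'J f z. *)
Definition normalized f := f 0 = 0 /\ 'J f 0 = 1%:M.

Definition locally_biholomorphic f := forall z, eball z ->
  exists U : set 'C[R]_n, exists g : 'C[R]_n -> 'C[R]_n,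
    [/\ open U, U z & U `<=` eball] /\
    [/\ forall w, U w -> differentiable f w,
        open (f @` U),
        forall w, U w -> g (f w) = w
      & forall y, (f @` U) y -> differentiable g y].

Definition opnorm (l : {linear 'C[R]_n -> R[i]}) : R :=
  sup [set cmod (l w) | w in [set w | enorm w <= 1]].

Definition Tset z : set {linear 'C[R]_n -> R[i]} :=
  [set l | opnorm l = 1 /\ l z = (enorm z)%:C].

Definition Mcal : set ('C[R]_n -> 'C[R]_n) :=
  [set h | [/\ Hol h, normalized h
    & forall z l, eball z -> z != 0 -> Tset z l -> 0 < complex.Re (l (h z))]].

Definition Mcal_g (g : R[i] -> R[i]) : set ('C[R]_n -> 'C[R]_n) :=
  [set h | [/\ Hol h, normalized h
    & forall z l, eball z -> z != 0 -> Tset z l ->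
        (g @` disc) ((enorm z)^-1%:C * l (h z))]].

Definition S_star (g : R[i] -> R[i]) : set ('C[R]_n -> 'C[R]_n) :=
  [set f | [/\ Hol f, normalized f, locally_biholomorphic f
    & Mcal_g g (fun z => f z *m invmx ('J f z))]].

End HolomorphicMaps.

Arguments eball {R n}.
Arguments ballmaps R n : clear implicits.

Section LoewnerFlows.
Context {R : realType} {n : nat}.
Implicit Types (z : 'C[R]_n) (f : 'C[R]_n -> 'C[R]_n).
Implicit Types (h : 'C[R]_n -> R -> 'C[R]_n) (v : R -> 'C[R]_n).

(* measurability with respect to the Lebesgue sigma-algebra (the library's
   sigma-algebra on R being the Borel one) *)
Definition lebesgue_measurable_fun (D : set R) (u : R -> R) :=
  forall B : set R, measurable B ->
    ((wlength idfun)^*)%mu.-cara.-measurable (D `&` u @^-1` B).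

Definition Herglotz h :=
  (forall t, 0 <= t -> Mcal (h^~ t)) /\
  (forall z (k : 'I_n), eball z ->
     lebesgue_measurable_fun `[0, +oo[ (fun t => complex.Re (h z t 0 k)) /\
     lebesgue_measurable_fun `[0, +oo[ (fun t => complex.Im (h z t 0 k))).

Definition locally_lipschitz v := forall t0 : R, 0 <= t0 ->
  exists L : R, \forall s & t \near t0, 0 <= s -> 0 <= t ->
    enorm (v s - v t) <= L * `|s - t|.

(* derivative with respect to a real variable (['C[R]_n] is a normed module
   over R[i], not over R) *)
Definition has_rderiv v (t : R) (w : 'C[R]_n) :=
  (s - t)^-1%:C *: (v s - v t) @[s --> t^'] --> w.

Definition loewner_solution h z v :=
  [/\ locally_lipschitz v,
      forall t, 0 <= t -> eball (v t),
      {ae lebesgue_measure, forall t, 0 <= t -> has_rderiv v t (- h (v t) t)}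
    & v 0 = z].

Definition unique_loewner_solution h z v :=
  loewner_solution h z v /\
  forall u, loewner_solution h z u -> forall t, 0 <= t -> u t = v t.

Definition S_zero (g : R[i] -> R[i]) : set ('C[R]_n -> 'C[R]_n) :=
  [set f | [/\ Hol f, normalized f
    & exists h, exists v : 'C[R]_n -> R -> 'C[R]_n,
      [/\ Herglotz h,
          {ae lebesgue_measure, forall t, 0 <= t -> Mcal_g g (h^~ t)},
          forall z, eball z -> unique_loewner_solution h z (v z)
        & {family compactly_in eball,
             (fun z => (expR t)%:C *: v z t) @[t --> +oo] --> f}]]].

End LoewnerFlows.

Section SupportPoints.
Context {R : realType} {n : nat}.
Implicit Types (E : set ('C[R]_n -> 'C[R]_n)) (f : 'C[R]_n -> 'C[R]_n).

Definition continuous_linear_functional (L : ballmaps R n -> R[i]) :=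
  (forall (a : R[i]) (p q : 'C[R]_n -> 'C[R]_n), Hol p -> Hol q ->
     L (fun z => a *: p z + q z) = a * L p + L q) /\
  {within (Hol : set (ballmaps R n)), continuous L}.

Definition support_point E f :=
  E f /\ exists L : ballmaps R n -> R[i],
    [/\ continuous_linear_functional L,
        exists p q, [/\ E p, E q & complex.Re (L p) <> complex.Re (L q)]
      & forall q, E q -> complex.Re (L q) <= complex.Re (L f)].

Definition bounded_support_point E f :=
  support_point E f /\
  exists C : R, forall z, eball z -> enorm (f z) <= C.

End SupportPoints.

Definition SS_zero (R : realType) (n : nat) (alpha : R) :
  set ('C[R]_n -> 'C[R]_n) := S_zero (sector_map alpha).

Definition SS_star (R : realType) (n : nat) (alpha : R) :
  set ('C[R]_n -> 'C[R]_n) := S_star (sector_map alpha).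

Definition sharp_bound (R : realType) (alpha : R) : R :=
  3 * Num.sqrt 3 / 2 * sin (alpha * pi / 2).

(* the sign is + for b = false and - for b = true *)
Definition Theta (R : realType) (n : nat) (alpha : R) (b : bool) (i j : 'I_n)
    (z : 'C[R]_n) : 'C[R]_n :=
  z + ((-1) ^+ b * (sharp_bound alpha)%:C * z 0 j ^+ 2) *: evec i.

(* Main.v *)
(* Write q(h) for the coefficient of z_j^2 in the i-th component of h.

   For h in M_g, average <h(z), z> over z = x v e_j + y v^2 e_i, |v| = r < 1, with x > 0: in the limit r -> 1 only
   x^2 + |y|^2 = 1 and x^2 conj(y) q(h) survive. The sector g(U) is the intersection of two half-planes
   at distance sin(alpha pi/2) from 1, so |q(h)| x^2 |y| <= sin(alpha pi/2), and x^2 |y| has maximum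
   2 / (3 sqrt 3) on the sphere.

   If v solves the Loewner equation with v(0) = zeta e_j, then up to O(|zeta|^3) the derivative of
   e^t v_i is - e^(-t) q(h_t) zeta^2, and e^(-t) has integral 1 over [0, oo), which transfers the bound
   to S_g^0. If f = h Df, then comparing coefficients gives q(f) = - q(h), which transfers it to S_g^*.

   For f(z) = z + a z_j^2 e_i with |a| the bound, [Df(z)]^-1 f(z) is the same map with - a for a;
   <h(z), z> / |z|^2 stays within sin(alpha pi/2) of 1 by AM-GM, hence in the sector, and the Loewner flow
   is explicit. The support functional is a rotation of q, continuous by Cauchy's estimate. *)

Require Import Defs.
From HB Require Import structures.
From mathcomp Require Import all_boot all_order all_algebra.
From mathcomp Require Import all_classical all_reals all_analysis.
From mathcomp Require Import ring lra.
Import Order.TTheory GRing.Theory Num.Theory.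
Import numFieldTopology.Exports numFieldNormedType.Exports.

Set Implicit Arguments.
Unset Strict Implicit.
Unset Printing Implicit Defensive.
Local Open Scope classical_set_scope.
Local Open Scope ring_scope.
Local Open Scope complex_scope.

(** * One complex variable *)

(** The field [h] is only measurable in [t], so the second coefficient of the flow is never obtained
    by differentiating the Loewner equation in [z]. It is read off at a small point [zeta e_j] from
    estimates whose constants do not depend on the field: positivity of [Re <h(z), z>] bounds every
    component of every [h] in [Mcal] by [1 / 2] on one fixed ball, and Cauchy estimates turn this
    into uniform Taylor remainders. A derivative in time that is known almost everywhere is not
    integrated; a locally Lipschitz auxiliary function is shown to be nonincreasing. Near 0 the flow
    decays only like [expR (- (1 - 8 |zeta|) t)], which costs a factor [1 - 16 |zeta|] that tends to
    1. In the averaging curve the weight [v ^ 2] on [e_i] matches the degree of the term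
    [q(h) z_j ^ 2] with which it is paired. For the extremal maps, a solution must stay in the ball
    for all time; with the critical coefficient [3 * sqrt 3 / 2] this comes down to a polynomial
    inequality in two variables with an equality case on the boundary. *)

Section ComplexModulus.
Context {R : realType}.
Implicit Types (z w : R[i]) (x y : R).

Lemma cmodE z : `|z| = (cmod z)%:C.
Proof. by []. Qed.

Lemma cmod_ge0 z : 0 <= cmod z.
Proof. by case: z => a b; rewrite /cmod /= sqrtr_ge0. Qed.

Lemma sqr_cmod z : cmod z ^+ 2 = complex.Re z ^+ 2 + complex.Im z ^+ 2.
Proof. by case: z => a b; rewrite /cmod /= sqr_sqrtr // addr_ge0 // sqr_ge0. Qed.

Lemma cmodM z w : cmod (z * w) = cmod z * cmod w.
Proof. exact: Normc.normcM. Qed.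

Lemma cmodD z w : cmod (z + w) <= cmod z + cmod w.
Proof. exact: le_normcD. Qed.

Lemma cmodN z : cmod (- z) = cmod z.
Proof. exact: normcN. Qed.

Lemma cmodB z w : cmod (z - w) <= cmod z + cmod w.
Proof. by rewrite -(cmodN w) cmodD. Qed.

Lemma cmod_distC z w : cmod (z - w) = cmod (w - z).
Proof. by rewrite -cmodN opprB. Qed.

Lemma cmod0 : cmod (0 : R[i]) = 0.
Proof. exact: Normc.normc0. Qed.

Lemma cmod1 : cmod (1 : R[i]) = 1.
Proof. exact: Normc.normc1. Qed.

Lemma cmodV z : cmod z^-1 = (cmod z)^-1.
Proof. exact: Normc.normcV. Qed.

Lemma cmodX z k : cmod (z ^+ k) = cmod z ^+ k.
Proof.
elim: k => [|k IH]; first by rewrite !expr0 cmod1.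
by rewrite !exprS cmodM IH.
Qed.

Lemma cmod_real x : cmod x%:C = `|x|.
Proof. by rewrite /cmod /= expr0n /= addr0 sqrtr_sqr. Qed.

Lemma cmod_i : cmod ('i%C : R[i]) = 1.
Proof. by rewrite /cmod /= expr0n expr1n /= add0r sqrtr1. Qed.

Lemma cmod_conj z : cmod z^*%C = cmod z.
Proof. by case: z => a b; rewrite /cmod /= sqrrN. Qed.

Lemma cmod_eq0 z : (cmod z == 0) = (z == 0).
Proof.
apply/eqP/eqP => [/Normc.eq0_normc //|->]; exact: cmod0.
Qed.

Lemma cmod_gt0 z : (0 < cmod z) = (z != 0).
Proof. by rewrite lt_def cmod_ge0 andbT cmod_eq0. Qed.

Lemma absRe_le z : `|complex.Re z| <= cmod z.
Proof.
by rewrite -sqrtr_sqr /cmod; case: z => a b /=; rewrite ler_wsqrtr // lerDl sqr_ge0.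
Qed.

Lemma absIm_le z : `|complex.Im z| <= cmod z.
Proof.
by rewrite -sqrtr_sqr /cmod; case: z => a b /=; rewrite ler_wsqrtr // lerDr sqr_ge0.
Qed.

Lemma Re_le_cmod z : complex.Re z <= cmod z.
Proof. exact: le_trans (ler_norm _) (absRe_le z). Qed.

Lemma cmod_le z : cmod z <= `|complex.Re z| + `|complex.Im z|.
Proof.
rewrite -(ler_pXn2r (n := 2)) // ?nnegrE ?cmod_ge0 ?addr_ge0 //.
rewrite sqr_cmod sqrrD !real_normK ?num_real // lerD2r lerDl.
by rewrite mulrn_wge0 // mulr_ge0.
Qed.

Lemma cReD z w : complex.Re (z + w) = complex.Re z + complex.Re w.
Proof. by case: z w => [? ?] []. Qed.

Lemma cImD z w : complex.Im (z + w) = complex.Im z + complex.Im w.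
Proof. by case: z w => [? ?] []. Qed.

Lemma cReN z : complex.Re (- z) = - complex.Re z.
Proof. by case: z. Qed.

Lemma cImN z : complex.Im (- z) = - complex.Im z.
Proof. by case: z. Qed.

Lemma cReM z w : complex.Re (z * w) =
  complex.Re z * complex.Re w - complex.Im z * complex.Im w.
Proof. by case: z w => [? ?] []. Qed.

Lemma cImM z w : complex.Im (z * w) =
  complex.Re z * complex.Im w + complex.Im z * complex.Re w.
Proof. by case: z w => [? ?] []. Qed.

Lemma cReC z : complex.Re z^*%C = complex.Re z.
Proof. by case: z. Qed.

Lemma cImC z : complex.Im z^*%C = - complex.Im z.
Proof. by case: z. Qed.

Lemma cReMr x z : complex.Re (x%:C * z) = x * complex.Re z.
Proof. by rewrite cReM /= mul0r subr0. Qed.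

Lemma cImMr x z : complex.Im (x%:C * z) = x * complex.Im z.
Proof. by rewrite cImM /= mul0r addr0. Qed.

Lemma cRe_sum (I : Type) (r : seq I) (P : pred I) (F : I -> R[i]) :
  complex.Re (\sum_(i <- r | P i) F i) = \sum_(i <- r | P i) complex.Re (F i).
Proof. exact: (big_morph _ cReD). Qed.

Lemma complexP z w :
  complex.Re z = complex.Re w -> complex.Im z = complex.Im w -> z = w.
Proof. by case: z w => [? ?] [? ?] /= -> ->. Qed.

Lemma mulcJ z : z * z^*%C = (cmod z ^+ 2)%:C.
Proof.
apply: complexP; rewrite ?cReM ?cImM cReC cImC /= ?sqr_cmod; ring.
Qed.

Lemma cmod_sum (I : Type) (r : seq I) (P : pred I) (F : I -> R[i]) :
  cmod (\sum_(i <- r | P i) F i) <= \sum_(i <- r | P i) cmod (F i).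
Proof.
elim/big_rec2 : _ => [|i x z _ h]; first by rewrite cmod0.
by apply: le_trans (cmodD _ _) _; rewrite lerD2l.
Qed.

Lemma unimodular_align z : exists2 c : R[i], cmod c = 1 & c * z = (cmod z)%:C.
Proof.
have [->|z0] := eqVneq z 0; first by exists 1; rewrite ?cmod1 // mulr0 cmod0.
have m0 : (cmod z)%:C != 0 :> R[i].
  by apply/eqP => -[/eqP]; rewrite cmod_eq0 (negbTE z0).
exists ((cmod z)%:C^-1 * z^*%C).
  rewrite cmodM cmodV cmod_conj cmod_real ger0_norm ?cmod_ge0 // mulVf //.
  by rewrite cmod_eq0.
by rewrite -mulrA (mulrC _ z) mulcJ rmorphXn expr2 mulKf.
Qed.

(** Rotating [z] onto the positive axis reduces a bound on a modulus to real linear bounds; complex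
    integrals and flows are estimated through real ones in this way. *)
Lemma cmod_le_Re z K :
  (forall c, cmod c = 1 -> complex.Re (c * z) <= K) -> cmod z <= K.
Proof.
by move=> H; have [c /H h e] := unimodular_align z; rewrite e in h.
Qed.

Lemma cmod_nneg x : 0 <= x -> cmod x%:C = x.
Proof. by move=> x0; rewrite cmod_real ger0_norm. Qed.

Lemma sqr_cmodB z w : cmod (z - w) ^+ 2 =
  cmod z ^+ 2 - 2 * complex.Re (z * w^*%C) + cmod w ^+ 2.
Proof. by rewrite !sqr_cmod cReM cReC cImC cReD cImD cReN cImN; ring. Qed.

End ComplexModulus.

(** * Compactness of segments and rectangles *)

Section Covering.
Context {R : realType}.

(** Continuous induction: the supremum of the points reachable from [a] is reachable, and unless it
    is [b] the local hypothesis leads past it. Only intervals containing [t] occur in that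
    hypothesis, so comparisons with the value at [t] suffice to verify it. *)
Lemma cousin (P : R -> R -> Prop) (a b : R) : a <= b ->
  (forall x y z, a <= x -> x <= y -> y <= z -> z <= b ->
     P x y -> P y z -> P x z) ->
  (forall t, a <= t -> t <= b -> exists2 d, 0 < d & forall s s',
     a <= s -> s <= t -> t <= s' -> s' <= b -> t - s < d -> s' - t < d ->
     P s s') ->
  P a b.
Proof.
move=> ab tr loc.
pose S := [set t | a <= t <= b /\ P a t].
have Sa : S a.
  split; first by rewrite lexx ab.
  have [d d0 h] := loc a (lexx a) ab; apply: h => //; rewrite subrr //.
have Sb : ubound S b by move=> t [/andP[]].
have hS : has_sup S by split; [exists a | exists b].
pose c := sup S.
have ac : a <= c by apply: sup_upper_bound.
have cb : c <= b by apply: ge_sup => //; exists a.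
have [d d0 h] := loc c ac cb.
have [t [/andP[at_ tb] Pat] ct] := sup_adherent d0 hS.
have tc : t <= c by apply: sup_upper_bound => //; split => //; rewrite at_ tb.
have Ptc : P t c by apply: h => //; rewrite ?subrr //; rewrite -/c in ct; lra.
have Pac : P a c by apply: tr Pat Ptc.
have [cltb|] := ltP c b; last by move=> bc; have -> : b = c by lra.
pose s' := Num.min (c + d / 2) b.
have s'c : c < s' by rewrite lt_min cltb andbT; lra.
have s'b : s' <= b by rewrite ge_min lexx orbT.
have s'd : s' <= c + d / 2 by rewrite ge_min lexx.
have Ss' : S s'.
  split; first by apply/andP; split=> //; lra.
  by apply: (tr a c s') => //; [lra | apply: h => //; lra].
have := sup_upper_bound hS Ss'; rewrite -/c; lra.
Qed.

(** Here [s] is the scale of a rectangle with lower left corner [(x, y)] and sides [s * W], [s * H].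
    A failing rectangle has a failing quarter, and the nested quarters shrink to a point where the
    local hypothesis is violated. *)
Lemma bisection2 (P : R -> R -> R -> Prop) (x0 y0 W H : R) :
  0 <= W -> 0 <= H ->
  (forall x y s, 0 < s ->
     x0 <= x -> x + s * W <= x0 + W -> y0 <= y -> y + s * H <= y0 + H ->
     P x y (s / 2) -> P (x + s / 2 * W) y (s / 2) ->
     P x (y + s / 2 * H) (s / 2) -> P (x + s / 2 * W) (y + s / 2 * H) (s / 2) ->
     P x y s) ->
  (forall p q, x0 <= p -> p <= x0 + W -> y0 <= q -> q <= y0 + H ->
     exists2 d, 0 < d & forall x y s, 0 < s -> s < d ->
       x0 <= x -> x + s * W <= x0 + W -> y0 <= y -> y + s * H <= y0 + H ->
       x <= p -> p <= x + s * W -> y <= q -> q <= y + s * H -> P x y s) ->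
  P x0 y0 1.
Proof.
move=> W0 H0 quarter loc; apply: contrapT => nP.
pose good (s : R) (u : R * R) :=
  [/\ x0 <= u.1, u.1 + s * W <= x0 + W, y0 <= u.2, u.2 + s * H <= y0 + H
    & ~ P u.1 u.2 s].
pose sub (s : R) (u v : R * R) := [/\ u.1 <= v.1, v.1 + s / 2 * W <= u.1 + s * W,
  u.2 <= v.2 & v.2 + s / 2 * H <= u.2 + s * H].
(* The implication makes the choice of a failing quarter total; at rectangles that do not fail the
   value [(0, 0)] is a dummy. *)
have step (su : R * (R * R)) : exists v,
    0 < su.1 -> good su.1 su.2 -> good (su.1 / 2) v /\ sub su.1 su.2 v.
  case: su => s [x y] /=.
  have [[s0 [/= g1 g2 g3 g4 g5]]|nh] := pselect (0 < s /\ good s (x, y)); last first.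
    by exists (0, 0) => h1 h2; case: nh.
  have sW : 0 <= s * W by apply: mulr_ge0 => //; lra.
  have sH : 0 <= s * H by apply: mulr_ge0 => //; lra.
  have eW : s / 2 * W = s * W / 2 by ring.
  have eH : s / 2 * H = s * H / 2 by ring.
  apply: contrapT => nE; apply: g5; apply: quarter => //; apply: contrapT => np;
    apply: nE.
  - by exists (x, y) => _ _; split; split => //=; rewrite ?eW ?eH; lra.
  - by exists (x + s / 2 * W, y) => _ _; split; split => //=; rewrite ?eW ?eH; lra.
  - by exists (x, y + s / 2 * H) => _ _; split; split => //=; rewrite ?eW ?eH; lra.
  - by exists (x + s / 2 * W, y + s / 2 * H) => _ _; split; split => //=;
      rewrite ?eW ?eH; lra.
have [f fP] := choice step.
pose u := fix u n := if n is m.+1 then f ((2^-1) ^+ m, u m) else (x0, y0).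
have sc0 n : 0 < (2^-1 : R) ^+ n by rewrite exprn_gt0.
have gu n : good ((2^-1) ^+ n) (u n).
  elim: n => [|n IH]; first by split; rewrite /= ?expr0 ?mul1r.
  by have [+ _] := fP ((2^-1) ^+ n, u n) (sc0 n) IH; rewrite exprSr.
have su n : sub ((2^-1) ^+ n) (u n) (u n.+1).
  by have [_] := fP ((2^-1) ^+ n, u n) (sc0 n) (gu n).
have nest n m : (n <= m)%N ->
  [/\ (u n).1 <= (u m).1, (u m).1 + (2^-1) ^+ m * W <= (u n).1 + (2^-1) ^+ n * W,
   (u n).2 <= (u m).2 & (u m).2 + (2^-1) ^+ m * H <= (u n).2 + (2^-1) ^+ n * H].
  elim: m => [|m IH]; first by rewrite leqn0 => /eqP ->.
  rewrite leq_eqVlt => /orP[/eqP <- //|/IH [a1 a2 a3 a4]].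
  have [b1 b2 b3 b4] := su m; rewrite !exprSr.
  by split; [exact: le_trans b1|exact: le_trans b2 a2|exact: le_trans b3
            |exact: le_trans b4 a4].
(* Nested intervals for one coordinate, with the supremum of the left ends as limit point; applied
   to both projections. *)
have point (g : R * R -> R) (K : R) :
    0 <= K ->
    (forall n m, (n <= m)%N -> g (u n) <= g (u m)) ->
    (forall n m, (n <= m)%N -> g (u m) + (2^-1) ^+ m * K <= g (u n) + (2^-1) ^+ n * K) ->
    exists p, forall n, g (u n) <= p <= g (u n) + (2^-1) ^+ n * K.
  move=> K0 mono anti.
  have bnd n m : g (u m) <= g (u n) + (2^-1) ^+ n * K.
    have [nm|/ltnW mn] := leqP n m.
      by apply: le_trans (anti _ _ nm); rewrite lerDl mulr_ge0 // ltW.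
    by apply: le_trans (mono _ _ mn) _; rewrite lerDl mulr_ge0 // ltW.
  pose S := range (fun n => g (u n)).
  have hS : has_sup S.
    by split; [exists (g (u 0%N)), 0%N|exists (g (u 0%N) + (2^-1) ^+ 0 * K) => _ [m _ <-]].
  exists (sup S) => n; apply/andP; split.
    by apply: sup_upper_bound => //; exists n.
  by apply: ge_sup; [exact: hS.1|move=> _ [m _ <-]].
have [p pP] := point fst W W0 (fun n m nm => let: And4 a _ _ _ := nest n m nm in a)
   (fun n m nm => let: And4 _ a _ _ := nest n m nm in a).
have [q qP] := point snd H H0 (fun n m nm => let: And4 _ _ a _ := nest n m nm in a)
   (fun n m nm => let: And4 _ _ _ a := nest n m nm in a).
have /= := pP 0%N; rewrite expr0 mul1r => /andP[p1 p2].
have /= := qP 0%N; rewrite expr0 mul1r => /andP[q1 q2].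
have [d d0 hd] := loc p q p1 p2 q1 q2.
have [N hN] : exists N, (2^-1 : R) ^+ N < d.
  have h : (2^-1 : R) ^+ n @[n --> \oo] --> 0 by apply: cvg_expr; rewrite ger0_norm; lra.
  have [N _ /(_ N (leqnn N))] := (cvgrPdist_lt _ _).1 h d d0.
  by rewrite /= sub0r normrN ger0_norm ?ltW // => ?; exists N.
have [g1 g2 g3 g4 g5] := gu N.
have /andP[? ?] := pP N; have /andP[? ?] := qP N.
by apply: g5; apply: hd.
Qed.

End Covering.


(** * Integrals of complex functions of a real variable *)

Section ContinuousCurves.
Context {R : realType}.
Implicit Types (f g : R -> R[i]) (x y a b : R).

Definition ccontin f x := forall eps : R, 0 < eps ->
  exists2 d, 0 < d & forall y, `|y - x| < d -> cmod (f y - f x) <= eps.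

Lemma ccontin_cst (c : R[i]) x : ccontin (fun=> c) x.
Proof. by move=> e e0; exists 1 => // y _; rewrite subrr cmod0 ltW. Qed.

Lemma ccontinD f g x : ccontin f x -> ccontin g x ->
  ccontin (fun t => f t + g t) x.
Proof.
move=> cf cg e e0.
have [d d0 hd] := cf _ (divr_gt0 e0 (ltr0n R 2)); have [d' d'0 hd'] := cg _ (divr_gt0 e0 (ltr0n R 2)).
exists (Num.min d d'); first by rewrite lt_min d0.
move=> y; rewrite lt_min => /andP[/hd h1 /hd' h2].
rewrite opprD addrACA; apply: le_trans (cmodD _ _) _.
by rewrite (splitr e) lerD.
Qed.

Lemma ccontinM f g x : ccontin f x -> ccontin g x ->
  ccontin (fun t => f t * g t) x.
Proof.
move=> cf cg e e0.
pose K := cmod (f x) + cmod (g x) + 1.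
have K0 : 0 < K by rewrite ltr_wpDl // addr_ge0 // cmod_ge0.
have eK : 0 < Num.min 1 (e / K / 2) by rewrite lt_min ltr01 /= !divr_gt0.
have [d d0 hd] := cf _ eK; have [d' d'0 hd'] := cg _ eK.
exists (Num.min d d'); first by rewrite lt_min d0.
move=> y; rewrite lt_min => /andP[/hd h1 /hd' h2].
move: h1 h2; rewrite !le_min => /andP[h1 h1'] /andP[h2 h2'].
have -> : f y * g y - f x * g x =
   (f y - f x) * (g y - g x) + (f x * (g y - g x) + (f y - f x) * g x) by ring.
apply: le_trans (cmodD _ _) _.
apply: le_trans (lerD (lexx _) (cmodD _ _)) _.
rewrite !cmodM.
have p := cmod_ge0 (f y - f x); have q := cmod_ge0 (g y - g x).
have s := cmod_ge0 (f x); have t := cmod_ge0 (g x).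
have eE : e = 2 * (e / K / 2) * K by field; rewrite gt_eqF.
set E := e / K / 2 in h1' h2' eE.
have E0 : 0 < E by rewrite /E !divr_gt0.
clearbody E; rewrite eE /K; clear eE; move: p q s t h1 h1' h2 h2' E0.
move: (cmod (f y - f x)) (cmod (g y - g x)) (cmod (f x)) (cmod (g x)) E.
clear; move=> A B C D E A0 B0 C0 D0 A1 AE B1 BE E0.
have h1 : A * B <= 1 * E by apply: ler_pM.
have h2 : C * B <= C * E by apply: ler_pM.
have h3 : A * D <= E * D by apply: ler_pM.
have h4 : 0 <= C * E by apply: mulr_ge0 => //; exact: ltW.
have h5 : 0 <= E * D by apply: mulr_ge0 => //; exact: ltW.
have -> : 2 * E * (C + D + 1) = 2 * (C * E) + 2 * (E * D) + 2 * E by ring.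
lra.
Qed.

Lemma ccontinN f x : ccontin f x -> ccontin (fun t => - f t) x.
Proof.
by move=> cf e /cf[d d0 hd]; exists d => // y /hd; rewrite -opprD cmodN.
Qed.

Lemma ccontinB f g x : ccontin f x -> ccontin g x ->
  ccontin (fun t => f t - g t) x.
Proof. by move=> cf cg; apply: ccontinD => //; exact: ccontinN. Qed.

Lemma ccontin_conj f x : ccontin f x -> ccontin (fun t => (f t)^*%C) x.
Proof.
by move=> cf e /cf[d d0 hd]; exists d => // y /hd; rewrite -rmorphB cmod_conj.
Qed.

(** Continuity at the endpoints is two-sided: the curves integrated below are defined beyond their
    intervals. *)
Definition cont_on a b f := forall x, a <= x -> x <= b -> ccontin f x.

Local Notation mu := (@lebesgue_measure R).

Definition cint a b f : R[i] :=
  (\int[mu]_(x in `[a, b]) complex.Re (f x)) +i*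
  (\int[mu]_(x in `[a, b]) complex.Im (f x)).

Lemma cont_on_Re a b f : cont_on a b f ->
  mu.-integrable `[a, b] (EFin \o (fun x => complex.Re (f x))).
Proof.
move=> cf; apply: continuous_compact_integrable; first exact: segment_compact.
apply: continuous_in_subspaceT => x /set_mem /=; rewrite in_itv /= => /andP[ax xb].
apply/cvgrPdist_le => e e0; have [d d0 hd] := cf x ax xb e e0.
near=> y; rewrite -cReN -cReD; apply: le_trans (absRe_le _) _.
rewrite cmod_distC; apply: hd; rewrite distrC.
near: y; exists d => //.
Unshelve. all: by end_near. Qed.

Lemma cont_on_i a b f : cont_on a b f -> cont_on a b (fun x => - 'i%C * f x).
Proof. by move=> cf x ax xb; apply: ccontinM; [exact: ccontin_cst|exact: cf]. Qed.

(** Lets facts about imaginary parts be deduced from those about real parts. *)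
Lemma cRe_i (z : R[i]) : complex.Re (- 'i%C * z) = complex.Im z.
Proof. by rewrite cReM /=; ring. Qed.

Lemma cont_on_Im a b f : cont_on a b f ->
  mu.-integrable `[a, b] (EFin \o (fun x => complex.Im (f x))).
Proof.
move=> /cont_on_i/cont_on_Re; congr (mu.-integrable _ _).
by apply/funext => x /=; rewrite cRe_i.
Qed.

Lemma eq_cint a b f g : (forall x, a <= x -> x <= b -> f x = g x) ->
  cint a b f = cint a b g.
Proof.
by move=> fg; congr Complex; apply: eq_Rintegral => x /set_mem /=;
  rewrite in_itv /= => /andP[? ?]; rewrite fg.
Qed.

Lemma cintD a b f g : cont_on a b f -> cont_on a b g ->
  cint a b (fun x => f x + g x) = cint a b f + cint a b g.
Proof.
move=> cf cg; apply: complexP; rewrite ?cReD ?cImD /=.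
  under eq_Rintegral do rewrite cReD.
  by rewrite RintegralD //; exact: cont_on_Re.
under eq_Rintegral do rewrite cImD.
by rewrite RintegralD //; exact: cont_on_Im.
Qed.

Lemma cintZ a b (c : R[i]) f : cont_on a b f ->
  cint a b (fun x => c * f x) = c * cint a b f.
Proof.
move=> cf.
have cr (r : R) : cont_on a b (fun x => r%:C * f x).
  by move=> x ax xb; apply: ccontinM; [exact: ccontin_cst|exact: cf].
have iR := cont_on_Re cf; have iI := cont_on_Im cf.
have rR (r : R) : mu.-integrable `[a, b] (EFin \o (fun x => r * complex.Re (f x))).
  have := cont_on_Re (cr r); congr (mu.-integrable _ _).
  by apply/funext => x /=; rewrite cReMr.
have rI (r : R) : mu.-integrable `[a, b] (EFin \o (fun x => r * complex.Im (f x))).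
  have := cont_on_Im (cr r); congr (mu.-integrable _ _).
  by apply/funext => x /=; rewrite cImMr.
apply: complexP; rewrite ?cReM ?cImM /=.
  under eq_Rintegral do rewrite cReM.
  by rewrite RintegralB // !RintegralZl.
under eq_Rintegral do rewrite cImM.
by rewrite RintegralD // !RintegralZl.
Qed.

Lemma cint_cst a b (c : R[i]) : a <= b -> cint a b (fun=> c) = c * (b - a)%:C.
Proof.
move=> ab.
have m : fine (mu `[a, b]) = b - a.
  rewrite lebesgue_measure_itv /= lte_fin; case: ltP => //= ba.
  by lra.
by apply: complexP; rewrite ?cReM ?cImM /= Rintegral_cst // m; ring.
Qed.

Lemma cintB a b f g : cont_on a b f -> cont_on a b g ->
  cint a b (fun x => f x - g x) = cint a b f - cint a b g.
Proof.
move=> cf cg; rewrite -mulN1r -cintZ // -cintD //.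
  by apply: eq_cint => x _ _; rewrite mulN1r.
by move=> x ax xb; apply: ccontinM; [exact: ccontin_cst|exact: cg].
Qed.

Lemma cint_conj a b f : cont_on a b f ->
  cint a b (fun x => (f x)^*%C) = (cint a b f)^*%C.
Proof.
move=> cf; apply: complexP; rewrite ?cReC ?cImC /=.
  by apply: eq_Rintegral => x _; rewrite cReC.
rewrite -mulN1r -RintegralZl //; last exact: cont_on_Im.
by apply: eq_Rintegral => x _; rewrite cImC mulN1r.
Qed.

Lemma cint_cat a b c f : a <= b -> b <= c -> cont_on a c f ->
  cint a c f = cint a b f + cint b c f.
Proof.
move=> ab bc cf.
have cbc : cont_on b c f by move=> x bx; apply: cf; exact: le_trans bx.
apply: complexP; rewrite ?cReD ?cImD /=.
  have := @Rintegral_itvB R (fun x => complex.Re (f x)) (BLeft a) (BRight c) b (cont_on_Re cf).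
  rewrite !bnd_simp => /(_ ab bc) /eqP; rewrite subr_eq addrC => /eqP ->.
  rewrite Rintegral_itv_obnd_cbnd //.
  by apply: integrableS (cont_on_Re cbc) => //; apply: subset_itvr; rewrite bnd_simp.
have := @Rintegral_itvB R (fun x => complex.Im (f x)) (BLeft a) (BRight c) b (cont_on_Im cf).
rewrite !bnd_simp => /(_ ab bc) /eqP; rewrite subr_eq addrC => /eqP ->.
rewrite Rintegral_itv_obnd_cbnd //.
by apply: integrableS (cont_on_Im cbc) => //; apply: subset_itvr; rewrite bnd_simp.
Qed.

Lemma le_Re_cint a b f g : cont_on a b f -> cont_on a b g ->
  (forall x, a <= x -> x <= b -> complex.Re (f x) <= complex.Re (g x)) ->
  complex.Re (cint a b f) <= complex.Re (cint a b g).
Proof.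
move=> cf cg fg /=; apply: le_Rintegral => //; try exact: cont_on_Re.
by move=> x /=; rewrite in_itv /= => /andP[? ?]; exact: fg.
Qed.

(** Rotating the integral onto the positive axis leaves an inequality of real integrals. The
    majorant is the real part of a complex [g], so that it may be a holomorphic function whose
    average is known. *)
Lemma cmod_cint_le_Re a b f g : cont_on a b f -> cont_on a b g ->
  (forall x, a <= x -> x <= b -> cmod (f x) <= complex.Re (g x)) ->
  cmod (cint a b f) <= complex.Re (cint a b g).
Proof.
move=> cf cg fg; apply: cmod_le_Re => c c1.
have cc : cont_on a b (fun x => c * f x).
  by move=> x ax xb; apply: ccontinM; [exact: ccontin_cst|exact: cf].
rewrite -cintZ //; apply: le_Re_cint => // x ax xb.
by apply: le_trans (Re_le_cmod _) _; rewrite cmodM c1 mul1r fg.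
Qed.

Lemma cmod_cint_le a b f K : a <= b -> cont_on a b f ->
  (forall x, a <= x -> x <= b -> cmod (f x) <= K) ->
  cmod (cint a b f) <= K * (b - a).
Proof.
move=> ab cf fK.
have := @cmod_cint_le_Re a b f (fun=> K%:C) cf.
by rewrite cint_cst // cReMr /=; apply => // x _ _; exact: ccontin_cst.
Qed.

End ContinuousCurves.


(** * Complex derivatives and the mean value inequality *)

Section ComplexDerivative.
Context {R : realType}.
Implicit Types (F G Q : R[i] -> R[i]) (w a l : R[i]) (eps r s x y : R).

Definition cderiv F a l := forall eps, 0 < eps ->
  exists2 d, 0 < d & forall w, cmod (w - a) < d ->
    cmod (F w - F a - l * (w - a)) <= eps * cmod (w - a).

Definition cdiff F a := exists l, cderiv F a l.

Lemma cderiv_local F G a l : F a = G a ->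
  (exists2 d, 0 < d & forall w, cmod (w - a) < d -> F w = G w) ->
  cderiv F a l -> cderiv G a l.
Proof.
move=> ea [d d0 hd] dF e e0; have [d' d'0 hd'] := dF e e0.
exists (Num.min d d'); first by rewrite lt_min d0.
by move=> w; rewrite lt_min => /andP[/hd <- /hd' h]; rewrite -ea.
Qed.

Lemma cderiv_cst (c : R[i]) a : cderiv (fun=> c) a 0.
Proof.
move=> e e0; exists 1 => // w _.
by rewrite subrr mul0r subr0 cmod0 mulr_ge0 ?cmod_ge0 ?ltW.
Qed.

Lemma cderiv_id a : cderiv id a 1.
Proof.
move=> e e0; exists 1 => // w _.
by rewrite mul1r subrr cmod0 mulr_ge0 ?cmod_ge0 ?ltW.
Qed.

Lemma cderiv_cont F a l : cderiv F a l ->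
  exists2 d, 0 < d & forall w, cmod (w - a) < d ->
    cmod (F w - F a) <= (cmod l + 1) * cmod (w - a).
Proof.
move=> /(_ _ ltr01) [d d0 hd]; exists d => // w /hd h.
have -> : F w - F a = (F w - F a - l * (w - a)) + l * (w - a) by ring.
by apply: le_trans (cmodD _ _) _; rewrite cmodM mulrDl mul1r addrC lerD2l -[leRHS]mul1r.
Qed.

Lemma cderivD F G a l m : cderiv F a l -> cderiv G a m ->
  cderiv (fun w => F w + G w) a (l + m).
Proof.
move=> dF dG e e0; have e2 : 0 < e / 2 by lra.
have [d d0 hd] := dF _ e2; have [d' d'0 hd'] := dG _ e2.
exists (Num.min d d'); first by rewrite lt_min d0.
move=> w; rewrite lt_min => /andP[/hd h1 /hd' h2].
have -> : F w + G w - (F a + G a) - (l + m) * (w - a) =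
  (F w - F a - l * (w - a)) + (G w - G a - m * (w - a)) by ring.
apply: le_trans (cmodD _ _) _; have -> : e = e / 2 + e / 2 by lra.
by rewrite mulrDl lerD.
Qed.

Lemma cderivM F G a l m : cderiv F a l -> cderiv G a m ->
  cderiv (fun w => F w * G w) a (l * G a + F a * m).
Proof.
move=> dF dG e e0.
pose K := cmod (G a) + cmod (F a) + (cmod l + 1) + 1.
have K0 : 0 < K by rewrite /K; have := cmod_ge0 (G a); have := cmod_ge0 (F a);
  have := cmod_ge0 l; lra.
have eK : 0 < e / K by apply: divr_gt0.
have [d d0 hd] := dF _ eK; have [d' d'0 hd'] := dG _ eK.
have [d1 d10 hd1] := cderiv_cont dF; have [d2 d20 hd2] := cderiv_cont dG.
pose d3 := e / K / (cmod m + 1).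
have m1 : 0 < cmod m + 1 by have := cmod_ge0 m; lra.
have d30 : 0 < d3 by rewrite /d3 !divr_gt0.
exists (Num.min (Num.min d d') (Num.min (Num.min d1 d2) d3)).
  by rewrite !lt_min d0 d'0 d10 d20 d30.
move=> w; rewrite !lt_min => /andP[/andP[/hd h1 /hd' h2] /andP[/andP[/hd1 h3 /hd2 h4] h5]].
have -> : F w * G w - F a * G a - (l * G a + F a * m) * (w - a) =
  (F w - F a - l * (w - a)) * G a + (F a * (G w - G a - m * (w - a)) +
   (F w - F a) * (G w - G a)) by ring.
apply: le_trans (cmodD _ _) _; apply: le_trans (lerD (lexx _) (cmodD _ _)) _.
rewrite !cmodM.
have g0 := cmod_ge0 (G a); have f0 := cmod_ge0 (F a); have l0 := cmod_ge0 l.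
have w0 := cmod_ge0 (w - a).
have t1 : cmod (F w - F a - l * (w - a)) * cmod (G a) <= e / K * cmod (w - a) * cmod (G a).
  by apply: ler_wpM2r.
have t2 : cmod (F a) * cmod (G w - G a - m * (w - a)) <= cmod (F a) * (e / K * cmod (w - a)).
  by apply: ler_wpM2l.
have t3 : cmod (F w - F a) * cmod (G w - G a) <=
    (cmod l + 1) * cmod (w - a) * (e / K).
  apply: ler_pM; rewrite ?cmod_ge0 //; apply: le_trans h4 _.
  by rewrite mulrC -ler_pdivlMr // ltW.
have -> : e * cmod (w - a) = e / K * cmod (w - a) * K by field; rewrite gt_eqF.
have t4 : 0 <= e / K * cmod (w - a) by rewrite mulr_ge0 // ltW.
rewrite {2}/K; move: t1 t2 t3 t4; move: (e / K) (cmod (w - a)) => A B.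
move: (cmod (G a)) (cmod (F a)) (cmod l) => C D E.
move: (_ * C) (D * cmod _) (cmod _ * cmod _) => X Y Z.
have -> : A * B * (C + D + (E + 1) + 1) = A * B * C + D * (A * B) + (E + 1) * B * A + A * B
  by ring.
lra.
Qed.

Lemma cderiv_comp F G a l m : cderiv G a m -> cderiv F (G a) l ->
  cderiv (fun w => F (G w)) a (l * m).
Proof.
move=> dG dF e e0.
have [d1 d10 hd1] := cderiv_cont dG.
pose K := cmod m + 1 + cmod l + 1.
have m0 := cmod_ge0 m; have l0 := cmod_ge0 l.
have K0 : 0 < K by rewrite /K; lra.
have eK : 0 < e / K by apply: divr_gt0.
have [d d0 hd] := dF _ eK; have [d' d'0 hd'] := dG _ eK.
have m1 : 0 < cmod m + 1 by lra.
exists (Num.min (Num.min d' d1) (d / (cmod m + 1))).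
  by rewrite !lt_min d'0 d10 divr_gt0.
move=> w; rewrite !lt_min => /andP[/andP[/hd' h1 /hd1 h2] h3].
have w0 := cmod_ge0 (w - a).
have : cmod (G w - G a) < d.
  by apply: le_lt_trans h2 _; rewrite mulrC -ltr_pdivlMr.
move=> /hd h4.
have -> : F (G w) - F (G a) - l * m * (w - a) =
  (F (G w) - F (G a) - l * (G w - G a)) + l * (G w - G a - m * (w - a)) by ring.
apply: le_trans (cmodD _ _) _; rewrite cmodM.
have t1 : cmod l * cmod (G w - G a - m * (w - a)) <= cmod l * (e / K * cmod (w - a)).
  by apply: ler_wpM2l.
have t2 : e / K * cmod (G w - G a) <= e / K * ((cmod m + 1) * cmod (w - a)).
  by apply: ler_wpM2l => //; exact: ltW.
have -> : e * cmod (w - a) = e / K * cmod (w - a) * K by field; rewrite gt_eqF.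
have t4 : 0 <= e / K * cmod (w - a) by rewrite mulr_ge0 // ltW.
rewrite {2}/K; move: h4 t1 t2 t4; move: (e / K) (cmod (w - a)) => A B.
move: (cmod l) (cmod m) => D E.
move: (cmod _) (D * cmod _) (A * cmod _) => X Y Z.
have -> : A * B * (E + 1 + D + 1) = D * (A * B) + A * ((E + 1) * B) + A * B by ring.
lra.
Qed.

Lemma cderivN F a l : cderiv F a l -> cderiv (fun w => - F w) a (- l).
Proof.
move=> dF e /dF[d d0 hd]; exists d => // w /hd.
by rewrite -cmodN; congr (cmod _ <= _); ring.
Qed.

Lemma cderivB F G a l m : cderiv F a l -> cderiv G a m ->
  cderiv (fun w => F w - G w) a (l - m).
Proof. by move=> dF dG; apply: cderivD => //; exact: cderivN. Qed.

Lemma cderivZ F a l (c : R[i]) : cderiv F a l -> cderiv (fun w => c * F w) a (c * l).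
Proof.
move=> dF; have := cderivM (cderiv_cst c a) dF.
by rewrite mul0r add0r.
Qed.

Lemma cderivX a k : cderiv (fun w => w ^+ k.+1) a (k.+1%:R * a ^+ k).
Proof.
elim: k => [|k IH]; first by rewrite mulr1; exact: cderiv_id.
have := cderivM (cderiv_id a) IH.
have -> : 1 * a ^+ k.+1 + id a * (k.+1%:R * a ^+ k) = k.+2%:R * a ^+ k.+1.
  by rewrite [k.+2%:R]mulrSr !exprS; ring.
by congr cderiv; apply/funext => w; rewrite [RHS]exprS.
Qed.

Lemma cderivV a : a != 0 -> cderiv (fun w => w^-1) a (- a^-2).
Proof.
move=> a0 e e0.
have m0 : 0 < cmod a by rewrite cmod_gt0.
(* The radius [cmod a / 2] keeps [|w|] above [|a| / 2]; the other one then controls the exact error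
   [(w - a) ^ 2 / (a ^ 2 * w)]. *)
exists (Num.min (cmod a / 2) (e * cmod a ^+ 3 / 2)).
  by rewrite lt_min !divr_gt0 // mulr_gt0 // exprn_gt0.
move=> w; rewrite lt_min => /andP[h1 h2].
have hw : cmod a / 2 < cmod w.
  have : cmod a <= cmod w + cmod (w - a).
    by rewrite -{1}(subKr w a); exact: cmodB.
  lra.
have w0 : w != 0 by rewrite -cmod_gt0; apply: lt_trans hw; rewrite divr_gt0.
have -> : w^-1 - a^-1 - - a^-2 * (w - a) = (w - a) ^+ 2 / (a ^+ 2 * w).
  by field; rewrite w0 a0.
rewrite cmodM cmodV cmodM !cmodX expr2 -mulrA mulrC.
apply: ler_wpM2r; first exact: cmod_ge0.
rewrite ler_pdivrMr; last by rewrite mulr_gt0 ?exprn_gt0 //; lra.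
apply: le_trans (ltW h2) _.
have -> : e * cmod a ^+ 3 / 2 = e * (cmod a ^+ 2 * (cmod a / 2)) by field.
by rewrite !ler_pM2l ?exprn_gt0 // ltW.
Qed.

Lemma cderiv_ccontin F (g : R -> R[i]) x l : ccontin g x -> cderiv F (g x) l ->
  ccontin (fun t => F (g t)) x.
Proof.
move=> cg dF e e0; have [d d0 hd] := cderiv_cont dF.
have l1 : 0 < cmod l + 1 by have := cmod_ge0 l; lra.
have h : 0 < Num.min (d / 2) (e / (cmod l + 1)) by rewrite lt_min !divr_gt0.
have [d' d'0 hd'] := cg _ h; exists d' => // y /hd'.
rewrite le_min => /andP[h1 h2]; apply: le_trans (hd _ _) _; first by lra.
by rewrite mulrC -ler_pdivlMr.
Qed.

(** With slope [K + e'] the bound is additive over adjacent parameter intervals and holds near each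
    parameter by differentiability, so [cousin] applies. The derivative is never integrated, since
    its continuity is not yet known. *)
Lemma mean_value_ineq F (F' : R[i] -> R[i]) a b K :
  (forall t, 0 <= t -> t <= 1 ->
     cderiv F (a + t%:C * (b - a)) (F' (a + t%:C * (b - a)))) ->
  (forall t, 0 <= t -> t <= 1 -> cmod (F' (a + t%:C * (b - a))) <= K) ->
  cmod (F b - F a) <= K * cmod (b - a).
Proof.
move=> dF bF; have n0 := cmod_ge0 (b - a).
have K0 : 0 <= K by apply: le_trans (cmod_ge0 _) (bF 0 _ _).
apply/ler_addgt0Pl => e e0.
(* Adding 1 keeps the denominator positive when [b = a]. *)
pose e' := e / (cmod (b - a) + 1).
have e'0 : 0 < e' by apply: divr_gt0 => //; lra.
pose g t := F (a + t%:C * (b - a)).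
pose P s t := cmod (g t - g s) <= (K + e') * (cmod (b - a) * (t - s)).
have : P 0 1.
  apply: (cousin (P := P)) => // [x y z _ xy yz _ Pxy Pyz|t t0 t1].
    rewrite /P; have -> : g z - g x = (g z - g y) + (g y - g x) by ring.
    apply: le_trans (cmodD _ _) _; have := lerD Pyz Pxy; rewrite -mulrDr -mulrDr.
    by have -> : z - y + (y - x) = z - x by ring.
  have [d d0 hd] := dF t t0 t1 e' e'0.
  have dn : 0 < d / (cmod (b - a) + 1) by apply: divr_gt0 => //; lra.
  have bnd s : `|s - t| < d / (cmod (b - a) + 1) ->
      cmod (g s - g t) <= (K + e') * (cmod (b - a) * `|s - t|).
    have es : a + s%:C * (b - a) - (a + t%:C * (b - a)) = (s - t)%:C * (b - a) by ring.
    have cs : cmod ((s - t)%:C * (b - a)) = cmod (b - a) * `|s - t|.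
      by rewrite cmodM cmod_real mulrC.
    move=> hs; have := hd (a + s%:C * (b - a)); rewrite es cs => /(_ _) h.
    have {}h : cmod (g s - g t - F' (a + t%:C * (b - a)) * ((s - t)%:C * (b - a)))
        <= e' * (cmod (b - a) * `|s - t|).
      apply: h; move: hs; rewrite ltr_pdivlMr; last by lra.
      by apply: le_lt_trans; rewrite mulrC ler_wpM2l //; lra.
    have -> : g s - g t = F' (a + t%:C * (b - a)) * ((s - t)%:C * (b - a)) +
       (g s - g t - F' (a + t%:C * (b - a)) * ((s - t)%:C * (b - a))) by ring.
    apply: le_trans (cmodD _ _) _; rewrite mulrDl; apply: lerD => //.
    by rewrite cmodM cs; apply: ler_wpM2r; [rewrite mulr_ge0|exact: bF].
  exists (d / (cmod (b - a) + 1)) => // s s' _ st ts' _ h1 h2.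
  have b1 := bnd s'; have b2 := bnd s.
  rewrite ger0_norm in b1; last by lra.
  rewrite distrC cmod_distC ger0_norm in b2; last by lra.
  rewrite /P; have -> : g s' - g s = (g s' - g t) + (g t - g s) by ring.
  apply: le_trans (cmodD _ _) _; have := lerD (b1 h2) (b2 h1); rewrite -mulrDr -mulrDr.
  by have -> : s' - t + (t - s) = s' - s by ring.
rewrite /P /g mul0r addr0 mul1r subr0 mulr1 (addrC a) subrK.
move=> /le_trans; apply.
rewrite mulrDl addrC lerD2r.
rewrite /e' mulrAC ler_pdivrMr; last by lra.
by rewrite ler_pM2l //; lra.
Qed.

End ComplexDerivative.


(** * The complex exponential *)

Section ComplexExponential.
Context {R : realType}.
Implicit Types (F G Q : R[i] -> R[i]) (w a : R[i]) (eps l r s x y : R).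

Lemma is_derive_eps (f : R -> R) x l : is_derive x 1 f l ->
  forall eps, 0 < eps -> exists2 d, 0 < d & forall y, `|y - x| < d ->
    `|f y - f x - l * (y - x)| <= eps * `|y - x|.
Proof.
move=> [df fl] e e0.
have : h^-1 *: (f (h *: (1 : R) + x) - f x) @[h --> 0^'] --> l by rewrite -fl; exact: df.
move=> /cvgrPdist_le /(_ e e0) [d /= d0 hd]; exists d => // y yd.
have [->|yx] := eqVneq y x; first by rewrite !subrr mulr0 subrr normr0 mulr0.
have := hd (y - x); rewrite /= sub0r normrN => /(_ yd).
rewrite subr_eq0 => /(_ yx).
rewrite /GRing.scale /= mulr1 subrK => h.
have y0 : 0 < `|y - x| by rewrite normr_gt0 subr_eq0.
rewrite -ler_pdivrMr // -normfV -normrM.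
have -> : (f y - f x - l * (y - x)) / (y - x) = (y - x)^-1 * (f y - f x) - l.
  by field; rewrite subr_eq0.
by rewrite distrC.
Qed.

Definition cis x : R[i] := cos x +i* sin x.

Lemma cisD x y : cis (x + y) = cis x * cis y.
Proof. by apply: complexP; rewrite ?cReM ?cImM /= ?cosD ?sinD; ring. Qed.

Lemma cis0 : cis 0 = 1.
Proof. by rewrite /cis cos0 sin0. Qed.

Lemma cmod_cis x : cmod (cis x) = 1.
Proof. by rewrite /cmod /= cos2Dsin2 sqrtr1. Qed.

Lemma cis2pi : cis (2 * pi) = 1.
Proof. by rewrite mulrC mulr_natr /cis cos2pi sin2pi. Qed.

(** It maps rectangles of height [2 * pi] onto annuli, which turns Goursat's theorem into a
    statement about averages over circles. *)
Definition cexp w : R[i] := (expR (complex.Re w))%:C * cis (complex.Im w).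

Lemma cexpD w a : cexp (w + a) = cexp w * cexp a.
Proof. by rewrite /cexp cReD cImD expRD cisD rmorphM; ring. Qed.

Lemma cmod_cexp w : cmod (cexp w) = expR (complex.Re w).
Proof. by rewrite cmodM cmod_cis mulr1 cmod_nneg // expR_ge0. Qed.

(** The derivatives of [expR], [sin], [cos] at 0 are 1, 1, 0, and products of increments are of
    second order. The functional equation then carries this derivative to every point. *)
Lemma cderiv_cexp0 : cderiv cexp 0 1.
Proof.
move=> e e0; pose k := Num.min 1 e / 8.
have e8 : 0 < k by rewrite divr_gt0 // lt_min ltr01.
have k1 : k <= 1 / 8 by rewrite /k ler_pM2r ?invr_gt0 // ge_min lexx.
have ke : k <= e / 8 by rewrite /k ler_pM2r ?invr_gt0 // ge_min lexx orbT.
have [d1 d10 h1] := is_derive_eps (is_derive_expR (0 : R)) e8.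
have [d2 d20 h2] := is_derive_eps (is_derive_sin (0 : R)) e8.
have [d3 d30 h3] := is_derive_eps (is_derive_cos (0 : R)) e8.
exists (Num.min (Num.min 1 (e / 100)) (Num.min (Num.min d1 d2) d3)).
  by rewrite !lt_min ltr01 d10 d20 d30 /= andbT; lra.
move=> w; rewrite subr0 !lt_min => /andP[/andP[w1 we] /andP[/andP[wd1 wd2] wd3]].
have eq1 : cexp 0 = 1 by rewrite /cexp /= expR0 cis0 mulr1.
rewrite eq1 mul1r; have n0 := cmod_ge0 w.
apply: le_trans (cmod_le _) _; rewrite /cexp !(cReD, cImD, cReN, cImN, cReMr, cImMr).
have rw := absRe_le w; have iw := absIm_le w.
case: w w1 we wd1 wd2 wd3 n0 rw iw => x y; set n := cmod _ => w1 we wd1 wd2 wd3 n0 /= xn yn.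
have {h1} := h1 x; have {h2} := h2 y; have {h3} := h3 y.
rewrite !subr0 expR0 cos0 sin0 oppr0 mul0r !mul1r !subr0.
move=> /(_ (le_lt_trans yn wd3)) h3 /(_ (le_lt_trans yn wd2)) h2 /(_ (le_lt_trans xn wd1)) h1.
have -> : expR x * cos y - 1 - x = (expR x - 1 - x) + (cos y - 1) + (expR x - 1) * (cos y - 1).
  by ring.
have -> : expR x * sin y - y = (sin y - y) + (expR x - 1) * (sin y).
  by ring.
rewrite addr0 in h2.
have hx : k * `|x| <= k * n by rewrite ler_wpM2l // ltW.
have hy : k * `|y| <= k * n by rewrite ler_wpM2l // ltW.
have kn : k * n <= 1 / 8 * n by rewrite ler_wpM2r.
have ken : k * n <= e / 8 * n by rewrite ler_wpM2r.
have b1 : `|expR x - 1| <= 2 * n.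
  have : `|expR x - 1| <= `|expR x - 1 - x| + `|x|.
    by rewrite -{1}[expR x - 1](subrK x) ler_normD.
  lra.
have b2 : `|sin y| <= 2 * n.
  have : `|sin y| <= `|sin y - y| + `|y|.
    by rewrite -{1}[sin y](subrK y) ler_normD.
  lra.
have b3 : `|(expR x - 1) * (cos y - 1)| <= 2 * n * (k * n).
  by rewrite normrM ler_pM //; lra.
have b4 : `|(expR x - 1) * sin y| <= 2 * n * (2 * n).
  by rewrite normrM ler_pM.
have t1 := ler_normD (expR x - 1 - x + (cos y - 1)) ((expR x - 1) * (cos y - 1)).
have t2 := ler_normD (expR x - 1 - x) (cos y - 1).
have t3 := ler_normD (sin y - y) ((expR x - 1) * sin y).
have b5 : n * (k * n) <= 1 * (k * n) by apply: ler_wpM2r; [rewrite mulr_ge0 // ltW|exact: ltW].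
have b6 : n * n <= e / 100 * n by rewrite ler_wpM2r // ltW.
have b7 : 0 <= e * n by rewrite mulr_ge0 // ltW.
have e4 : (2 * n) * (2 * n) = 4 * (n * n) by ring.
have e3 : (2 * n) * (k * n) = 2 * (n * (k * n)) by ring.
rewrite e4 in b4; rewrite e3 in b3.
lra.
Qed.

Lemma cderiv_cexp a : cderiv cexp a (cexp a).
Proof.
have d0 : cderiv (fun w => w - a) a 1.
  by have := cderivB (cderiv_id a) (cderiv_cst a a); rewrite subr0.
have := cderiv_comp (F := cexp) d0; rewrite subrr => /(_ _ cderiv_cexp0).
rewrite mul1r => /(cderivZ (cexp a)); rewrite mulr1.
by congr cderiv; apply/funext => w; rewrite -cexpD addrC subrK.
Qed.

End ComplexExponential.

(** * Goursat's theorem on rectangles *)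

Section Goursat.
Context {R : realType}.
Implicit Types (F G Q : R[i] -> R[i]) (a b c d m k t : R).

(** The counterclockwise boundary integral of [Q]; the factor ['i] is the velocity on the vertical
    sides. *)
Definition rect Q a b c d : R[i] :=
  cint a b (fun t => Q (t +i* c)) - cint a b (fun t => Q (t +i* d)) +
  'i%C * (cint c d (fun t => Q (b +i* t)) - cint c d (fun t => Q (a +i* t))).

Definition diff_on Q a b c d :=
  forall x y, a <= x -> x <= b -> c <= y -> y <= d -> cdiff Q (x +i* y).

Lemma ccontin_hor c t : ccontin (fun x : R => x +i* c) t.
Proof.
move=> e e0; exists e => // y /ltW; congr (_ <= _); rewrite -cmod_real; congr cmod.
by apply: complexP; rewrite ?cReD ?cImD ?cReN ?cImN /= ?subrr.
Qed.

Lemma ccontin_ver c t : ccontin (fun x : R => c +i* x) t.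
Proof.
move=> e e0; exists e => // y /ltW; congr (_ <= _); rewrite -cmod_real.
have -> : (c +i* y) - (c +i* t) = 'i%C * (y - t)%:C.
  by apply: complexP; rewrite ?cReD ?cImD ?cReN ?cImN ?cReM ?cImM /=; ring.
by rewrite cmodM cmod_i mul1r.
Qed.

Lemma diff_on_hor Q a b c d y : diff_on Q a b c d -> c <= y -> y <= d ->
  cont_on a b (fun t => Q (t +i* y)).
Proof.
move=> dQ cy yd x ax xb; have [l dl] := dQ x y ax xb cy yd.
exact: (cderiv_ccontin (g := fun t => t +i* y)) (ccontin_hor _ _) dl.
Qed.

Lemma diff_on_ver Q a b c d x : diff_on Q a b c d -> a <= x -> x <= b ->
  cont_on c d (fun t => Q (x +i* t)).
Proof.
move=> dQ ax xb y cy yd; have [l dl] := dQ x y ax xb cy yd.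
exact: (cderiv_ccontin (g := fun t => x +i* t)) (ccontin_ver _ _) dl.
Qed.

Lemma rect_split Q a m b c k d : a <= m -> m <= b -> c <= k -> k <= d ->
  diff_on Q a b c d ->
  rect Q a b c d = rect Q a m c k + rect Q m b c k + rect Q a m k d + rect Q m b k d.
Proof.
move=> am mb ck kd dQ; rewrite /rect.
have ab := le_trans am mb; have cd := le_trans ck kd.
rewrite (cint_cat am mb (diff_on_hor dQ (lexx _) cd)).
rewrite (cint_cat am mb (diff_on_hor dQ cd (lexx _))).
rewrite (cint_cat ck kd (diff_on_ver dQ (lexx _) ab)).
rewrite (cint_cat ck kd (diff_on_ver dQ ab (lexx _))).
ring.
Qed.

(** An affine function has boundary integral 0, so only the deviation from it counts. Opposite sides
    are paired because their affine parts then differ by a constant, and the two constants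
    cancel. *)
Lemma rect_small Q a b c d p l eps : a <= b -> c <= d ->
  diff_on Q a b c d ->
  (forall x y, a <= x -> x <= b -> c <= y -> y <= d ->
     cmod (Q (x +i* y) - Q p - l * ((x +i* y) - p)) <= eps) ->
  cmod (rect Q a b c d) <= 2 * eps * ((b - a) + (d - c)).
Proof.
move=> ab cd dQ h.
have ct (r s : R) (z : R[i]) : cont_on r s (fun=> z).
  by move=> x _ _; exact: ccontin_cst.
have chc := diff_on_hor dQ (lexx _) cd; have chd := diff_on_hor dQ cd (lexx _).
have cva := diff_on_ver dQ (lexx _) ab; have cvb := diff_on_ver dQ ab (lexx _).
have cB f g r s : cont_on r s f -> cont_on r s g ->
    cont_on r s (fun x => f x - g x : R[i]).
  by move=> cf cg x rx xs; apply: ccontinB; [exact: cf|exact: cg].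
have e1 : rect Q a b c d =
   cint a b (fun t => Q (t +i* c) - Q (t +i* d) - (- l * 'i%C * (d - c)%:C)) +
   'i%C * cint c d (fun t => Q (b +i* t) - Q (a +i* t) - l * (b - a)%:C).
  rewrite /rect !cintB ?cint_cst //; last 2 first.
    exact: cB. exact: cB.
  ring.
rewrite e1; apply: le_trans (cmodD _ _) _; rewrite mulrDr; apply: lerD.
  apply: cmod_cint_le => //; first by apply: (cB) => //; exact: cB.
  move=> x ax xb.
  have -> : Q (x +i* c) - Q (x +i* d) - - l * 'i%C * (d - c)%:C =
    (Q (x +i* c) - Q p - l * ((x +i* c) - p)) -
    (Q (x +i* d) - Q p - l * ((x +i* d) - p)).
    have -> : - l * 'i%C * (d - c)%:C = l * ((x +i* c) - (x +i* d)).
      rewrite mulNr -mulrN -mulrA; congr (_ * _).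
      by apply: complexP; rewrite ?cReM ?cImM ?cReD ?cImD ?cReN ?cImN /=; ring.
    ring.
  apply: le_trans (cmodB _ _) _.
  have := h x c ax xb (lexx _) cd; have := h x d ax xb cd (lexx _); lra.
rewrite cmodM cmod_i mul1r.
apply: cmod_cint_le => //; first by apply: (cB) => //; exact: cB.
move=> y cy yd.
have -> : Q (b +i* y) - Q (a +i* y) - l * (b - a)%:C =
  (Q (b +i* y) - Q p - l * ((b +i* y) - p)) -
  (Q (a +i* y) - Q p - l * ((a +i* y) - p)).
  have -> : l * (b - a)%:C = l * ((b +i* y) - (a +i* y)).
    congr (_ * _).
    by apply: complexP; rewrite ?cReM ?cImM ?cReD ?cImD ?cReN ?cImN /=; ring.
  ring.
apply: le_trans (cmodB _ _) _.
have := h b y ab (lexx _) cy yd; have := h a y (lexx _) ab cy yd; lra.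
Qed.

Lemma goursat Q a b c d : a <= b -> c <= d -> diff_on Q a b c d ->
  rect Q a b c d = 0.
Proof.
move=> ab cd dQ; apply/eqP; rewrite -cmod_eq0 eq_le cmod_ge0 andbT.
apply/ler_addgt0Pl => e e0; rewrite addr0.
pose W := b - a; pose H := d - c.
have W0 : 0 <= W by rewrite subr_ge0.
have H0 : 0 <= H by rewrite subr_ge0.
have sub x x' y y' : a <= x -> x' <= b -> c <= y -> y' <= d -> diff_on Q x x' y y'.
  by move=> ax xb cy yd p q h1 h2 h3 h4; apply: dQ; lra.
(* The bound scales like the area: four quarters of scale [s / 2] contribute [e * (s / 2) ^ 2] each,
   which adds up to [e * s ^ 2]. *)
pose P x y s := cmod (rect Q x (x + s * W) y (y + s * H)) <= e * s ^+ 2.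
have : P a c 1.
  have aW : a + W = b by rewrite /W; ring.
  have cH : c + H = d by rewrite /H; ring.
  apply: (bisection2 (P := P) W0 H0).
    move=> x y s s0 ax xb cy yd; rewrite /P => h1 h2 h3 h4.
    have s2 : 0 <= s / 2 by rewrite divr_ge0 // ltW.
    have sW : 0 <= s / 2 * W by exact: mulr_ge0.
    have sH : 0 <= s / 2 * H by exact: mulr_ge0.
    have eW : x + s * W = x + s / 2 * W + s / 2 * W by field.
    have eH : y + s * H = y + s / 2 * H + s / 2 * H by field.
    rewrite eW eH in xb yd *; clear eW eH.
    move: sW sH xb yd h1 h2 h3 h4; move: (s / 2 * W) (s / 2 * H) => w h.
    move=> w0 h0 xb yd h1 h2 h3 h4.
    rewrite aW in xb; rewrite cH in yd.
    have up (u v : R) : 0 <= v -> u <= u + v by rewrite lerDl.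
    rewrite (rect_split (up _ _ w0) (up _ _ w0) (up _ _ h0) (up _ _ h0) (sub _ _ _ _ ax xb cy yd)).
    apply: le_trans (cmodD _ _) _.
    apply: le_trans (lerD (le_trans (cmodD _ _) (lerD (le_trans (cmodD _ _) (lerD h1 h2)) h3)) h4) _.
    by rewrite le_eqVlt; apply/orP; left; apply/eqP; field.
  move=> p q ap pb cq qd.
  have [l dl] : cdiff Q (p +i* q) by apply: dQ; lra.
  (* On a rectangle of scale [s] the deviation from the affine part is at most
     [e / K * (s * (W + H))], and [rect_small] multiplies it by [2 * (s * (W + H))]. *)
  pose K := 2 * (W + H) ^+ 2 + 1.
  have K0 : 0 < K by rewrite /K; have := sqr_ge0 (W + H); lra.
  have eK : 0 < e / K by rewrite divr_gt0.
  have [r r0 hr] := dl _ eK.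
  have WH : 0 < W + H + 1 by lra.
  exists (r / (W + H + 1)); first by rewrite divr_gt0.
  move=> x y s s0 sr ax xb cy yd xp px yq qy.
  have sW : 0 <= s * W by rewrite mulr_ge0 // ltW.
  have sH : 0 <= s * H by rewrite mulr_ge0 // ltW.
  have near u v : x <= u -> u <= x + s * W -> y <= v -> v <= y + s * H ->
      cmod ((u +i* v) - (p +i* q)) <= s * (W + H).
    move=> xu ux yv vy; apply: le_trans (cmod_le _) _.
    rewrite ?cReD ?cImD ?cReN ?cImN /= mulrDr; apply: lerD.
      by rewrite ler_norml; apply/andP; split; lra.
    by rewrite ler_norml; apply/andP; split; lra.
  have := rect_small (p := p +i* q) (l := l) (eps := e / K * (s * (W + H)))
    (a := x) (b := x + s * W) (c := y) (d := y + s * H) (Q := Q).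
  rewrite aW in xb; rewrite cH in yd.
  rewrite lerDl lerDl => /(_ sW sH (sub _ _ _ _ ax xb cy yd)) h.
  apply: le_trans (h _) _.
    move=> u v xu ux yv vy; have nr := near u v xu ux yv vy.
    apply: le_trans (hr _ _) _; last by rewrite ler_wpM2l // ltW.
    apply: le_lt_trans nr _; move: sr; rewrite ltr_pdivlMr //.
    by apply: le_lt_trans; rewrite ler_pM2l //; lra.
  have -> : 2 * (e / K * (s * (W + H))) * (x + s * W - x + (y + s * H - y)) =
    e / K * s ^+ 2 * (2 * (W + H) ^+ 2) by ring.
  have {2}-> : e = e / K * K by field; rewrite gt_eqF.
  have -> : e / K * K * s ^+ 2 = e / K * s ^+ 2 * K by ring.
  by apply: ler_wpM2l; [apply: mulr_ge0; [exact: ltW|exact: sqr_ge0]|rewrite /K; lra].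
rewrite /P !mul1r /W /H expr1n mulr1.
by rewrite [a + _]addrC subrK [c + _]addrC subrK.
Qed.

End Goursat.


(** * Averages over circles centred at 0 *)

Section CircleAverage.
Context {R : realType}.
Implicit Types (F G : R[i] -> R[i]) (w a l L : R[i]) (r s d rho K : R).

Definition on_circle r (F : R[i] -> R[i]) (t : R) := F (r%:C * cis t).

Definition cavg r F : R[i] := (2 * pi)^-1%:C * cint 0 (2 * pi) (on_circle r F).

Definition ccirc r F := cont_on 0 (2 * pi) (on_circle r F).

Lemma cmod_circle r t : 0 <= r -> cmod (r%:C * cis t) = r.
Proof. by move=> r0; rewrite cmodM cmod_cis mulr1 cmod_nneg. Qed.

Lemma twopi_gt0 : 0 < 2 * pi :> R.
Proof. by rewrite mulr_gt0 // pi_gt0. Qed.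

Lemma ccontin_cis t : ccontin (cis : R -> R[i]) t.
Proof.
have := cderiv_ccontin (ccontin_ver 0 t) (cderiv_cexp _).
rewrite /cexp /= expR0 => h e /h[d d0 hd]; exists d => // y /hd.
by rewrite !mul1r.
Qed.

Lemma ccontin_circle r t : ccontin (fun s => r%:C * cis s) t.
Proof. by apply: ccontinM; [exact: ccontin_cst|exact: ccontin_cis]. Qed.

Lemma diff_ccirc r F : 0 <= r -> (forall w, cmod w = r -> cdiff F w) -> ccirc r F.
Proof.
move=> r0 dF t _ _; have [l dl] := dF _ (cmod_circle t r0).
exact: (cderiv_ccontin (g := fun s => r%:C * cis s)) (ccontin_circle r t) dl.
Qed.

Lemma ccirc_cst r (c : R[i]) : ccirc r (fun=> c).
Proof. by move=> t _ _; exact: ccontin_cst. Qed.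

Lemma ccirc_id r : ccirc r id.
Proof. by move=> t _ _; exact: ccontin_circle. Qed.

Lemma ccirc_conj r F : ccirc r F -> ccirc r (fun w => (F w)^*%C).
Proof. by move=> cF t t0 t1; apply: ccontin_conj; exact: cF. Qed.

Lemma ccircM r F G : ccirc r F -> ccirc r G -> ccirc r (fun w => F w * G w).
Proof. by move=> cF cG t t0 t1; apply: ccontinM; [exact: cF|exact: cG]. Qed.

Lemma ccircD r F G : ccirc r F -> ccirc r G -> ccirc r (fun w => F w + G w).
Proof. by move=> cF cG t t0 t1; apply: ccontinD; [exact: cF|exact: cG]. Qed.

Lemma ccircB r F G : ccirc r F -> ccirc r G -> ccirc r (fun w => F w - G w).
Proof. by move=> cF cG t t0 t1; apply: ccontinB; [exact: cF|exact: cG]. Qed.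

Lemma eq_cavg r F G : 0 <= r -> (forall w, cmod w = r -> F w = G w) ->
  cavg r F = cavg r G.
Proof.
move=> r0 FG; congr (_ * _); apply: eq_cint => t _ _.
by apply: FG; exact: cmod_circle.
Qed.

Lemma cavgD r F G : ccirc r F -> ccirc r G ->
  cavg r (fun w => F w + G w) = cavg r F + cavg r G.
Proof. by move=> cF cG; rewrite /cavg -mulrDr -cintD. Qed.

Lemma cavgB r F G : ccirc r F -> ccirc r G ->
  cavg r (fun w => F w - G w) = cavg r F - cavg r G.
Proof. by move=> cF cG; rewrite /cavg -mulrBr -cintB. Qed.

Lemma cavgZ r c F : ccirc r F -> cavg r (fun w => c * F w) = c * cavg r F.
Proof. by move=> cF; rewrite /cavg mulrCA -(cintZ c cF). Qed.

Lemma cavg_cst r c : cavg r (fun=> c) = c.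
Proof.
rewrite /cavg cint_cst ?(ltW twopi_gt0) // subr0 mulrCA -rmorphM mulVf ?mulr1 //.
by rewrite gt_eqF // twopi_gt0.
Qed.

Lemma cavg_conj r F : ccirc r F -> cavg r (fun w => (F w)^*%C) = (cavg r F)^*%C.
Proof.
move=> cF; rewrite /cavg [RHS]rmorphM; congr (_ * _); first by rewrite /= oppr0.
exact: cint_conj cF.
Qed.

Lemma cmod_cavg_le_Re r F G : 0 <= r -> ccirc r F -> ccirc r G ->
  (forall w, cmod w = r -> cmod (F w) <= complex.Re (G w)) ->
  cmod (cavg r F) <= complex.Re (cavg r G).
Proof.
move=> r0 cF cG FG; rewrite cmodM cReMr cmod_nneg ?invr_ge0 ?(ltW twopi_gt0) //.
rewrite ler_pM2l ?invr_gt0 ?twopi_gt0 //.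
by apply: cmod_cint_le_Re => // t _ _; apply: FG; exact: cmod_circle.
Qed.

Lemma cmod_cavg_le r F K : 0 <= r -> ccirc r F ->
  (forall w, cmod w = r -> cmod (F w) <= K) -> cmod (cavg r F) <= K.
Proof.
move=> r0 cF FK; have := @cmod_cavg_le_Re r F (fun=> K%:C) r0 cF.
by rewrite cavg_cst; apply => //; exact: ccirc_cst.
Qed.

Lemma Re_cavg_ge0 r F : 0 <= r -> ccirc r F ->
  (forall w, cmod w = r -> 0 <= complex.Re (F w)) -> 0 <= complex.Re (cavg r F).
Proof.
move=> r0 cF F0; have := @cmod_cavg_le_Re r (fun=> 0) F r0 (@ccirc_cst _ _) cF.
by rewrite cavg_cst cmod0; apply => w /F0.
Qed.

(** Goursat for [F] composed with [cexp]: the horizontal sides cancel by periodicity and the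
    vertical ones are the two averages. Since [cexp] omits 0, holomorphy on the punctured disc is
    enough. *)
Lemma cavg_radius rho F r s : (forall w, 0 < cmod w -> cmod w < rho -> cdiff F w) ->
  0 < r -> r <= s -> s < rho -> cavg r F = cavg s F.
Proof.
move=> dF r0 rs srho; have s0 := lt_le_trans r0 rs.
pose Q w := F (cexp w).
have lrs : ln r <= ln s by rewrite ler_ln.
have dQ : diff_on Q (ln r) (ln s) 0 (2 * pi).
  move=> x y rx xs _ _.
  have [l dl] : cdiff F (cexp (x +i* y)).
    apply: dF; rewrite cmod_cexp /= ?expR_gt0 //.
    by apply: le_lt_trans srho; rewrite -(lnK s0) ler_expR.
  exists (l * cexp (x +i* y)); exact: cderiv_comp (cderiv_cexp _) dl.
have := goursat lrs (ltW twopi_gt0) dQ.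
have e t : Q (t +i* (2 * pi)) = Q (t +i* 0) by rewrite /Q /cexp /= cis2pi cis0.
rewrite /rect (eq_cint (g := fun t => Q (t +i* (2 * pi)))); last by move=> t _ _; rewrite e.
rewrite subrr add0r => /eqP; rewrite mulf_eq0.
have -> /= : ('i%C == 0 :> R[i]) = false by rewrite -cmod_eq0 cmod_i oner_eq0.
rewrite subr_eq0 => /eqP h; congr (_ * _); symmetry.
transitivity (cint 0 (2 * pi) (fun t => Q (ln s +i* t))).
  by apply: eq_cint => t _ _; rewrite /Q /cexp /= lnK.
by rewrite h; apply: eq_cint => t _ _; rewrite /Q /cexp /= lnK.
Qed.

(** The value at 0 is excluded because [F] will be a difference quotient, whose value there is an
    artefact of division by 0. *)
Definition tends0 F L := forall eps : R, 0 < eps ->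
  exists2 d, 0 < d & forall w, 0 < cmod w -> cmod w < d -> cmod (F w - L) <= eps.

(** The average does not depend on the radius and tends to [L] as the circle shrinks. This yields
    Taylor coefficients directly as limits of difference quotients. *)
Lemma cavg_mean rho F L r : (forall w, 0 < cmod w -> cmod w < rho -> cdiff F w) ->
  tends0 F L -> 0 < r -> r < rho -> cavg r F = L.
Proof.
move=> dF FL r0 rrho; apply/eqP; rewrite -subr_eq0 -cmod_eq0 eq_le cmod_ge0 andbT.
apply/ler_addgt0Pl => e e0; rewrite addr0; have [d d0 hd] := FL e e0.
pose s := Num.min (d / 2) r.
have s0 : 0 < s by rewrite lt_min divr_gt0.
have sr : s <= r by rewrite ge_min lexx orbT.
have sd : s < d.
  by apply: (@le_lt_trans _ _ (d / 2)); [rewrite ge_min lexx|lra].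
rewrite -(cavg_radius dF s0 sr rrho) -(cavg_cst s L) -cavgB; last 2 first.
- apply: diff_ccirc; first exact: ltW.
  move=> w ws; apply: dF; rewrite ws //; exact: le_lt_trans rrho.
- exact: ccirc_cst.
apply: cmod_cavg_le; first exact: ltW.
  apply: ccircB; last exact: ccirc_cst.
  apply: diff_ccirc; first exact: ltW.
  move=> w ws; apply: dF; rewrite ws //; exact: le_lt_trans rrho.
by move=> w ws; apply: hd; rewrite ws.
Qed.

Lemma cdiff_tends0 F : cdiff F 0 -> tends0 F (F 0).
Proof.
move=> [l /cderiv_cont[d d0 hd]] e e0.
have l0 : 0 < cmod l + 1 by have := cmod_ge0 l; lra.
exists (Num.min d (e / (cmod l + 1))); first by rewrite lt_min d0 divr_gt0.
move=> w w0; rewrite lt_min ltr_pdivlMr // => /andP[wd we].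
have := hd w; rewrite subr0 => /(_ wd) /le_trans; apply.
by rewrite mulrC ltW.
Qed.

Lemma cavg_center rho F r : (forall w, cmod w < rho -> cdiff F w) ->
  0 < r -> r < rho -> cavg r F = F 0.
Proof.
move=> dF r0 rr; apply: (cavg_mean (rho := rho)) => //; first by move=> w _; exact: dF.
by apply: cdiff_tends0; apply: dF; rewrite cmod0; apply: lt_trans rr.
Qed.

Lemma cavg_X r k : 0 < r -> cavg r (fun w => w ^+ k.+1) = 0.
Proof.
move=> r0; have r1 : r < r + 1 by lra.
rewrite (cavg_center (rho := r + 1)) ?expr0n //.
by move=> w _; exists (k.+1%:R * w ^+ k); exact: cderivX.
Qed.

Lemma ccircX r k : ccirc r (fun w => w ^+ k).
Proof.
elim: k => [|k IH]; first exact: ccirc_cst.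
have := ccircM (@ccirc_id r) IH.
by congr ccirc; apply/funext => w; rewrite exprS.
Qed.

Lemma cavg_conjX r k : 0 < r -> cavg r (fun w => (w ^+ k.+1)^*%C) = 0.
Proof.
by move=> r0; rewrite cavg_conj ?cavg_X ?conjc0 //; exact: ccircX.
Qed.

(** On [|w| = r] the conjugate of [w] is [r ^ 2 / w], so this is the mean value of the difference
    quotient; the constant [F 0] is killed by [cavg_conjX]. *)
Lemma cavg_coef1 rho F l r : (forall w, cmod w < rho -> cdiff F w) ->
  cderiv F 0 l -> 0 < r -> r < rho ->
  cavg r (fun w => F w * w^*%C) = (r ^+ 2)%:C * l.
Proof.
move=> dF dl r0 rr; pose G w := (F w - F 0) / w.
have cF : ccirc r F.
  by apply: diff_ccirc; [exact: ltW|move=> w wr; apply: dF; rewrite wr].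
have dG w : 0 < cmod w -> cmod w < rho -> cdiff G w.
  rewrite cmod_gt0 => w0 /dF[m dm].
  by have := cderivM (cderivB dm (cderiv_cst (F 0) w)) (cderivV w0); exists (((m - 0) / w) + (F w - F 0) * (- w^-2)).
have cG : ccirc r G.
  by apply: diff_ccirc; [exact: ltW|move=> w wr; apply: dG; rewrite wr].
have Gl : tends0 G l.
  move=> e /dl[d d0 hd]; exists d => // w w0 wd.
  have := hd w; rewrite subr0 => /(_ wd).
  have -> : F w - F 0 - l * w = (G w - l) * w.
    by rewrite /G; field; rewrite -cmod_gt0.
  by rewrite cmodM ler_pM2r.
rewrite -(cavg_mean dG Gl r0 rr) -cavgZ //.
have cc := ccirc_conj (@ccirc_id r).
transitivity (cavg r (fun w => (r ^+ 2)%:C * G w + F 0 * w^*%C)).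
  apply: eq_cavg; first exact: ltW.
  move=> w wr; have w0 : w != 0 by rewrite -cmod_gt0 wr.
  rewrite -wr -mulcJ /G; field; exact: w0.
rewrite cavgD; [|by apply: ccircM => //; exact: ccirc_cst ..].
rewrite [X in _ + X]cavgZ //.
by have := cavg_conjX 0 r0; rewrite /= => ->; rewrite mulr0 addr0.
Qed.

(** Same principle one order higher: the terms with [F 0] and [l] carry a conjugate power of [w] and
    average to 0. *)
Lemma cavg_coef2 rho F l m r : (forall w, cmod w < rho -> cdiff F w) ->
  tends0 (fun w => (F w - F 0 - l * w) / w ^+ 2) m -> 0 < r -> r < rho ->
  cavg r (fun w => F w * (w ^+ 2)^*%C) = (r ^+ 4)%:C * m.
Proof.
move=> dF Gl r0 rr; pose G w := (F w - F 0 - l * w) / w ^+ 2.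
have cF : ccirc r F.
  by apply: diff_ccirc; [exact: ltW|move=> w wr; apply: dF; rewrite wr].
have dG w : 0 < cmod w -> cmod w < rho -> cdiff G w.
  rewrite cmod_gt0 => w0 /dF[q dq].
  have w20 : w ^+ 2 != 0 by rewrite expf_neq0.
  have h1 := cderivB (cderivB dq (cderiv_cst (F 0) w)) (cderivZ l (cderiv_id w)).
  have h2 := cderiv_comp (cderivX w 1) (cderivV w20).
  by exists ((q - 0 - l * 1) / w ^+ 2 + (F w - F 0 - l * w) * (- (w ^+ 2) ^-2 * (2%:R * w ^+ 1)));
    exact: cderivM h1 h2.
have cG : ccirc r G.
  by apply: diff_ccirc; [exact: ltW|move=> w wr; apply: dG; rewrite wr].
rewrite -(cavg_mean dG Gl r0 rr) -cavgZ //.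
have cc := ccirc_conj (@ccircX r 2); have c1 := ccirc_conj (@ccirc_id r).
transitivity (cavg r (fun w => (r ^+ 4)%:C * G w + (F 0 * (w ^+ 2)^*%C + l * (r ^+ 2)%:C * w^*%C))).
  apply: eq_cavg; first exact: ltW.
  move=> w wr; have w0 : w != 0 by rewrite -cmod_gt0 wr.
  have -> : (r ^+ 4)%:C = ((r ^+ 2)%:C) ^+ 2 :> R[i] by rewrite -rmorphXn -exprM.
  rewrite -wr -mulcJ /G rmorphXn /=; field; exact: w0.
have cZ c H : ccirc r H -> ccirc r (fun w => c * H w).
  by move=> ?; apply: ccircM => //; exact: ccirc_cst.
rewrite cavgD; [|exact: cZ|by apply: ccircD; exact: cZ].
rewrite [X in _ + X]cavgD; [|exact: cZ ..].
rewrite [X in _ + (X + _)]cavgZ // [X in _ + (_ + X)]cavgZ //.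
have := cavg_conjX 0 r0; have := cavg_conjX 1 r0; rewrite /= => -> ->.
by rewrite !mulr0 !addr0.
Qed.

End CircleAverage.


(** * Cauchy estimates and Taylor expansion *)

Section CauchyEstimates.
Context {R : realType}.
Implicit Types (F G : R[i] -> R[i]) (a b w l m : R[i]) (r s d rho K M : R).

Lemma cderiv_unique F a l m : cderiv F a l -> cderiv F a m -> l = m.
Proof.
move=> dl dm; apply/eqP; rewrite -subr_eq0 -cmod_eq0 eq_le cmod_ge0 andbT.
apply/ler_addgt0Pl => e e0; rewrite addr0; have e2 : 0 < e / 2 by lra.
have [d d0 hd] := dl _ e2; have [d' d'0 hd'] := dm _ e2.
pose s := Num.min d d' / 2.
have s0 : 0 < s by rewrite divr_gt0 // lt_min d0.
have sd : s < d.
  have : Num.min d d' <= d by rewrite ge_min lexx.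
  by rewrite /s; lra.
have sd' : s < d'.
  have : Num.min d d' <= d' by rewrite ge_min lexx orbT.
  by rewrite /s; lra.
have es : cmod (a + s%:C - a) = s by rewrite addrC addKr cmod_nneg // ltW.
have := hd (a + s%:C); have := hd' (a + s%:C); rewrite es => /(_ sd') h' /(_ sd) h.
have : cmod (l - m) * s <= e * s.
  rewrite -{1}es -cmodM.
  have -> : (l - m) * (a + s%:C - a) = (F (a + s%:C) - F a - m * (a + s%:C - a)) -
     (F (a + s%:C) - F a - l * (a + s%:C - a)) by ring.
  by apply: le_trans (cmodB _ _) _; lra.
by rewrite ler_pM2r.
Qed.

(** Totalized by the value 0 where no derivative exists, so that it can be iterated. *)
Definition der F a : R[i] := xget 0 [set l | cderiv F a l].

Lemma derP F a : cdiff F a -> cderiv F a (der F a).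
Proof. by move=> [l dl]; apply: (xgetPex 0); exists l. Qed.

Lemma derE F a l : cderiv F a l -> der F a = l.
Proof. by move=> dl; exact: (cderiv_unique (derP (ex_intro _ l dl)) dl). Qed.

Definition hol_disc F a rho := forall w, cmod (w - a) < rho -> cdiff F w.

Lemma hol_discW F a b rho s : hol_disc F a rho -> cmod (b - a) + s <= rho ->
  hol_disc F b s.
Proof.
move=> hF h w ws; apply: hF; have -> : w - a = (w - b) + (b - a) by ring.
by apply: le_lt_trans (cmodD _ _) _; lra.
Qed.

Lemma cderiv_shift F a b l : cderiv F (a + b) l ->
  cderiv (fun w => F (a + w)) b l.
Proof.
move=> dF e /dF[d d0 hd]; exists d => // w wb.
have ew : a + w - (a + b) = w - b by ring.
by have := hd (a + w); rewrite ew => /(_ wb).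
Qed.

Lemma cdiff_shift F a b : cdiff F (a + b) -> cdiff (fun w => F (a + w)) b.
Proof. by move=> [l dl]; exists l; exact: cderiv_shift. Qed.

Lemma hol_disc_shift F a rho : hol_disc F a rho ->
  forall w, cmod w < rho -> cdiff (fun w => F (a + w)) w.
Proof. by move=> hF w wr; apply: cdiff_shift; apply: hF; rewrite addrC addKr. Qed.

(** Cauchy's formula for the derivative, with [r ^ 2 / w] written as [w^*]. *)
Lemma der_cavg F a rho r : hol_disc F a rho -> 0 < r -> r < rho ->
  cavg r (fun w => F (a + w) * w^*%C) = (r ^+ 2)%:C * der F a.
Proof.
move=> hF r0 rr; have dF := hol_disc_shift hF.
apply: (cavg_coef1 dF) => //; apply: cderiv_shift; rewrite addr0; apply: derP.
by apply: hF; rewrite subrr cmod0; exact: lt_trans rr.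
Qed.

Lemma ccirc_shift F a rho r : hol_disc F a rho -> 0 < r -> r < rho ->
  ccirc r (fun w => F (a + w)).
Proof.
move=> /hol_disc_shift hF r0 rr; apply: diff_ccirc; first exact: ltW.
by move=> w wr; apply: hF; rewrite wr.
Qed.

Lemma ccirc_shift_conj F a rho r : hol_disc F a rho -> 0 < r -> r < rho ->
  ccirc r (fun w => F (a + w) * w^*%C).
Proof.
move=> hF r0 rr; apply: ccircM; first exact: (ccirc_shift hF).
by apply: ccirc_conj; exact: ccirc_id.
Qed.

Lemma cauchy_bound F a rho r M : hol_disc F a rho -> 0 < r -> r < rho ->
  (forall w, cmod w = r -> cmod (F (a + w)) <= M) -> cmod (der F a) <= M / r.
Proof.
move=> hF r0 rr FM; rewrite ler_pdivlMr //.
rewrite -(ler_pM2l r0).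
have -> : r * (cmod (der F a) * r) = cmod ((r ^+ 2)%:C * der F a).
  by rewrite cmodM cmod_nneg ?sqr_ge0 //; ring.
rewrite -(der_cavg hF r0 rr); apply: cmod_cavg_le; first exact: ltW.
  exact: (ccirc_shift_conj hF).
move=> w wr; rewrite cmodM cmod_conj wr mulrC ler_pM2l //; exact: FM.
Qed.

Lemma disc_convex a b b' rho t : cmod (b - a) < rho -> cmod (b' - a) < rho ->
  0 <= t -> t <= 1 -> cmod (b + t%:C * (b' - b) - a) < rho.
Proof.
move=> hb hb' t0 t1.
have -> : b + t%:C * (b' - b) - a = (1 - t)%:C * (b - a) + t%:C * (b' - a).
  by rewrite rmorphB rmorph1; ring.
apply: le_lt_trans (cmodD _ _) _; rewrite !cmodM !cmod_nneg ?subr_ge0 //.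
have [->|tn] := eqVneq t 1; first by rewrite subrr mul0r add0r mul1r.
have t1' : t < 1 by rewrite lt_neqAle tn.
have h1 : (1 - t) * cmod (b - a) < (1 - t) * rho by rewrite ltr_pM2l // subr_gt0.
have h2 : t * cmod (b' - a) <= t * rho by rewrite ler_wpM2l // ltW.
have -> : rho = (1 - t) * rho + t * rho by ring.
exact: ltr_leD.
Qed.

Lemma disc_lipschitz F a rho K b b' : hol_disc F a rho ->
  (forall w, cmod (w - a) < rho -> cmod (der F w) <= K) ->
  cmod (b - a) < rho -> cmod (b' - a) < rho ->
  cmod (F b' - F b) <= K * cmod (b' - b).
Proof.
move=> hF hK hb hb'.
apply: (mean_value_ineq (F' := der F)) => t t0 t1.
  by apply: derP; apply: hF; exact: disc_convex.
by apply: hK; exact: disc_convex.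
Qed.

Lemma der_bound F a rho r M : hol_disc F a rho -> 0 < r -> r < rho ->
  (forall w, cmod (w - a) < rho -> cmod (F w) <= M) ->
  forall w, cmod (w - a) < rho - r -> cmod (der F w) <= M / r.
Proof.
move=> hF r0 rr FM w hw.
have hFw : hol_disc F w (rho - cmod (w - a)) by apply: hol_discW hF _; lra.
apply: (cauchy_bound hFw) => //; first by lra.
move=> v vr; apply: FM; have -> : w + v - a = v + (w - a) by ring.
by apply: le_lt_trans (cmodD _ _) _; rewrite vr; lra.
Qed.

(** Both derivatives are averages over circles of the same radius, so the Lipschitz bound of [F]
    passes to [der F] at the price of [1 / r]. *)
Lemma der_lipschitz F a rho r K b b' : hol_disc F a rho -> 0 < r -> r < rho ->
  (forall w, cmod (w - a) < rho -> cmod (der F w) <= K) ->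
  cmod (b - a) < rho - r -> cmod (b' - a) < rho - r ->
  cmod (der F b' - der F b) <= K / r * cmod (b' - b).
Proof.
move=> hF r0 rr hK hb hb'.
have ho c : cmod (c - a) < rho - r -> hol_disc F c (rho - cmod (c - a)).
  by move=> hc; apply: hol_discW hF _; lra.
have rb : r < rho - cmod (b - a) by lra.
have rb' : r < rho - cmod (b' - a) by lra.
rewrite mulrAC ler_pdivlMr // -(ler_pM2l r0).
have -> : r * (cmod (der F b' - der F b) * r) =
    cmod ((r ^+ 2)%:C * der F b' - (r ^+ 2)%:C * der F b).
  by rewrite -mulrBr cmodM cmod_nneg ?sqr_ge0 //; ring.
rewrite -(der_cavg (ho _ hb) r0 rb) -(der_cavg (ho _ hb') r0 rb').
have c1 := ccirc_shift_conj (ho _ hb) r0 rb; have c2 := ccirc_shift_conj (ho _ hb') r0 rb'.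
rewrite -cavgB //; apply: cmod_cavg_le; [exact: ltW|exact: ccircB|].
move=> w wr; rewrite -mulrBl cmodM cmod_conj wr mulrC ler_pM2l //.
have -> : b' - b = (b' + w) - (b + w) by ring.
apply: (disc_lipschitz hF hK).
  have -> : b + w - a = w + (b - a) by ring.
  by apply: le_lt_trans (cmodD _ _) _; rewrite wr; lra.
have -> : b' + w - a = w + (b' - a) by ring.
by apply: le_lt_trans (cmodD _ _) _; rewrite wr; lra.
Qed.

Lemma taylor1 F a rho K b b' : hol_disc F a rho ->
  (forall c c', cmod (c - a) < rho -> cmod (c' - a) < rho ->
     cmod (der F c' - der F c) <= K * cmod (c' - c)) ->
  0 <= K -> cmod (b - a) < rho -> cmod (b' - a) < rho ->
  cmod (F b' - F b - der F b * (b' - b)) <= K * cmod (b' - b) * cmod (b' - b).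
Proof.
move=> hF hK K0 hb hb'; pose G w := F w - der F b * w.
have -> : F b' - F b - der F b * (b' - b) = G b' - G b by rewrite /G; ring.
apply: (mean_value_ineq (F' := fun w => der F w - der F b)) => t t0 t1.
  have hw := disc_convex hb hb' t0 t1.
  have := cderivB (derP (hF _ hw)) (cderivZ (der F b) (cderiv_id (b + t%:C * (b' - b)))).
  by rewrite mulr1.
apply: le_trans (hK _ _ hb _) _; first exact: disc_convex.
have -> : b + t%:C * (b' - b) - b = t%:C * (b' - b) by ring.
rewrite cmodM cmod_nneg // ler_wpM2l // -[leRHS]mul1r ler_wpM2r ?cmod_ge0 //.
Qed.

(** Differentiation under the average: [der F] is given by Cauchy's formula, and [taylor1] makes the
    first order error of the integrand uniformly quadratic on the circle. *)
Lemma der_diff F a rho : 0 < rho -> hol_disc F a rho -> cdiff (der F) a.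
Proof.
move=> rho0 hF.
have aa : cmod (a - a) < rho by rewrite subrr cmod0.
have [d1 d10 hd1] := cderiv_cont (derP (hF a aa)).
(* A bound for [F] is available only near [a], from differentiability there; hence the smaller
   disc. *)
pose d := Num.min rho (Num.min d1 1).
have d0 : 0 < d by rewrite !lt_min rho0 d10 ltr01.
have drho : d <= rho by rewrite ge_min lexx.
have dd1 : d <= d1 by rewrite !ge_min lexx /= orbT.
have dle1 : d <= 1 by rewrite !ge_min lexx /= !orbT.
pose M := cmod (F a) + (cmod (der F a) + 1).
have l0 := cmod_ge0 (der F a).
have M0 : 0 <= M by rewrite /M; have := cmod_ge0 (F a); lra.
have FM w : cmod (w - a) < d -> cmod (F w) <= M.
  move=> wd; have -> : F w = F a + (F w - F a) by ring.
  apply: le_trans (cmodD _ _) _; rewrite lerD2l.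
  apply: le_trans (hd1 _ _) _; first exact: lt_le_trans dd1.
  have w1 : cmod (w - a) <= 1 by apply: ltW; exact: lt_le_trans dle1.
  by rewrite -[leRHS]mulr1 ler_wpM2l //; lra.
pose r := d / 4.
have r0 : 0 < r by rewrite divr_gt0.
have hFd : hol_disc F a d by move=> w wd; apply: hF; exact: lt_le_trans drho.
have rd : r < d by rewrite /r; lra.
have bd := der_bound hFd r0 rd FM.
have hF3 : hol_disc F a (d - r) by move=> w wd; apply: hFd; lra.
have rd3 : r < d - r by rewrite /r; lra.
have lip b b' := der_lipschitz (b := b) (b' := b') hF3 r0 rd3 bd.
have hF2 : hol_disc F a (d - r - r) by move=> w wd; apply: hFd; lra.
have L0 : 0 <= M / r / r by rewrite !divr_ge0 // ltW.
have tay := taylor1 hF2 lip L0.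
set L := M / r / r in L0 tay.
(* The second derivative as predicted by Cauchy's formula for [der F]. *)
pose m := (r ^+ 2)^-1%:C * cavg r (fun w => der F (a + w) * w^*%C).
exists m => e e0.
pose N := L / r + 1.
have N0 : 0 < N by rewrite /N ltr_wpDl // divr_ge0 // ltW.
exists (Num.min r (e / N)); first by rewrite lt_min r0 divr_gt0.
move=> b; rewrite lt_min => /andP[br be].
have aa3 : cmod (a - a) < d - r - r - r by rewrite subrr cmod0 /r; lra.
have ba3 : cmod (b - a) < d - r - r - r by rewrite /r; move: br; rewrite /r; lra.
have ho c : cmod (c - a) < d - r - r - r -> hol_disc F c (d - cmod (c - a)).
  by move=> hc; apply: hol_discW hFd _; lra.
have rb : r < d - cmod (b - a) by rewrite /r; move: br; rewrite /r; lra.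
have ra : r < d - cmod (a - a) by rewrite subrr cmod0; lra.
have r2 : 0 < r ^+ 2 by rewrite exprn_gt0.
have cB := ccirc_shift_conj (ho _ ba3) r0 rb.
have cA := ccirc_shift_conj (ho _ aa3) r0 ra.
have circ2 w : cmod w = r -> cmod (a + w - a) < d - r - r.
  by move=> wr; rewrite addrC addKr wr /r; lra.
have circ2b w : cmod w = r -> cmod (b + w - a) < d - r - r.
  move=> wr; have -> : b + w - a = w + (b - a) by ring.
  by apply: le_lt_trans (cmodD _ _) _; rewrite wr; move: br; rewrite /r; lra.
(* Continuity of [der F] comes from its Lipschitz bound, its differentiability being what is to be
   proved. *)
have cD : ccirc r (fun w => der F (a + w) * w^*%C).
  apply: ccircM; last by apply: ccirc_conj; exact: ccirc_id.
  move=> t _ _ eps eps0.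
  pose L1 := L + 1; have L10 : 0 < L1 by rewrite /L1; lra.
  have dl : 0 < eps / L1 by rewrite divr_gt0.
  have [d' d'0 hd'] := ccontin_circle r t dl.
  exists d' => // s /hd' hs; rewrite /on_circle.
  apply: le_trans (lip _ _ _ _) _; try (by apply: circ2; rewrite cmod_circle // ltW).
  have -> : a + r%:C * cis s - (a + r%:C * cis t) = r%:C * cis s - r%:C * cis t by ring.
  have : L1 * cmod (r%:C * cis s - r%:C * cis t) <= eps.
    by rewrite mulrC -ler_pdivlMr.
  by rewrite /L1 mulrDl mul1r; have := cmod_ge0 (r%:C * cis s - r%:C * cis t); rewrite -/L; lra.
rewrite -(ler_pM2l r2).
have -> : r ^+ 2 * cmod (der F b - der F a - m * (b - a)) =
   cmod ((r ^+ 2)%:C * der F b - (r ^+ 2)%:C * der F a - (b - a) * ((r ^+ 2)%:C * m)).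
  rewrite -{1}(cmod_nneg (ltW r2)) -cmodM; congr cmod; ring.
have -> : (r ^+ 2)%:C * m = cavg r (fun w => der F (a + w) * w^*%C).
  by rewrite /m mulrA -rmorphM mulfV ?mul1r // gt_eqF.
rewrite -(der_cavg (ho _ ba3) r0 rb) -(der_cavg (ho _ aa3) r0 ra).
rewrite -cavgB // -cavgZ // -cavgB; last 2 first.
- exact: ccircB.
- by apply: ccircM => //; exact: ccirc_cst.
apply: le_trans (cmod_cavg_le (K := r * (L * cmod (b - a) * cmod (b - a))) (ltW r0) _ _) _.
- by apply: ccircB; [exact: ccircB|apply: ccircM => //; exact: ccirc_cst].
- move=> w wr.
  have -> : F (b + w) * w^*%C - F (a + w) * w^*%C - (b - a) * (der F (a + w) * w^*%C) =
    (F (b + w) - F (a + w) - der F (a + w) * (b + w - (a + w))) * w^*%C by ring.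
  rewrite cmodM cmod_conj wr mulrC ler_pM2l //.
  have := tay (a + w) (b + w) (circ2 _ wr) (circ2b _ wr).
  by have -> : b + w - (a + w) = b - a by ring.
have n0 := cmod_ge0 (b - a).
have -> : r * (L * cmod (b - a) * cmod (b - a)) =
  r ^+ 2 * (L / r * cmod (b - a) * cmod (b - a)) by field; rewrite gt_eqF.
rewrite ler_pM2l // ler_wpM2r //.
have : N * cmod (b - a) <= e by rewrite mulrC -ler_pdivlMr // ltW.
by rewrite /N mulrDl mul1r; lra.
Qed.

Lemma hol_der F a rho : hol_disc F a rho -> hol_disc (der F) a rho.
Proof.
move=> hF w wr; apply: (@der_diff F w (rho - cmod (w - a))); first by lra.
by apply: hol_discW hF _; lra.
Qed.

(** Three Cauchy estimates, each giving up a margin [rho], bound the third derivative by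
    [M / rho ^ 3], whence the radius [4 * rho]. The mean value inequality then brings this back to
    [F] in successive steps. *)
Lemma taylor2 F a rho M : 0 < rho -> hol_disc F a (4 * rho) ->
  (forall w, cmod (w - a) < 4 * rho -> cmod (F w) <= M) ->
  forall w, cmod (w - a) < rho ->
    cmod (F w - F a - der F a * (w - a) - der (der F) a / 2 * (w - a) ^+ 2)
      <= M / rho ^+ 3 * cmod (w - a) ^+ 3.
Proof.
move=> rho0 hF FM w hw.
have h1 := hol_der hF; have h2 := hol_der h1.
have hsub G s : s <= 4 * rho -> hol_disc G a (4 * rho) -> hol_disc G a s.
  by move=> sr hG v vs; apply: hG; exact: lt_le_trans sr.
have r4 : rho < 4 * rho by lra.
have M0 : 0 <= M.
  by apply: le_trans (cmod_ge0 (F a)) (FM a _); rewrite subrr cmod0 mulr_gt0.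
have b1 := der_bound hF rho0 r4 FM.
have r3 : rho < 4 * rho - rho by lra.
have b2 := der_bound (hsub _ (4 * rho - rho) ltac:(lra) h1) rho0 r3 b1.
have r2 : rho < 4 * rho - rho - rho by lra.
have b3 := der_bound (hsub _ (4 * rho - rho - rho) ltac:(lra) h2) rho0 r2 b2.
set K := M / rho / rho / rho in b3.
have K0 : 0 <= K by rewrite /K !divr_ge0 // ltW.
have aa : cmod (a - a) < rho by rewrite subrr cmod0.
have e3 : M / rho ^+ 3 = K by rewrite /K; field; rewrite gt_eqF.
have ha s G : s <= rho -> hol_disc G a (4 * rho) -> hol_disc G a s.
  by move=> sr; apply: hsub; lra.
have seg t : 0 <= t -> t <= 1 -> cmod (a + t%:C * (w - a) - a) <= cmod (w - a).
  move=> t0 t1; have -> : a + t%:C * (w - a) - a = t%:C * (w - a) by ring.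
  by rewrite cmodM cmod_nneg // -[leRHS]mul1r ler_wpM2r ?cmod_ge0.
have t2 v : cmod (v - a) < rho ->
    cmod (der F v - der F a - der (der F) a * (v - a)) <= K * cmod (v - a) * cmod (v - a).
  move=> hv; pose G u := der F u - der (der F) a * u.
  have -> : der F v - der F a - der (der F) a * (v - a) = G v - G a by rewrite /G; ring.
  apply: (mean_value_ineq (F' := fun u => der (der F) u - der (der F) a)) => t t0 t1.
    have hu := disc_convex aa hv t0 t1.
    have := cderivB (derP (ha _ _ (lexx _) h1 _ hu))
      (cderivZ (der (der F) a) (cderiv_id (a + t%:C * (v - a)))).
    by rewrite mulr1.
  have hu := disc_convex aa hv t0 t1.
  apply: le_trans (disc_lipschitz (ha _ _ (lexx _) h2) (K := K) _ aa hu) _.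
    by move=> u ur; apply: b3; lra.
  rewrite ler_wpM2l //; have -> : a + t%:C * (v - a) - a = t%:C * (v - a) by ring.
  by rewrite cmodM cmod_nneg // -[leRHS]mul1r ler_wpM2r ?cmod_ge0.
pose G u := F u - der F a * u - der (der F) a / 2 * (u - a) ^+ 2.
have -> : F w - F a - der F a * (w - a) - der (der F) a / 2 * (w - a) ^+ 2 = G w - G a.
  by rewrite /G; ring.
rewrite e3 !exprSr expr0 mul1r !mulrA.
apply: (mean_value_ineq
  (F' := fun u => der F u - der F a - der (der F) a * (u - a))) => t t0 t1.
  have hu := disc_convex aa hw t0 t1.
  have d1 := cderivB (derP (ha _ _ (lexx _) hF _ hu))
    (cderivZ (der F a) (cderiv_id (a + t%:C * (w - a)))).
  have d2 := cderivB (cderiv_id (a + t%:C * (w - a))) (cderiv_cst a (a + t%:C * (w - a))).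
  have := cderivB d1 (cderivZ (der (der F) a / 2)
     (cderiv_comp d2 (cderivX (a + t%:C * (w - a) - a) 1))).
  by congr cderiv; field.
have hu := disc_convex aa hw t0 t1.
have sg := seg t t0 t1.
apply: le_trans (t2 _ hu) _.
by apply: ler_pM; [rewrite mulr_ge0 ?cmod_ge0|exact: cmod_ge0|rewrite ler_wpM2l|].
Qed.

End CauchyEstimates.


(** * Several complex variables *)

Section HermitianSpace.
Context {R : realType} {n : nat}.
Implicit Types (z w u : 'C[R]_n) (c : R[i]) (k : 'I_n).

Definition herm z w : R[i] := \sum_(k < n) z 0 k * (w 0 k)^*%C.

Lemma enorm_ge0 z : 0 <= enorm z.
Proof. exact: sqrtr_ge0. Qed.

Lemma sqr_enorm z : enorm z ^+ 2 = \sum_(k < n) cmod (z 0 k) ^+ 2.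
Proof. by rewrite sqr_sqrtr // sumr_ge0 // => k _; exact: sqr_ge0. Qed.

Lemma herm_id z : herm z z = (enorm z ^+ 2)%:C.
Proof.
by rewrite sqr_enorm rmorph_sum; apply: eq_bigr => k _; rewrite mulcJ.
Qed.

Lemma hermC z w : herm w z = (herm z w)^*%C.
Proof.
rewrite /herm rmorph_sum; apply: eq_bigr => k _.
by rewrite rmorphM /= conjcK mulrC.
Qed.

Lemma hermDl z w u : herm (z + w) u = herm z u + herm w u.
Proof. by rewrite -big_split; apply: eq_bigr => k _; rewrite mxE mulrDl. Qed.

Lemma hermZl c z w : herm (c *: z) w = c * herm z w.
Proof. by rewrite mulr_sumr; apply: eq_bigr => k _; rewrite mxE mulrA. Qed.

Lemma hermDr z w u : herm u (z + w) = herm u z + herm u w.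
Proof. by rewrite (hermC z u) (hermC w u) hermC hermDl rmorphD. Qed.

Lemma hermZr c z w : herm z (c *: w) = c^*%C * herm z w.
Proof. by rewrite (hermC w z) hermC hermZl rmorphM. Qed.

Lemma herm0l w : herm 0 w = 0.
Proof. by rewrite /herm big1 // => k _; rewrite mxE mul0r. Qed.

Lemma enormZ c z : enorm (c *: z) = cmod c * enorm z.
Proof.
apply/eqP; rewrite -(eqrXn2 (n := 2)) ?mulr_ge0 ?cmod_ge0 ?enorm_ge0 //.
rewrite exprMn !sqr_enorm mulr_sumr; apply/eqP; apply: eq_bigr => k _.
by rewrite mxE cmodM exprMn.
Qed.

Lemma enormN z : enorm (- z) = enorm z.
Proof. by rewrite -scaleN1r enormZ cmodN cmod1 mul1r. Qed.

Lemma enorm0 : enorm (0 : 'C[R]_n) = 0.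
Proof. by rewrite -(scale0r (0 : 'C[R]_n)) enormZ cmod0 mul0r. Qed.

Lemma le_cmod_enorm z k : cmod (z 0 k) <= enorm z.
Proof.
rewrite -(ler_pXn2r (n := 2)) ?nnegrE ?cmod_ge0 ?enorm_ge0 // sqr_enorm.
by rewrite (bigD1 k) //= lerDl sumr_ge0 // => i _; exact: sqr_ge0.
Qed.

Lemma enorm_eq0 z : (enorm z == 0) = (z == 0).
Proof.
apply/eqP/eqP => [z0|->]; last exact: enorm0.
apply/rowP => k; rewrite mxE; apply/eqP; rewrite -cmod_eq0 eq_le cmod_ge0 andbT.
by rewrite -z0 le_cmod_enorm.
Qed.

Lemma enorm_gt0 z : (0 < enorm z) = (z != 0).
Proof. by rewrite lt_def enorm_ge0 andbT enorm_eq0. Qed.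

Lemma sqr_enormD z w : enorm (z + w) ^+ 2 =
  enorm z ^+ 2 + 2 * complex.Re (herm z w) + enorm w ^+ 2.
Proof.
have := herm_id (z + w); rewrite hermDl !hermDr !herm_id (hermC z w).
move=> /(congr1 (@complex.Re R)); rewrite !cReD cReC /= => <-; ring.
Qed.

(** Expand the square norm of [|w| c z - |z| w], where the unimodular [c] makes [c <z, w>] real and
    nonnegative. *)
Lemma cauchy_schwarz z w : cmod (herm z w) <= enorm z * enorm w.
Proof.
have [->|z0] := eqVneq z 0.
  by rewrite herm0l cmod0 mulr_ge0 ?enorm_ge0.
have [->|w0] := eqVneq w 0.
  by rewrite hermC herm0l cmod_conj cmod0 mulr_ge0 ?enorm_ge0.
have zp : 0 < enorm z by rewrite enorm_gt0.
have wp : 0 < enorm w by rewrite enorm_gt0.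
have [c c1 e] := unimodular_align (herm z w).
have := sqr_ge0 (enorm ((enorm w)%:C * c *: z + (- (enorm z)%:C) *: w)).
rewrite sqr_enormD !enormZ hermZl hermZr.
rewrite cmodN cmodM c1 !cmod_nneg ?enorm_ge0 //.
have -> : (enorm w)%:C * c * ((- (enorm z)%:C)^*%C * herm z w) =
   (enorm w * enorm z)%:C * (- (c * herm z w)).
  have -> : (- (enorm z)%:C)^*%C = - (enorm z)%:C :> R[i].
    by apply: complexP; rewrite ?cReC ?cImC ?cReN ?cImN /= ?oppr0.
  rewrite rmorphM /=; ring.
rewrite e cReMr cReN /=.
have -> : (enorm w * 1 * enorm z) ^+ 2 + 2 * (enorm w * enorm z * - cmod (herm z w)) +
  (enorm z * enorm w) ^+ 2 =
  2 * (enorm w * enorm z) * (enorm z * enorm w - cmod (herm z w)) by ring.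
rewrite pmulr_rge0 ?subr_ge0 //; first by rewrite !mulr_gt0.
Qed.

Lemma enormD z w : enorm (z + w) <= enorm z + enorm w.
Proof.
rewrite -(ler_pXn2r (n := 2)) ?nnegrE ?addr_ge0 ?enorm_ge0 //.
rewrite sqr_enormD.
have := Re_le_cmod (herm z w); have := cauchy_schwarz z w.
have -> : (enorm z + enorm w) ^+ 2 = enorm z ^+ 2 + 2 * (enorm z * enorm w) + enorm w ^+ 2.
  by ring.
lra.
Qed.

Lemma enormB z w : enorm (z - w) <= enorm z + enorm w.
Proof. by rewrite -(enormN w); exact: enormD. Qed.

Lemma enorm_sum (I : Type) (r : seq I) (P : pred I) (F : I -> 'C[R]_n) :
  enorm (\sum_(i <- r | P i) F i) <= \sum_(i <- r | P i) enorm (F i).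
Proof.
elim/big_rec2 : _ => [|i x z _ h]; first by rewrite enorm0.
by apply: le_trans (enormD _ _) _; rewrite lerD2l.
Qed.

Lemma enorm_evec k : enorm (evec k : 'C[R]_n) = 1.
Proof.
apply/eqP; rewrite -(eqrXn2 (n := 2)) ?enorm_ge0 // sqr_enorm expr1n.
rewrite (bigD1 k) //= mxE !eqxx cmod1 expr1n big1 ?addr0 // => i ik.
by rewrite mxE (negbTE ik) andbF cmod0 expr0n.
Qed.

Lemma enorm_le_sum z : enorm z <= \sum_(k < n) cmod (z 0 k).
Proof.
have {1}-> : z = \sum_(k < n) z 0 k *: evec k.
  exact: row_sum_delta.
apply: le_trans (enorm_sum _ _ _) _.
by apply: ler_sum => k _; rewrite enormZ enorm_evec mulr1.
Qed.

Lemma norm_le_enorm z : `|z| <= (enorm z)%:C.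
Proof.
have [->|z0] := eqVneq z 0; first by rewrite normr0 enorm0.
have [[i k] e] : exists i : 'I_1 * 'I_n, `|z| = `|z i.1 i.2|.
  by apply: mx_norm_neq0; apply: contra z0 => /eqP/mx_norm_eq0 ->.
by rewrite e /= (ord1 i) cmodE lecR le_cmod_enorm.
Qed.

Lemma cmod_le_norm z k : (cmod (z 0 k))%:C <= `|z|.
Proof.
have : `|z 0 k|%:nng <= \big[Num.max/0%:nng]_i `|z i.1 i.2|%:nng.
  exact: (le_bigmax _ (fun i : 'I_1 * 'I_n => `|z i.1 i.2|%:nng) (0, k)).
by rewrite -num_le.
Qed.

Lemma enorm_le_norm z (x : R) : `|z| <= x%:C -> enorm z <= n%:R * x.
Proof.
move=> zx; apply: le_trans (enorm_le_sum z) _.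
have -> : n%:R * x = \sum_(k < n) x by rewrite sumr_const card_ord mulr_natl.
by apply: ler_sum => k _; rewrite -lecR; apply: le_trans zx; exact: cmod_le_norm.
Qed.

(** Passage between the topology of the sup norm, whose values lie in [R[i]], and Euclidean balls
    with real radii. *)
Lemma nbhs_enormP z (A : set 'C[R]_n) :
  nbhs z A <-> exists2 d, 0 < d & forall w, enorm (w - z) < d -> A w.
Proof.
split=> [/nbhs_normP[e /= e0 he]|[d d0 hd]].
  have er : e = (complex.Re e)%:C.
    by move: e0; rewrite ltcE => /andP[/eqP /= i0 _]; case: e i0 {he} => a b /= ->.
  have r0 : 0 < complex.Re e by rewrite -ltcR -er.
  exists (complex.Re e) => // w wz; apply: he => /=; rewrite /ball_ /= distrC er.
  by apply: le_lt_trans (norm_le_enorm _) _; rewrite ltcR.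
(* The Euclidean norm is at most [n] times the sup norm; [n.+1] keeps the quotient meaningful for
   [n = 0]. *)
apply: (nbhs_normP z A).2; have d1 : 0 < d / (n.+1%:R) by rewrite divr_gt0.
exists (d / n.+1%:R)%:C; first by rewrite /= ltcR.
move=> w /=; rewrite /ball_ /= distrC => /ltW/enorm_le_norm h; apply: hd.
apply: le_lt_trans h _; rewrite mulrCA gtr_pMr // ltr_pdivrMr ?mul1r ?ltr_nat //.
Qed.

End HermitianSpace.

(** * Complex differentiability and restriction to curves *)

Section SeveralVariables.
Context {R : realType} {n : nat}.
Implicit Types (H : 'C[R]_n -> R[i]) (z w u l : 'C[R]_n) (k : 'I_n).

Definition hderiv H z l := forall eps : R, 0 < eps ->
  exists2 d, 0 < d & forall w, enorm (w - z) < d ->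
    cmod (H w - H z - \sum_(k < n) (w - z) 0 k * l 0 k) <= eps * enorm (w - z).

Definition hdiff H z := exists l, hderiv H z l.

Lemma differentiable_hderiv (f : 'C[R]_n -> 'C[R]_n) z k : differentiable f z ->
  hderiv (fun w => f w 0 k) z (\row_m ('J f z) m k).
Proof.
move=> df e e0; have := diff_locally df => /eqaddoP.
have ne0 : 0 < e%:C :> R[i] by rewrite ltcR.
move=> /(_ _ ne0) /nbhs_enormP[d d0 hd]; exists d => // w wd.
have := hd (w - z); rewrite subr0 => /(_ wd) /= h.
have e1 : 'd f z (w - z) = (w - z) *m 'J f z by rewrite /jacobian mul_rV_lin1.
have -> : f w 0 k - f z 0 k - \sum_(m < n) (w - z) 0 m * (\row_m' ('J f z) m' k) 0 m =
   (f w - f z - 'd f z (w - z)) 0 k.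
  by rewrite e1 !mxE; congr (_ - _ - _); apply: eq_bigr => m _; rewrite !mxE.
rewrite -lecR; apply: le_trans (cmod_le_norm _ _) _.
have -> : f w - f z - 'd f z (w - z) =
   (f \o shift z - (cst (f z) + 'd f z)) (w - z).
  rewrite -[(f \o shift z - (cst (f z) + 'd f z)) (w - z)]/
    (f (w - z + z) - (f z + 'd f z (w - z))).
  by rewrite subrK opprD addrA.
apply: le_trans h _; rewrite rmorphM /= ler_pM2l //.
exact: norm_le_enorm.
Qed.

Lemma hderiv_comp H (g : R[i] -> 'C[R]_n) (g' : 'C[R]_n) l a :
  (forall k, cderiv (fun v => g v 0 k) a (g' 0 k)) -> hderiv H (g a) l ->
  cderiv (fun v => H (g v)) a (\sum_(k < n) g' 0 k * l 0 k).
Proof.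
move=> dg dH e e0.
pose L := \sum_(k < n) cmod (l 0 k).
have L0 : 0 <= L by rewrite sumr_ge0 // => k _; exact: cmod_ge0.
pose K := \sum_(k < n) (cmod (g' 0 k) + 1).
have K0 : 0 <= K by rewrite sumr_ge0 // => k _; have := cmod_ge0 (g' 0 k); lra.
pose N := K + L + 1.
have N0 : 0 < N by rewrite /N; lra.
have eN : 0 < e / N by rewrite divr_gt0.
have [d d0 hd] := dH _ eN.
(* A common radius for the finitely many components. *)
have unif (P : 'I_n -> R[i] -> Prop) :
    (forall k, exists2 r, 0 < r & forall v, cmod (v - a) < r -> P k v) ->
    exists2 r, 0 < r & forall v, cmod (v - a) < r -> forall k, P k v.
  move=> hP; have /choice[r rP] : forall k, exists r, 0 < r /\
      forall v, cmod (v - a) < r -> P k v.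
    by move=> k; have [r r0 hr] := hP k; exists r.
  exists (\big[Order.min/1]_(k < n) r k).
    by apply/bigmin_gtP; split=> // k _; have [] := rP k.
  by move=> v /bigmin_gtP[_ h] k; have [_] := rP k; apply; exact: h.
have [r1 r10 h1] := unif _ (fun k => cderiv_cont (dg k)).
have [r2 r20 h2] := unif _ (fun k => dg k _ eN).
exists (Num.min (Num.min r1 r2) (d / (K + 1))).
  by rewrite !lt_min r10 r20 divr_gt0 //; lra.
move=> v; rewrite !lt_min => /andP[/andP[/h1 {}h1 /h2 {}h2] h3].
have w0 := cmod_ge0 (v - a).
have gK : enorm (g v - g a) <= K * cmod (v - a).
  apply: le_trans (enorm_le_sum _) _; rewrite /K mulr_suml; apply: ler_sum => k _.
  by rewrite !mxE; exact: h1.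
have gd : enorm (g v - g a) < d.
  apply: le_lt_trans gK _; move: h3; rewrite ltr_pdivlMr; last by lra.
  have -> : cmod (v - a) * (K + 1) = K * cmod (v - a) + cmod (v - a) by ring.
  by lra.
have := hd _ gd => h4.
have -> : H (g v) - H (g a) - (\sum_(k < n) g' 0 k * l 0 k) * (v - a) =
  (H (g v) - H (g a) - \sum_(k < n) (g v - g a) 0 k * l 0 k) +
  \sum_(k < n) (g v 0 k - g a 0 k - g' 0 k * (v - a)) * l 0 k.
  have -> : (\sum_(k < n) g' 0 k * l 0 k) * (v - a) =
      \sum_(k < n) (g v - g a) 0 k * l 0 k -
      \sum_(k < n) (g v 0 k - g a 0 k - g' 0 k * (v - a)) * l 0 k.
    rewrite mulr_suml -sumrB; apply: eq_bigr => k _; rewrite !mxE; ring.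
  ring.
apply: le_trans (cmodD _ _) _.
have h5 : cmod (\sum_(k < n) (g v 0 k - g a 0 k - g' 0 k * (v - a)) * l 0 k) <=
   e / N * cmod (v - a) * L.
  apply: le_trans (cmod_sum _ _ _) _; rewrite /L mulr_sumr; apply: ler_sum => k _.
  by rewrite cmodM ler_wpM2r ?cmod_ge0.
have h6 : e / N * enorm (g v - g a) <= e / N * (K * cmod (v - a)).
  by rewrite ler_wpM2l // ltW.
have h7 : 0 <= e / N * cmod (v - a) by rewrite mulr_ge0 // ltW.
have -> : e * cmod (v - a) = e / N * (K * cmod (v - a)) + e / N * cmod (v - a) * L
   + e / N * cmod (v - a).
  have -> : e * cmod (v - a) = e / N * (K + L + 1) * cmod (v - a).
    by rewrite -/N divfK ?gt_eqF.
  ring.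
lra.
Qed.

Lemma hdiff_slice H z u a : hdiff H (z + a *: u) -> cdiff (fun v => H (z + v *: u)) a.
Proof.
move=> [l dl]; exists (\sum_(k < n) u 0 k * l 0 k).
apply: (hderiv_comp (g := fun v => z + v *: u)) dl => k.
have := cderivD (cderiv_cst (z 0 k) a) (cderivM (cderiv_id a) (cderiv_cst (u 0 k) a)).
rewrite mul1r mulr0 addr0 add0r; apply: cderiv_local.
  by rewrite !mxE.
by exists 1 => // w _; rewrite !mxE.
Qed.

(** Links the directional derivatives of the final statement to one-variable derivatives on complex
    lines. *)
Lemma cderiv_derive (F : 'C[R]_n -> R[i]) z u (l : R[i]) :
  cderiv (fun v => F (z + v *: u)) 0 l -> 'D_u F z = l.
Proof.
move=> dF; apply: cvg_lim; first exact: norm_hausdorff.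
apply/cvgrPdist_le => e e0.
have er : e = (complex.Re e)%:C.
  by move: e0; rewrite ltcE => /andP[/eqP /= i0 _]; case: e i0 => a b /= ->.
have r0 : 0 < complex.Re e by rewrite -ltcR -er.
have [d d0 hd] := dF _ r0.
exists d%:C; first by rewrite /= ltcR.
move=> h /=; rewrite sub0r normrN cmodE ltcR => hd' h0.
have := hd h; rewrite subr0 => /(_ hd').
rewrite scale0r addr0 => hh.
rewrite er cmodE lecR /GRing.scale /= [h *: u + z]addrC.
have hp : 0 < cmod h by rewrite cmod_gt0.
rewrite -(ler_pM2r hp) -cmodM -cmodN; apply: le_trans hh.
have -> // : - ((l - h^-1 * (F (z + h *: u) - F z)) * h) =
  F (z + h *: u) - F z - l * h by field.
Qed.

End SeveralVariables.


(** * Cauchy and Taylor estimates on the ball, by slicing *)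

Section SliceEstimates.
Context {R : realType} {n : nat}.
Implicit Types (H : 'C[R]_n -> R[i]) (p z w u l : 'C[R]_n) (k j : 'I_n) (rho s M : R).

Definition hol_ball H rho := forall z, enorm z < rho -> hdiff H z.

Definition dird H p u : R[i] := der (fun v => H (p + v *: u)) 0.

Lemma hol_slice H rho p u (r : R) : hol_ball H rho ->
  enorm p + r * enorm u <= rho -> 0 < enorm u ->
  hol_disc (fun v => H (p + v *: u)) 0 r.
Proof.
move=> hH hr u0 v; rewrite subr0 => vr; apply: hdiff_slice; apply: hH.
apply: le_lt_trans (enormD _ _) _; rewrite enormZ.
by apply: lt_le_trans hr; rewrite ltrD2l ltr_pM2r.
Qed.

Lemma dirdP H rho p u (v : R[i]) : hol_ball H rho -> enorm (p + v *: u) < rho ->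
  cderiv (fun v => H (p + v *: u)) v (dird H (p + v *: u) u).
Proof.
move=> hH hv; have d0 : cdiff (fun x => H (p + v *: u + x *: u)) 0.
  by apply: hdiff_slice; rewrite scale0r addr0; exact: hH.
have := derP d0; rewrite -/(dird _ _ _) => h.
have e0 : v - v = 0 by rewrite subrr.
have h' : cderiv (fun x => H (p + v *: u + x *: u)) (v - v) (dird H (p + v *: u) u).
  by rewrite e0.
have := cderiv_comp (cderivB (cderiv_id v) (cderiv_cst v v)) h'.
rewrite (subr0 (1 : R[i])).
rewrite (mulr1 (dird _ _ _)).
suff -> : (fun v => H (p + v *: u)) = (fun x => H (p + v *: u + (x - v) *: u)) by [].
by apply/funext => x; rewrite scalerBl -addrA [v *: u + _]addrC subrK.
Qed.

Lemma dird0 H p : dird H p 0 = 0.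
Proof.
apply: derE; have := cderiv_cst (H p) 0; congr cderiv.
by apply/funext => v; rewrite scaler0 addr0.
Qed.

(** Cauchy's estimate on the slice through [p] in the direction [u], on the circle of radius
    [s / enorm u]. *)
Lemma dird_bound H rho p u s M : hol_ball H rho ->
  (forall z, enorm z < rho -> cmod (H z) <= M) -> 0 < s -> enorm p + s < rho ->
  cmod (dird H p u) <= M / s * enorm u.
Proof.
move=> hH HM s0 ps; have [->|u0] := eqVneq u 0.
  by rewrite dird0 cmod0 enorm0 mulr0.
have up : 0 < enorm u by rewrite enorm_gt0.
have hs : hol_disc (fun v => H (p + v *: u)) 0 ((rho - enorm p) / enorm u).
  by apply: (hol_slice hH _ up); rewrite divfK ?gt_eqF //; lra.
have su : 0 < s / enorm u by rewrite divr_gt0.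
have sr : s / enorm u < (rho - enorm p) / enorm u.
  by rewrite ltr_pM2r ?invr_gt0 //; lra.
apply: le_trans (cauchy_bound (M := M) hs su sr _) _.
  move=> v vr; apply: HM; rewrite add0r.
  apply: le_lt_trans (enormD _ _) _; rewrite enormZ vr divfK ?gt_eqF //.
by rewrite invf_div mulrA mulrAC.
Qed.

Lemma segment_ball rho p p' (t : R) : enorm p < rho -> enorm p' < rho ->
  0 <= t -> t <= 1 -> enorm (p + t%:C *: (p' - p)) < rho.
Proof.
move=> hp hp' t0 t1.
have -> : p + t%:C *: (p' - p) = (1 - t)%:C *: p + t%:C *: p'.
  by apply/rowP => k; rewrite !mxE rmorphB rmorph1; ring.
apply: le_lt_trans (enormD _ _) _; rewrite !enormZ !cmod_nneg ?subr_ge0 //.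
have [->|tn] := eqVneq t 1; first by rewrite subrr mul0r add0r mul1r.
have t1' : t < 1 by rewrite lt_neqAle tn.
have h1 : (1 - t) * enorm p < (1 - t) * rho by rewrite ltr_pM2l // subr_gt0.
have h2 : t * enorm p' <= t * rho by rewrite ler_wpM2l // ltW.
have -> : rho = (1 - t) * rho + t * rho by ring.
exact: ltr_leD.
Qed.

Lemma ball_lipschitz H rho p p' s M : hol_ball H rho ->
  (forall z, enorm z < rho -> cmod (H z) <= M) -> 0 < s ->
  enorm p < rho - s -> enorm p' < rho - s ->
  cmod (H p' - H p) <= M / s * enorm (p' - p).
Proof.
move=> hH HM s0 hp hp'; pose phi (v : R[i]) := H (p + v *: (p' - p)).
have -> : H p' = phi 1 by rewrite /phi scale1r addrC subrK.
have -> : H p = phi 0 by rewrite /phi scale0r addr0.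
have := @mean_value_ineq R phi (fun v => dird H (p + v *: (p' - p)) (p' - p)) 0 1
   (M / s * enorm (p' - p)).
rewrite subr0 cmod1 mulr1; apply => t t0 t1; rewrite add0r mulr1;
  have hs := segment_ball hp hp' t0 t1.
  by apply: (dirdP hH); lra.
by apply: (dird_bound _ hH HM); lra.
Qed.

Lemma dird_lipschitz H rho p p' u s M : hol_ball H rho ->
  (forall z, enorm z < rho -> cmod (H z) <= M) -> 0 < s ->
  enorm p < rho - s - s -> enorm p' < rho - s - s ->
  cmod (dird H p' u - dird H p u) <= M / s ^+ 2 * enorm (p' - p) * enorm u.
Proof.
move=> hH HM s0 hp hp'; have [->|u0] := eqVneq u 0.
  by rewrite !dird0 subrr cmod0 enorm0 mulr0.
have up : 0 < enorm u by rewrite enorm_gt0.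
pose r := s / enorm u; have r0 : 0 < r by rewrite divr_gt0.
have ru : r * enorm u = s by rewrite divfK ?gt_eqF.
have hs q : enorm q < rho - s - s ->
    hol_disc (fun v => H (q + v *: u)) 0 ((rho - enorm q) / enorm u).
  by move=> hq; apply: (hol_slice hH _ up); rewrite divfK ?gt_eqF //; lra.
have sr (q : 'C[R]_n) : enorm q < rho - s - s -> r < (rho - enorm q) / enorm u.
  by move=> hq; rewrite ltr_pM2r ?invr_gt0 //; lra.
have e := der_cavg (hs _ hp) r0 (sr _ hp).
have e' := der_cavg (hs _ hp') r0 (sr _ hp').
have c := ccirc_shift_conj (hs _ hp) r0 (sr _ hp).
have c' := ccirc_shift_conj (hs _ hp') r0 (sr _ hp').
have r2 : 0 < r ^+ 2 by rewrite exprn_gt0.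
rewrite -(ler_pM2l r2) -{1}(cmod_nneg (ltW r2)) -cmodM mulrBr -e -e' -cavgB //.
apply: cmod_cavg_le; [exact: ltW|exact: ccircB|] => v vr.
rewrite -mulrBl cmodM cmod_conj vr !add0r.
have -> : r ^+ 2 * (M / s ^+ 2 * enorm (p' - p) * enorm u) =
   M / s * enorm (p' - p) * r.
  by rewrite /r; field; rewrite !gt_eqF.
rewrite ler_pM2r //.
have -> : p' - p = p' + v *: u - (p + v *: u) by apply/rowP => k; rewrite !mxE; ring.
apply: (ball_lipschitz hH HM) => //.
  by apply: le_lt_trans (enormD _ _) _; rewrite enormZ vr ru; lra.
by apply: le_lt_trans (enormD _ _) _; rewrite enormZ vr ru; lra.
Qed.

(** The linear term is taken at 0 and not at [p], because for normalized maps the derivative at 0 is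
    known. The price is the factor [enorm p + enorm u], by the Lipschitz bound on [dird]. *)
Lemma ball_taylor1 H rho p u s M : hol_ball H rho ->
  (forall z, enorm z < rho -> cmod (H z) <= M) -> 0 < s ->
  enorm p + enorm u < rho - s - s ->
  cmod (H (p + u) - H p - dird H 0 u) <= M / s ^+ 2 * (enorm p + enorm u) * enorm u.
Proof.
move=> hH HM s0 hp.
have M0 : 0 <= M by apply: le_trans (cmod_ge0 (H 0)) (HM 0 _);
  rewrite enorm0; have := enorm_ge0 p; have := enorm_ge0 u; lra.
pose phi (v : R[i]) := H (p + v *: u) - dird H 0 u * v.
have -> : H (p + u) - H p - dird H 0 u = phi 1 - phi 0.
  by rewrite /phi scale1r scale0r addr0 mulr0 mulr1; ring.
have := @mean_value_ineq R phi (fun v => dird H (p + v *: u) u - dird H 0 u) 0 1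
   (M / s ^+ 2 * (enorm p + enorm u) * enorm u).
have pu t : 0 <= t -> t <= 1 -> enorm (p + t%:C *: u) <= enorm p + enorm u.
  move=> t0 t1; apply: le_trans (enormD _ _) _; rewrite lerD2l enormZ cmod_nneg //.
  by rewrite ler_piMl ?enorm_ge0.
rewrite subr0 cmod1 mulr1; apply => t t0 t1; rewrite add0r mulr1; have h := pu t t0 t1.
  have := cderivB (dirdP (p := p) (u := u) (v := t%:C) hH _) (cderivZ (dird H 0 u) (cderiv_id t%:C)).
  by rewrite mulr1; apply; lra.
apply: le_trans (dird_lipschitz _ hH HM s0 _ _) _.
- by rewrite enorm0; have := enorm_ge0 p; have := enorm_ge0 u; lra.
- by lra.
rewrite subr0 ler_wpM2r ?enorm_ge0 // ler_wpM2l // divr_ge0 // sqr_ge0 //.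
Qed.

Lemma hderiv_dird H z l u : hderiv H z l -> dird H z u = \sum_(k < n) u 0 k * l 0 k.
Proof.
move=> dH; apply: derE.
have dH' : hderiv H (z + 0 *: u) l by rewrite scale0r addr0.
apply: (hderiv_comp (g := fun v => z + v *: u)) dH' => k.
have := cderivD (cderiv_cst (z 0 k) 0) (cderivM (cderiv_id 0) (cderiv_cst (u 0 k) 0)).
rewrite mul1r mulr0 addr0 add0r; apply: cderiv_local; first by rewrite !mxE.
by exists 1 => // w _; rewrite !mxE.
Qed.

(** The quantity [q(f)] of the overview, computed on the axis of [e_j] alone. *)
Definition coef2 (f : 'C[R]_n -> 'C[R]_n) (i j : 'I_n) : R[i] :=
  der (der (fun v => f (v *: evec j) 0 i)) 0 / 2.

Lemma Hol_comp (f : 'C[R]_n -> 'C[R]_n) k : Hol f -> hol_ball (fun z => f z 0 k) 1.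
Proof.
by move=> hf z z1; exists (\row_m ('J f z) m k); apply: differentiable_hderiv; exact: hf.
Qed.

Lemma normalized_dird (f : 'C[R]_n -> 'C[R]_n) k u : Hol f -> normalized f ->
  dird (fun z => f z 0 k) 0 u = u 0 k.
Proof.
move=> hf [_ J1]; have b0 : eball (0 : 'C[R]_n) by rewrite /eball /= enorm0.
rewrite (hderiv_dird _ (differentiable_hderiv k (hf 0 b0))) J1.
rewrite (bigD1 k) //= !mxE eqxx mulr1 big1 ?addr0 // => i ik.
by rewrite !mxE (negbTE ik) mulr0.
Qed.

Lemma hol_ballW H rho rho' : rho' <= rho -> hol_ball H rho -> hol_ball H rho'.
Proof. by move=> h hH z zr; apply: hH; exact: lt_le_trans h. Qed.

Section Normalized.
Variables (f : 'C[R]_n -> 'C[R]_n) (rho M : R).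
Hypotheses (hf : Hol f) (nf : normalized f) (rho0 : 0 < rho) (rho1 : rho <= 1).
Hypothesis fM : forall z k, enorm z < rho -> cmod (f z 0 k) <= M.

Lemma normalized_order1 w k : enorm w < rho / 2 ->
  cmod (f w 0 k - w 0 k) <= 16 * M / rho ^+ 2 * enorm w ^+ 2.
Proof.
move=> wr; have s0 : 0 < rho / 4 by rewrite divr_gt0.
have := ball_taylor1 (p := 0) (u := w) (hol_ballW rho1 (Hol_comp k hf))
  (fun z zr => fM k zr) s0.
rewrite enorm0 !add0r normalized_dird // (proj1 nf) mxE subr0 => /(_ _).
have -> : M / (rho / 4) ^+ 2 * enorm w * enorm w = 16 * M / rho ^+ 2 * enorm w ^+ 2.
  by field; rewrite gt_eqF.
by apply; lra.
Qed.

Lemma normalized_axis (i j : 'I_n) (v : R[i]) : i != j -> cmod v < rho / 4 ->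
  cmod (f (v *: evec j) 0 i - coef2 f i j * v ^+ 2) <= 64 * M / rho ^+ 3 * cmod v ^+ 3.
Proof.
move=> ij vr; have s0 : 0 < rho / 4 by rewrite divr_gt0.
have hs : hol_disc (fun v => f (v *: evec j) 0 i) 0 (4 * (rho / 4)).
  have := @hol_slice (fun z => f z 0 i) rho 0 (evec j) (4 * (rho / 4))
    (hol_ballW rho1 (Hol_comp i hf)).
  rewrite enorm0 enorm_evec add0r mulr1 => h.
  have {}h := h _ ltr01.
  move=> x xr; have := h _ x xr.
  have -> : (fun v : R[i] => f (0 + v *: evec j) 0 i) = (fun v => f (v *: evec j) 0 i).
    by apply/funext => y; rewrite add0r.
  by apply; lra.
have := @taylor2 R (fun v => f (v *: evec j) 0 i) 0 (rho / 4) M s0 hs _ v.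
rewrite !subr0 scale0r (proj1 nf) mxE subr0 => /(_ _ vr).
have -> : der (fun v => f (v *: evec j) 0 i) 0 = 0.
  have := normalized_dird i (evec j) hf nf; rewrite /dird.
  have -> : (fun v : R[i] => f (0 + v *: evec j) 0 i) = (fun v => f (v *: evec j) 0 i).
    by apply/funext => y; rewrite add0r.
  by move=> ->; rewrite mxE (negbTE ij) andbF.
rewrite mul0r subr0.
have -> : M / (rho / 4) ^+ 3 = 64 * M / rho ^+ 3 by field; rewrite gt_eqF.
apply=> x; rewrite subr0 => xr; apply: fM; rewrite enormZ enorm_evec; lra.
Qed.

(** Go from 0 to [w_j e_j] along the axis and from there to [w]. Only the [z_j ^ 2] term is
    isolated; the other quadratic terms contain an off-axis coordinate, so for points at distance
    [O(|w| ^ 2)] from the axis the whole error is cubic. *)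
Lemma normalized_order2 w (i j : 'I_n) : i != j -> enorm w < rho / 4 ->
  cmod (f w 0 i - w 0 i - coef2 f i j * w 0 j ^+ 2) <=
    32 * M / rho ^+ 2 * enorm w * enorm (w - w 0 j *: evec j) +
    64 * M / rho ^+ 3 * enorm w ^+ 3.
Proof.
move=> ij wr; have s0 : 0 < rho / 4 by rewrite divr_gt0.
have M0 : 0 <= M.
  by apply: le_trans (cmod_ge0 (f 0 0 i)) (fM i _); rewrite enorm0.
have wj : cmod (w 0 j) <= enorm w := le_cmod_enorm w j.
pose w' := w - w 0 j *: evec j.
have w'w : enorm w' <= enorm w.
  rewrite -(ler_pXn2r (n := 2)) ?nnegrE ?enorm_ge0 // !sqr_enorm.
  apply: ler_sum => k _; rewrite /w' !mxE /=.
  have [->|kj] := eqVneq k j; last by rewrite mulr0 subr0.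
  by rewrite mulr1 subrr cmod0 expr0n sqr_ge0.
have := ball_taylor1 (p := w 0 j *: evec j) (u := w')
  (hol_ballW rho1 (Hol_comp i hf)) (fun z zr => fM i zr) s0.
have -> : w 0 j *: evec j + w' = w by rewrite /w' addrC subrK.
rewrite normalized_dird // enormZ enorm_evec mulr1.
have -> : w' 0 i = w 0 i by rewrite /w' !mxE (negbTE ij) andbF mulr0 subr0.
move=> /(_ _) h1.
have {}h1 : cmod (f w 0 i - f (w 0 j *: evec j) 0 i - w 0 i) <=
    32 * M / rho ^+ 2 * enorm w * enorm w'.
  apply: le_trans (h1 _) _; first by lra.
  rewrite ler_wpM2r ?enorm_ge0 //.
  have -> : M / (rho / 4) ^+ 2 = 16 * M / rho ^+ 2 by field; rewrite gt_eqF.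
  have -> : 32 * M / rho ^+ 2 * enorm w = 16 * M / rho ^+ 2 * (2 * enorm w) by ring.
  rewrite ler_wpM2l ?divr_ge0 ?mulr_ge0 ?sqr_ge0 //; lra.
have h2 := normalized_axis ij (le_lt_trans wj wr).
have h3 : cmod (w 0 j) ^+ 3 <= enorm w ^+ 3.
  by rewrite lerXn2r // nnegrE ?cmod_ge0 ?enorm_ge0.
have h4 : 64 * M / rho ^+ 3 * cmod (w 0 j) ^+ 3 <= 64 * M / rho ^+ 3 * enorm w ^+ 3.
  by apply: ler_wpM2l => //; apply: divr_ge0; [exact: mulr_ge0|apply: exprn_ge0; exact: ltW].
have -> : f w 0 i - w 0 i - coef2 f i j * w 0 j ^+ 2 =
  (f w 0 i - f (w 0 j *: evec j) 0 i - w 0 i) +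
  (f (w 0 j *: evec j) 0 i - coef2 f i j * w 0 j ^+ 2) by ring.
by apply: le_trans (cmodD _ _) _; rewrite -/w'; lra.
Qed.

End Normalized.

End SliceEstimates.


(** * Fields with values in a half-plane *)

Section SupportFunctionals.
Context {R : realType} {n : nat}.
Implicit Types (z w u : 'C[R]_n) (k j : 'I_n).

(** For nonzero [z] this is the only element of [Tset z]. It receives a linear structure below
    because the elements of [Tset z] are bundled linear maps. *)
Definition herm_unit z (w : 'C[R]_n) : R[i] := (enorm z)^-1%:C * herm w z.

Lemma herm_unit_linear z : linear (herm_unit z).
Proof.
move=> a u w; rewrite /herm_unit hermDl hermZl mulrDr mulrCA; congr (_ + _).
Qed.

HB.instance Definition _ z := GRing.isLinear.Build R[i] 'C[R]_n R[i] _ (herm_unit z)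
  (herm_unit_linear z).

Lemma linear_herm (l : {linear 'C[R]_n -> R[i]}) w :
  l w = herm w (\row_k (l (evec k))^*%C).
Proof.
rewrite {1}(row_sum_delta w) linear_sum; apply: eq_bigr => k _.
by rewrite linearZ mxE /= conjcK.
Qed.

Lemma opnorm_herm (l : {linear 'C[R]_n -> R[i]}) a : (forall w, l w = herm w a) ->
  opnorm l = enorm a.
Proof.
move=> la; apply/eqP; rewrite eq_le /opnorm; apply/andP; split.
  apply: ge_sup; first by exists (cmod (l 0)), 0 => //=; rewrite enorm0.
  move=> _ [w /= w1 <-]; rewrite la; apply: le_trans (cauchy_schwarz _ _) _.
  by rewrite ler_piMl ?enorm_ge0.
have [->|a0] := eqVneq a 0.
  rewrite enorm0; apply: le_trans (cmod_ge0 (l 0)) _; apply: sup_upper_bound.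
    split; first by exists (cmod (l 0)), 0 => //=; rewrite enorm0.
    exists (enorm a) => _ [w /= w1 <-]; rewrite la; apply: le_trans (cauchy_schwarz _ _) _.
    by rewrite ler_piMl ?enorm_ge0.
  by exists 0 => //=; rewrite enorm0.
have ap : 0 < enorm a by rewrite enorm_gt0.
apply: sup_upper_bound.
  split; first by exists (cmod (l 0)), 0 => //=; rewrite enorm0.
  exists (enorm a) => _ [w /= w1 <-]; rewrite la; apply: le_trans (cauchy_schwarz _ _) _.
  by rewrite ler_piMl ?enorm_ge0.
exists ((enorm a)^-1%:C *: a) => /=.
  by rewrite enormZ cmod_nneg ?invr_ge0 ?enorm_ge0 // mulVf // gt_eqF.
rewrite la hermZl herm_id -rmorphM cmod_nneg ?mulr_ge0 ?invr_ge0 ?sqr_ge0 ?enorm_ge0 //.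
by rewrite expr2 mulKf // gt_eqF.
Qed.

Lemma Tset_herm z : z != 0 -> Tset z (herm_unit z).
Proof.
move=> z0; have zp : 0 < enorm z by rewrite enorm_gt0.
split.
  rewrite (opnorm_herm (a := (enorm z)^-1%:C *: z)).
    by rewrite enormZ cmod_nneg ?invr_ge0 ?enorm_ge0 // mulVf // gt_eqF.
  by move=> w; rewrite hermZr /= oppr0.
by rewrite /= /herm_unit herm_id -rmorphM expr2 mulKf // gt_eqF.
Qed.

(** Write [l] as the product with a vector [a] of norm 1. Then [<z, a> = |z|] is the equality case
    of Cauchy-Schwarz: the norm of [z - |z| a] vanishes. *)
Lemma Tset_unique z (l : {linear 'C[R]_n -> R[i]}) : z != 0 -> Tset z l ->
  forall w, l w = herm_unit z w.
Proof.
move=> z0 [l1 lz]; have zp : 0 < enorm z by rewrite enorm_gt0.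
pose a := \row_k (l (evec k))^*%C.
have la w : l w = herm w a := linear_herm l w.
have a1 : enorm a = 1 by rewrite -(opnorm_herm la).
have : enorm (z + (- (enorm z)%:C) *: a) ^+ 2 = 0.
  rewrite sqr_enormD hermZr -la lz enormZ cmodN cmod_nneg ?enorm_ge0 // a1 mulr1.
  have -> : (- (enorm z)%:C)^*%C = - (enorm z)%:C :> R[i].
    by apply: complexP; rewrite ?cReC ?cImC ?cReN ?cImN /= ?oppr0.
  by rewrite mulNr -rmorphM cReN /=; ring.
move=> /eqP; rewrite sqrf_eq0 enorm_eq0 scaleNr subr_eq0 => /eqP za w.
rewrite la /herm_unit [in herm w z]za hermZr conjc_real mulrA -rmorphM mulVf ?mul1r //.
by rewrite gt_eqF.
Qed.

Lemma Mcal_Re (h : 'C[R]_n -> 'C[R]_n) z : Mcal h -> eball z -> z != 0 ->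
  0 < complex.Re (herm (h z) z).
Proof.
move=> [_ _ hr] bz z0; have := hr z _ bz z0 (Tset_herm z0).
by rewrite /= /herm_unit cReMr pmulr_rgt0 // invr_gt0 enorm_gt0.
Qed.

End SupportFunctionals.

(** * Functions with nonnegative real part *)

Section Caratheodory.
Context {R : realType}.
Implicit Types (K : R[i] -> R[i]) (v : R[i]).

(* On a circle, the average of [conj K w * conj w] vanishes, so the derivative is an average of [2 Re K]. *)
Lemma caratheodory_der K a (rho r : R) : hol_disc K a rho -> 0 < r -> r < rho ->
  (forall v, cmod (v - a) < rho -> 0 <= complex.Re (K v)) ->
  cmod (der K a) <= 2 / r * complex.Re (K a).
Proof.
move=> hK r0 rr K0.
have c1 := ccirc_shift hK r0 rr; have c2 := ccirc_shift_conj hK r0 rr.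
have c3 : ccirc r (fun w => (K (a + w) * w)^*%C).
  by apply: ccirc_conj; apply: ccircM => //; exact: ccirc_id.
have e0 : cavg r (fun w => (K (a + w) * w)^*%C) = 0.
  rewrite cavg_conj; last by apply: ccircM => //; exact: ccirc_id.
  rewrite (cavg_center (rho := rho)) ?mulr0 ?conjc0 // => w wr.
  have [l dl] := hol_disc_shift hK wr.
  by exists (l * w + K (a + w) * 1); exact: cderivM dl (cderiv_id w).
have c4 : ccirc r (fun w => (2 * r)%:C * K (a + w)).
  by apply: ccircM => //; exact: ccirc_cst.
have r2 : 0 < r ^+ 2 by rewrite exprn_gt0.
rewrite -(ler_pM2l r2) -{1}(cmod_nneg (ltW r2)) -cmodM -(der_cavg hK r0 rr).
rewrite -[X in cmod X]addr0 -e0 -cavgD //.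
have -> : r ^+ 2 * (2 / r * complex.Re (K a)) =
    complex.Re (cavg r (fun w => (2 * r)%:C * K (a + w))).
  rewrite cavgZ // (cavg_center (rho := rho)) //; last exact: hol_disc_shift hK.
  by rewrite addr0 cReMr; field; rewrite gt_eqF.
apply: cmod_cavg_le_Re => //; first exact: ltW.
  exact: ccircD.
move=> w wr.
have -> : K (a + w) * w^*%C + (K (a + w) * w)^*%C = (2 * complex.Re (K (a + w)))%:C * w^*%C.
  by apply: complexP; rewrite !(cReD, cImD, cReM, cImM, cReC, cImC) /=; ring.
have k0 : 0 <= complex.Re (K (a + w)).
  by apply: K0; rewrite addrC addKr wr.
rewrite cmodM cmod_conj wr cReMr cmod_nneg ?mulr_ge0 //.
by rewrite le_eqVlt; apply/orP; left; apply/eqP; ring.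
Qed.

Lemma segment_bounded K (a b : R[i]) :
  (forall t : R, 0 <= t -> t <= 1 -> cdiff K (a + t%:C * (b - a))) ->
  exists B, forall t : R, 0 <= t -> t <= 1 -> cmod (K (a + t%:C * (b - a))) <= B.
Proof.
move=> dK; pose P (s s' : R) := exists B, forall t : R, s <= t -> t <= s' ->
  cmod (K (a + t%:C * (b - a))) <= B.
apply: (cousin (P := P)) => //.
- move=> x y z _ xy yz _ [B hB] [B' hB']; exists (Num.max B B') => t xt tz.
  rewrite le_max; have [ty|/ltW yt] := leP t y; first by rewrite hB.
  by rewrite hB' // orbT.
- move=> t t0 t1; have [l dl] := dK t t0 t1.
  have cg : ccontin (fun s : R => a + s%:C * (b - a)) t.
    apply: ccontinD; first exact: ccontin_cst.
    by apply: ccontinM; [exact: (ccontin_hor 0)|exact: ccontin_cst].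
  have [d d0 hd] := cderiv_ccontin (F := K) cg dl ltr01.
  exists d => // s s' _ st ts' _ h1 h2.
  exists (cmod (K (a + t%:C * (b - a))) + 1) => x sx xs'.
  have -> : K (a + x%:C * (b - a)) = K (a + t%:C * (b - a)) +
    (K (a + x%:C * (b - a)) - K (a + t%:C * (b - a))) by ring.
  apply: le_trans (cmodD _ _) _; rewrite lerD2l; apply: hd.
  by rewrite ltr_norml; apply/andP; split; lra.
Qed.

(** A bootstrap: if [m] is the supremum of [|K|] on the segment from 0 to [v], then the derivative
    is at most [4 * m] there, so [|K - 1|] is at most [4 * m * |v|], hence at most [m / 2]. This
    forces [m <= 2], provided [m] is finite, which [segment_bounded] ensures. *)
Lemma caratheodory K : hol_disc K 0 1 -> K 0 = 1 ->
  (forall v, cmod v < 1 -> 0 <= complex.Re (K v)) ->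
  forall v, cmod v <= 1 / 8 -> cmod (K v - 1) <= 8 * cmod v /\ cmod (K v) <= 2.
Proof.
move=> hK K1 K0 v v8.
have v0 := cmod_ge0 v.
have tv (t : R) : 0 <= t -> t <= 1 -> cmod (t%:C * v) <= cmod v.
  by move=> t0 t1; rewrite cmodM cmod_nneg // -[leRHS]mul1r ler_wpM2r.
have dK (t : R) : 0 <= t -> t <= 1 -> cdiff K (t%:C * v).
  by move=> t0 t1; apply: hK; rewrite subr0; have := tv t t0 t1; lra.
have [B hB] : exists B, forall t : R, 0 <= t -> t <= 1 -> cmod (K (t%:C * v)) <= B.
  have [B hB] := @segment_bounded K 0 v (fun t t0 t1 =>
    let e : t%:C * v = 0 + t%:C * (v - 0) := ltac:(by rewrite subr0 add0r) in
    ltac:(rewrite -e; exact: dK)).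
  by exists B => t t0 t1; have := hB t t0 t1; rewrite subr0 add0r.
pose S := [set x : R | exists t : R, [/\ 0 <= t, t <= 1 & x = cmod (K (t%:C * v))]].
have hS : has_sup S.
  split; first by exists (cmod (K (0%:C * v))), 0.
  by exists B => _ [t [t0 t1 ->]]; exact: hB.
pose m := sup S.
have Sm (t : R) : 0 <= t -> t <= 1 -> cmod (K (t%:C * v)) <= m.
  by move=> t0 t1; apply: sup_upper_bound => //; exists t.
have m0 : 0 <= m by apply: le_trans (cmod_ge0 (K (0%:C * v))) (Sm 0 _ _).
have der4 (t : R) : 0 <= t -> t <= 1 -> cmod (der K (t%:C * v)) <= 4 * m.
  move=> t0 t1; have h := tv t t0 t1.
  have hd : hol_disc K (t%:C * v) (3 / 4).
    by apply: hol_discW hK _; rewrite subr0; lra.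
  have r0 : 0 < 1 / 2 :> R by rewrite divr_gt0.
  have r1 : 1 / 2 < 3 / 4 :> R by clear; lra.
  have := caratheodory_der hd r0 r1.
  have -> : 2 / (1 / 2) = 4 :> R by field.
  move=> h'; apply: le_trans (h' _) _.
    move=> w wr; apply: K0; have -> : w = (w - t%:C * v) + t%:C * v by ring.
    by apply: le_lt_trans (cmodD _ _) _; lra.
  rewrite ler_wpM2l //; apply: le_trans (Re_le_cmod _) _; exact: Sm.
have main (s : R) : 0 <= s -> s <= 1 -> cmod (K (s%:C * v) - 1) <= 4 * m * (s * cmod v).
  move=> s0 s1; rewrite -K1.
  have := @mean_value_ineq R K (der K) 0 (s%:C * v) (4 * m).
  rewrite subr0 cmodM cmod_nneg //; apply=> t t0 t1; rewrite add0r mulrA -rmorphM.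
    apply: derP; apply: dK; first exact: mulr_ge0.
    by rewrite mulr_ile1.
  by apply: der4; [exact: mulr_ge0|rewrite mulr_ile1].
(* The radius [1 / 8] is chosen for [4 * m / 8] to be absorbed by the left side. *)
have m2 : m <= 1 + m / 2.
  apply: ge_sup; first exact: hS.1.
  move=> _ [t [t0 t1 ->]].
  have -> : K (t%:C * v) = 1 + (K (t%:C * v) - 1) by ring.
  apply: le_trans (cmodD _ _) _; rewrite cmod1 lerD2l.
  apply: le_trans (main t t0 t1) _.
  have : t * cmod v <= 1 * (1 / 8) by apply: ler_pM.
  move=> /(ler_wpM2l (x := 4 * m)); rewrite mulr_ge0 // => /(_ isT); lra.
have h1 := main 1 ler01 (lexx _); rewrite !mul1r in h1.
have h2 := Sm 1 ler01 (lexx _); rewrite mul1r in h2.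
split; last by lra.
apply: le_trans h1 _; rewrite ler_wpM2r //; lra.
Qed.

End Caratheodory.


(** * Division by the variable *)

Section Removable.
Context {R : realType}.
Implicit Types (F : R[i] -> R[i]) (v w : R[i]).

Definition quotient0 F v : R[i] := if v == 0 then der F 0 else F v / v.

(** Only the origin is at issue: there [taylor2] shows that the derivative is half the second
    derivative of [F]. *)
Lemma hol_quotient0 F (rho : R) : hol_disc F 0 rho -> F 0 = 0 ->
  hol_disc (quotient0 F) 0 rho.
Proof.
move=> hF F0 v vr; rewrite subr0 in vr.
have [->|v0] := eqVneq v 0; last first.
  have [l dl] : cdiff F v by apply: hF; rewrite subr0.
  have dV := cderivM dl (cderivV v0).
  exists (l / v + F v * (- v^-2)); apply: cderiv_local dV.
    by rewrite /quotient0 (negbTE v0).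
  exists (cmod v); first by rewrite cmod_gt0.
  move=> w wv; rewrite /quotient0; case: eqVneq => // w0.
  by move: wv; rewrite w0 sub0r cmodN ltxx.
have r0 : 0 < rho by apply: le_lt_trans vr; exact: cmod_ge0.
have d0 : cdiff F 0 by apply: hF; rewrite subrr cmod0.
have [d dp hd] := cderiv_cont (derP d0).
pose s := Num.min d rho / 4.
have s0 : 0 < s by rewrite divr_gt0 // lt_min dp.
have sd : 4 * s <= d by rewrite /s mulrC divfK // ge_min lexx.
have sr : 4 * s <= rho by rewrite /s mulrC divfK // ge_min lexx orbT.
pose M := (cmod (der F 0) + 1) * d.
have M0 : 0 <= M by rewrite mulr_ge0 ?ltW //; have := cmod_ge0 (der F 0); lra.
have FM w : cmod (w - 0) < 4 * s -> cmod (F w) <= M.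
  move=> ws; have := hd w; rewrite F0 !subr0 in ws *.
  move=> h; apply: le_trans (h _) _; first by lra.
  by rewrite /M ler_wpM2l; [|have := cmod_ge0 (der F 0); lra|lra].
have hs : hol_disc F 0 (4 * s) by move=> w ws; apply: hF; lra.
have tay := taylor2 s0 hs FM.
set C := M / s ^+ 3 in tay.
have C0 : 0 <= C by rewrite /C divr_ge0 // exprn_ge0 // ltW.
exists (der (der F) 0 / 2) => e e0.
exists (Num.min s (e / (C + 1))).
  by rewrite lt_min s0 divr_gt0 //; lra.
move=> w; rewrite subr0 lt_min => /andP[ws we].
rewrite /quotient0 eqxx; case: eqVneq => [->|w0].
  by rewrite subrr mulr0 subrr cmod0 mulr_ge0 // ltW.
have := tay w; rewrite F0 !subr0 => /(_ ws) h.
have wp : 0 < cmod w by rewrite cmod_gt0.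
rewrite -(ler_pM2r wp) -cmodM.
have -> : (F w / w - der F 0 - der (der F) 0 / 2 * w) * w =
  F w - der F 0 * w - der (der F) 0 / 2 * w ^+ 2 by field.
apply: le_trans h _.
have -> : C * cmod w ^+ 3 = C * cmod w * cmod w * cmod w by ring.
rewrite !ler_pM2r //.
have : cmod w * (C + 1) < e by rewrite -ltr_pdivlMr //; lra.
have -> : cmod w * (C + 1) = C * cmod w + cmod w by ring.
by lra.
Qed.

Lemma cdiff_sum (I : Type) (r : seq I) (P : pred I) (F : I -> R[i] -> R[i]) v :
  (forall i, cdiff (F i) v) -> cdiff (fun w => \sum_(i <- r | P i) F i w) v.
Proof.
move=> dF; elim: r => [|i r [l IH]].
  exists 0; apply: cderiv_local (cderiv_cst 0 v); first by rewrite big_nil.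
  by exists 1 => // w _; rewrite big_nil.
have [m dm] := dF i; case Pi : (P i).
  exists (m + l); apply: cderiv_local (cderivD dm IH); first by rewrite big_cons Pi.
  by exists 1 => // w _; rewrite big_cons Pi.
exists l; apply: cderiv_local IH; first by rewrite big_cons Pi.
by exists 1 => // w _; rewrite big_cons Pi.
Qed.

Lemma cdiffZr F (c : R[i]) v : cdiff F v -> cdiff (fun w => F w * c) v.
Proof. by move=> [l dl]; exists (l * c + F v * 0); exact: cderivM dl (cderiv_cst c v). Qed.

Lemma cdiffM F G v : cdiff F v -> cdiff G v -> cdiff (fun w => F w * G w) v.
Proof. by move=> [l dl] [m dm]; exists (l * G v + F v * m); exact: cderivM. Qed.

End Removable.

(** * Estimates uniform over the class [Mcal] *)

Section CaratheodoryClass.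
Context {R : realType} {n : nat}.
Implicit Types (h : 'C[R]_n -> 'C[R]_n) (z w u : 'C[R]_n) (k j : 'I_n).

(** With [u] the direction of [z], the slice function [<h(v u), u> / v] has value 1 at 0 and
    nonnegative real part; [caratheodory] is applied at [v = enorm z]. *)
Lemma Mcal_herm h z : Mcal h -> enorm z <= 1 / 8 ->
  cmod (herm (h z) z - (enorm z ^+ 2)%:C) <= 8 * enorm z ^+ 3 /\
  cmod (herm (h z) z) <= 2 * enorm z ^+ 2.
Proof.
move=> Mh z8; have [hh [h0 Jh] _] := Mh.
have [->|z0] := eqVneq z 0.
  by rewrite hermC herm0l conjc0 enorm0 !expr0n subr0 cmod0 !mulr0.
have zp : 0 < enorm z by rewrite enorm_gt0.
pose u := (enorm z)^-1%:C *: z.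
have u1 : enorm u = 1.
  by rewrite enormZ cmod_nneg ?invr_ge0 ?enorm_ge0 // mulVf // gt_eqF.
have zu : z = (enorm z)%:C *: u.
  by rewrite scalerA -rmorphM mulfV ?scale1r // gt_eqF.
pose phi (v : R[i]) := herm (h (v *: u)) u.
have hphi : hol_disc phi 0 1.
  move=> v; rewrite subr0 => v1; rewrite /phi /herm; apply: cdiff_sum => k.
  apply: cdiffZr; have := @hol_slice _ _ (fun x => h x 0 k) 1 0 u 1 (Hol_comp k hh).
  rewrite u1 enorm0 mulr1 add0r lexx => /(_ isT ltr01 v); rewrite subr0 => /(_ v1).
  congr cdiff; apply/funext => x; by rewrite add0r.
have phi0 : phi 0 = 0 by rewrite /phi scale0r h0 herm0l.
have dphi : der phi 0 = 1.
  apply: derE; have : herm u u = 1 by rewrite herm_id u1 expr1n.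
  move=> <-; rewrite /phi /herm.
  have d k : cderiv (fun v => h (v *: u) 0 k) 0 (u 0 k).
    rewrite -(normalized_dird k u hh (conj h0 Jh)).
    have := @dirdP _ _ (fun x => h x 0 k) 1 0 u 0 (Hol_comp k hh).
    rewrite scale0r addr0 enorm0 => /(_ ltr01).
    congr cderiv; apply/funext => x; by rewrite add0r.
  (* Replacing the enumeration of the indices by an arbitrary list permits induction on the sum. *)
  have [rs] : exists rs : seq 'I_n, rs = index_enum _ by eexists.
  move=> <-; elim: rs => [|k rs IH].
    rewrite big_nil; apply: cderiv_local (cderiv_cst 0 0); first by rewrite big_nil.
    by exists 1 => // w _; rewrite big_nil.
  have := cderivD (cderivM (d k) (cderiv_cst (u 0 k)^*%C 0)) IH.
  rewrite mulr0 addr0 big_cons; apply: cderiv_local; first by rewrite big_cons.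
  by exists 1 => // w _; rewrite big_cons.
have hK := hol_quotient0 hphi phi0.
have K1 : quotient0 phi 0 = 1 by rewrite /quotient0 eqxx.
have K0 v : cmod v < 1 -> 0 <= complex.Re (quotient0 phi v).
  move=> v1; rewrite /quotient0; case: eqVneq => [_|v0]; first by rewrite dphi.
  have vp : 0 < cmod v by rewrite cmod_gt0.
  have := @Mcal_Re _ _ h (v *: u) Mh; rewrite /eball /= enormZ u1 mulr1 => /(_ v1).
  have vu0 : v *: u != 0 by rewrite -enorm_gt0 enormZ u1 mulr1.
  move=> /(_ vu0); rewrite hermZr -/(phi v).
  have -> : v^*%C * phi v = (cmod v ^+ 2)%:C * (phi v / v) by rewrite -mulcJ; field.
  by rewrite cReMr pmulr_rgt0 ?exprn_gt0 // => /ltW.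
have := @caratheodory _ _ hK K1 K0 (enorm z)%:C.
rewrite cmod_nneg ?enorm_ge0 // => /(_ z8).
have zc0 : (enorm z)%:C != 0 :> R[i] by rewrite -cmod_gt0 cmod_nneg ?enorm_ge0.
have -> : quotient0 phi (enorm z)%:C = (enorm z ^+ 2)^-1%:C * herm (h z) z.
  rewrite /quotient0 (negbTE zc0) /phi -zu /u hermZr conjc_real.
  rewrite -(fmorphV (real_complex R)) mulrC mulrA -rmorphM; congr (_%:C * _).
  by rewrite expr2 invfM.
set X := herm _ _ => -[b1 b2].
have z2 : 0 < enorm z ^+ 2 by rewrite exprn_gt0.
have eX : X = (enorm z ^+ 2)%:C * ((enorm z ^+ 2)^-1%:C * X).
  by rewrite mulrA -rmorphM mulfV ?mul1r // gt_eqF.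
split.
  rewrite {1}eX -[X in _ - X]mulr1 -mulrBr cmodM cmod_nneg ?(ltW z2) //.
  have -> : 8 * enorm z ^+ 3 = enorm z ^+ 2 * (8 * enorm z) by ring.
  by rewrite ler_pM2l.
by rewrite eX cmodM cmod_nneg ?(ltW z2) // mulrC ler_pM2r.
Qed.

(** Polarization: averaging [v <h(z + v e_k), z + v e_k>] over [|v| = s] leaves [s ^ 2] times the
    component [h_k(z)], as [v v^* = s ^ 2] while the other terms vanish at the centre. With
    [s = 1 / 16] all points have norm at most [1 / 8], and [Mcal_herm] gives
    [2 (1 / 8) ^ 2 / s = 1 / 2]. *)
Lemma Mcal_bound h z k : Mcal h -> enorm z < 1 / 16 -> cmod (h z 0 k) <= 1 / 2.
Proof.
move=> Mh z16; have [hh [h0 Jh] _] := Mh.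
pose s : R := 1 / 16; have s0 : 0 < s by rewrite /s; lra.
pose zeta (v : R[i]) := z + v *: evec k.
have hz l : hol_disc (fun v => h (zeta v) 0 l) 0 (1 / 2).
  apply: (hol_slice (rho := 1) (H := fun x => h x 0 l)); rewrite ?enorm_evec //.
    exact: Hol_comp.
  by lra.
have sr : s < 1 / 2 by rewrite /s; lra.
have cz l := ccirc_shift (hz l) s0 sr.
pose A v := \sum_(l < n) h (zeta (0 + v)) 0 l * (z 0 l)^*%C.
have dA v : cmod v < 1 / 2 -> cdiff A v.
  move=> v2; apply: cdiff_sum => l; apply: cdiffZr.
  exact: (hol_disc_shift (hz l)).
have cA : ccirc s A.
  apply: diff_ccirc; first exact: ltW.
  by move=> w ws; apply: dA; rewrite ws.
have aA : cavg s (fun v => v * A v) = 0.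
  rewrite (cavg_center (rho := 1 / 2)) ?mul0r // => w w2.
  by apply: cdiffM; [exists 1; exact: cderiv_id|exact: dA].
have ah : cavg s (fun v => h (zeta (0 + v)) 0 k) = h z 0 k.
  rewrite (cavg_center (rho := 1 / 2)) //; last exact: hol_disc_shift (hz k).
  by rewrite addr0 /zeta scale0r addr0.
have e v : cmod v = s -> v * herm (h (zeta v)) (zeta v) =
    v * A v + (s ^+ 2)%:C * h (zeta (0 + v)) 0 k.
  move=> vs; rewrite -vs -mulcJ /A add0r [in X in herm _ X]/zeta hermDr hermZr.
  have -> : herm (h (zeta v)) (evec k) = h (zeta v) 0 k.
    rewrite /herm (bigD1 k) //= big1 ?addr0; first by rewrite mxE !eqxx conjc1 mulr1.
    by move=> i ik; rewrite mxE (negbTE ik) andbF conjc0 mulr0.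
  by rewrite mulrDr mulrA.
have s2 : 0 < s ^+ 2 by rewrite exprn_gt0.
have ck : ccirc s (fun v => v * A v + (s ^+ 2)%:C * h (zeta (0 + v)) 0 k).
  apply: ccircD; first by apply: ccircM => //; exact: ccirc_id.
  by apply: ccircM => //; exact: ccirc_cst.
have : (s ^+ 2)%:C * h z 0 k = cavg s (fun v => v * A v + (s ^+ 2)%:C * h (zeta (0 + v)) 0 k).
  rewrite cavgD ?aA ?cavgZ ?ah ?add0r //.
    by apply: ccircM => //; exact: ccirc_id.
  by apply: ccircM => //; exact: ccirc_cst.
move=> eh; rewrite -(ler_pM2l s2) -{1}(cmod_nneg (ltW s2)) -cmodM eh.
apply: cmod_cavg_le => //; first exact: ltW.
move=> v vs; rewrite -e // cmodM vs.
have hv : enorm (zeta v) <= 1 / 8.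
  apply: le_trans (enormD _ _) _; rewrite enormZ enorm_evec vs /s; lra.
have [_ b] := Mcal_herm Mh hv.
have b2 : enorm (zeta v) ^+ 2 <= (1 / 8) ^+ 2.
  by rewrite lerXn2r // nnegrE ?enorm_ge0 //; lra.
have -> : s ^+ 2 * (1 / 2) = s * (2 * (1 / 8) ^+ 2) by rewrite /s; field.
by rewrite ler_pM2l //; apply: le_trans b _; rewrite ler_pM2l.
Qed.

(** The constant is chosen before [h], so it serves all fields [h(., t)] of a Herglotz family at
    once. *)
Lemma Mcal_order1 : exists2 C : R, 0 < C & forall h w k, Mcal h ->
  enorm w < 1 / 32 -> cmod (h w 0 k - w 0 k) <= C * enorm w ^+ 2.
Proof.
exists (16 * (1 / 2) / (1 / 16) ^+ 2).
  by rewrite !(mulr_gt0, invr_gt0, exprn_gt0).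
move=> h w k Mh w32; have [hh nh _] := Mh.
apply: (@normalized_order1 _ _ h (1 / 16) (1 / 2) hh nh); try lra.
by move=> z l; exact: Mcal_bound.
Qed.

Lemma Mcal_order2 : exists2 C : R, 0 < C & forall h w (i j : 'I_n), Mcal h -> i != j ->
  enorm w < 1 / 64 ->
  cmod (h w 0 i - w 0 i - coef2 h i j * w 0 j ^+ 2) <=
    C * enorm w * enorm (w - w 0 j *: evec j) + C * enorm w ^+ 3.
Proof.
pose C1 : R := 32 * (1 / 2) / (1 / 16) ^+ 2; pose C2 : R := 64 * (1 / 2) / (1 / 16) ^+ 3.
have C10 : 0 < C1 by rewrite !(mulr_gt0, invr_gt0, exprn_gt0).
have C20 : 0 < C2 by rewrite !(mulr_gt0, invr_gt0, exprn_gt0).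
exists (C1 + C2); first exact: addr_gt0.
move=> h w i j Mh ij w64; have [hh nh _] := Mh.
apply: le_trans (@normalized_order2 _ _ h (1 / 16) (1 / 2) hh nh _ _ _ w i j ij _) _;
  try lra.
  by move=> z l; exact: Mcal_bound.
rewrite -/C1 -/C2; apply: lerD.
  apply: ler_wpM2r; first exact: enorm_ge0.
  by apply: ler_wpM2r; [exact: enorm_ge0|rewrite lerDl ltW].
by apply: ler_wpM2r; [rewrite exprn_ge0 ?enorm_ge0|rewrite lerDr ltW].
Qed.

End CaratheodoryClass.

(** * Fields with values in a sector *)

Section Sector.
Context {R : realType}.
Implicit Types (w p zeta : R[i]) (a r theta : R).

Lemma Re_div_cmod w : -1 <= complex.Re w / cmod w <= 1.
Proof.
have [->|w0] := eqVneq w 0; first by rewrite cmod0 invr0 mulr0; apply/andP; split; lra.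
have wp : 0 < cmod w by rewrite cmod_gt0.
by rewrite ler_pdivlMr // ler_pdivrMr // mulN1r mul1r -ler_norml absRe_le.
Qed.

Lemma polar_form w : w = (cmod w)%:C * cis (carg w).
Proof.
have [->|w0] := eqVneq w 0; first by rewrite cmod0 mul0r.
have wp : 0 < cmod w by rewrite cmod_gt0.
have b := Re_div_cmod w.
have c : cos (acos (complex.Re w / cmod w)) = complex.Re w / cmod w.
  by rewrite acosK // in_itv.
have s : sin (acos (complex.Re w / cmod w)) = `|complex.Im w| / cmod w.
  rewrite sin_acos //; apply/eqP.
  rewrite -(eqrXn2 (n := 2)) ?sqrtr_ge0 ?divr_ge0 ?cmod_ge0 //.
  rewrite sqr_sqrtr; last first.
    have -> : 1 - (complex.Re w / cmod w) ^+ 2 =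
      (1 - complex.Re w / cmod w) * (1 + complex.Re w / cmod w) by ring.
    by move/andP: b => [b1 b2]; apply: mulr_ge0; lra.
  rewrite !exprMn exprVn real_normK ?num_real // sqr_cmod.
  by apply/eqP; field; rewrite -sqr_cmod gt_eqF // exprn_gt0.
apply: complexP; rewrite ?cReMr ?cImMr /carg /=; case: ifP => i0.
- by rewrite c mulrC divfK // gt_eqF.
- by rewrite cosN c mulrC divfK // gt_eqF.
- by rewrite s ger0_norm // mulrC divfK // gt_eqF.
- rewrite sinN s ler0_norm; last by rewrite ltW // ltNge i0.
  by rewrite mulNr opprK mulrC divfK // gt_eqF.
Qed.

Lemma carg_lt_pihalf w : 0 < complex.Re w -> - (pi / 2) < carg w < pi / 2.
Proof.
move=> w0; have wp : 0 < cmod w by apply: lt_le_trans (Re_le_cmod w).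
have b := Re_div_cmod w; have p0 := pi_gt0 R.
set x := complex.Re w / cmod w in b.
have x0 : 0 < x by rewrite divr_gt0.
have h0 := acos_ge0 b; have hp := acos_lepi b.
have h : acos x < pi / 2.
  have i1 : pi / 2 \in `[0, pi : R] by rewrite in_itv /=; apply/andP; split; lra.
  have i2 : acos x \in `[0, pi] by rewrite in_itv /= h0 hp.
  by rewrite -(ltr_cos i2 i1) cos_pihalf acosK ?in_itv.
by rewrite /carg -/x; case: ifP => _; apply/andP; split; lra.
Qed.

Lemma carg_cis r theta : 0 < r -> - (pi / 2) < theta < pi / 2 ->
  carg (r%:C * cis theta) = theta.
Proof.
move=> r0 /andP[t1 t2]; have p0 := pi_gt0 R.
rewrite /carg cmodM cmod_cis mulr1 cmod_nneg ?(ltW r0) // cReMr cImMr /=.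
rewrite mulrAC mulfV ?gt_eqF // mul1r.
have [t0|t0] := leP 0 theta.
  rewrite cosK ?in_itv /=; last by apply/andP; split; lra.
  by rewrite mulr_ge0 ?(ltW r0) // sin_ge0_pi //; apply/andP; split; lra.
rewrite cosKN; last by apply/andP; split; lra.
have : 0 < sin (- theta) by apply: sin_gt0_pi; apply/andP; split; lra.
rewrite sinN => s; rewrite leNgt pmulr_rlt0 // -oppr_gt0 s /=.
by rewrite opprK.
Qed.

Lemma cpowE w a : cpow w a = (cmod w `^ a)%:C * cis (a * carg w).
Proof. by []. Qed.

Lemma Re_cayley zeta : disc zeta -> 0 < complex.Re ((1 - zeta) / (1 + zeta)).
Proof.
move=> z1; have n0 : 1 + zeta != 0.
  apply/eqP => h; have e : zeta = - 1 by apply/eqP; rewrite -addr_eq0 addrC h.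
  by move: z1; rewrite /disc /= e cmodN cmod1 ltxx.
have np : 0 < cmod (1 + zeta) ^+ 2 by rewrite exprn_gt0 // cmod_gt0.
have -> : (1 - zeta) / (1 + zeta) =
    (cmod (1 + zeta) ^+ 2)^-1%:C * ((1 - zeta) * (1 + zeta)^*%C).
  have n0' : (1 + zeta)^*%C != 0 by rewrite conjc_eq0.
  have -> : (cmod (1 + zeta) ^+ 2)^-1%:C = ((cmod (1 + zeta) ^+ 2)%:C)^-1 :> R[i].
    exact: fmorphV.
  rewrite -mulcJ; move: ((1 + zeta)^*%C) n0' => A A0.
  by field; rewrite n0 A0.
rewrite cReMr pmulr_rgt0 ?invr_gt0 //.
have : cmod zeta ^+ 2 < 1 by rewrite exprn_ilt1 ?cmod_ge0.
rewrite sqr_cmod; case: zeta {z1 n0 np} => x y.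
rewrite cReM cReC cImC !(cReD, cImD, cReN, cImN) /= => h.
have -> : (1 - x) * (1 + x) - (0 - y) * - (0 + y) = 1 - (x ^+ 2 + y ^+ 2) by ring.
by rewrite subr_gt0.
Qed.

(** The argument of [w] lies strictly between [- alpha * pi / 2] and [alpha * pi / 2]; the rotation
    carries the upper bounding ray to the imaginary axis. The first inequality serves for membership
    in [Mcal], the second for the sharp bound. *)
Lemma sector_halfplane alpha w : 0 < alpha <= 1 -> (sector_map alpha @` disc) w ->
  0 < complex.Re w /\ 0 < complex.Re (cis ((1 - alpha) * (pi / 2)) * w).
Proof.
move=> /andP[a0 a1] [zeta z1 <-]; have p0 := pi_gt0 R.
have q0 := Re_cayley z1; rewrite /sector_map; set q := _ / _ in q0 *.
have /andP[c1 c2] := carg_lt_pihalf q0.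
have qp : 0 < cmod q by apply: lt_le_trans (Re_le_cmod q).
have ac1 : alpha * carg q < alpha * (pi / 2) by rewrite ltr_pM2l.
have ac2 : alpha * - (pi / 2) < alpha * carg q by rewrite ltr_pM2l.
have api : alpha * (pi / 2) <= pi / 2 by rewrite ler_piMl //; lra.
rewrite cpowE mulrCA -cisD !cReMr /= !pmulr_rgt0 ?powR_gt0 //.
rewrite mulrN in ac2.
by split; apply: cos_gt0_pihalf; apply/andP; split; rewrite ?mulrBl ?mul1r; lra.
Qed.

(* The distance from [1] to the boundary ray of the sector is [sin (alpha * pi / 2)]. *)
Lemma disc_in_sector alpha w : 0 < alpha <= 1 ->
  cmod (w - 1) < sin (alpha * pi / 2) -> (sector_map alpha @` disc) w.
Proof.
move=> /andP[a0 a1] hw; have p0 := pi_gt0 R.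
have api : alpha * pi / 2 <= pi / 2.
  by rewrite -mulrA ler_piMl //; lra.
have api0 : 0 < alpha * pi / 2 by rewrite !mulr_gt0 //; lra.
have s1 : sin (alpha * pi / 2) <= 1 by exact: sin_le1.
have w0 : 0 < complex.Re w.
  have := absRe_le (w - 1); rewrite cReD cReN /= => h.
  have : - (complex.Re w - 1) <= `|complex.Re w - 1| by rewrite -normrN ler_norm.
  lra.
have /andP[c1 c2] := carg_lt_pihalf w0.
have wp : 0 < cmod w by apply: lt_le_trans (Re_le_cmod w).
set th := carg w in c1 c2.
(* The distance from 1 to the line through 0 and [w] is [|sin th|]: the difference of squares is
   [(|w| - cos th) ^ 2]. *)
have sth : sin th ^+ 2 < sin (alpha * pi / 2) ^+ 2.
  apply: (@le_lt_trans _ _ (cmod (w - 1) ^+ 2)); last first.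
    by rewrite ltr_pXn2r // nnegrE ?cmod_ge0 //; apply: le_trans (ltW hw); exact: cmod_ge0.
  rewrite sqr_cmodB mulrC.
  have -> : (1 : R[i])^*%C = 1 by exact: conjc1.
  rewrite mulr1 cmod1.
  have -> : complex.Re w = cmod w * cos th by rewrite {1}(polar_form w) cReMr.
  have := cos2Dsin2 th => h.
  have -> : sin th ^+ 2 = 1 - cos th ^+ 2 by rewrite -h; ring.
  rewrite -subr_ge0.
  have -> : cmod w ^+ 2 - cmod w * cos th * 2 + 1 ^+ 2 - (1 - cos th ^+ 2) =
    (cmod w - cos th) ^+ 2 by ring.
  exact: sqr_ge0.
have sa0 : 0 < sin (alpha * pi / 2).
  by apply: sin_gt0_pi; apply/andP; split; lra.
have sab : - sin (alpha * pi / 2) < sin th < sin (alpha * pi / 2).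
  rewrite -ltr_norml -(ltr_pXn2r (n := 2)) ?nnegrE ?(ltW sa0) //.
  by rewrite real_normK ?num_real.
have /andP[t1 t2] : - (alpha * pi / 2) < th < alpha * pi / 2.
  move/andP: sab => [b1 b2]; apply/andP; split.
    rewrite -ltr_sin ?sinN ?in_itv //=; apply/andP; split; lra.
  rewrite -ltr_sin ?in_itv //=; apply/andP; split; lra.
(* The preimage of [w] under the power; it lies in the right half-plane, and as the Cayley transform
   is an involution the point of the disc is [(1 - p) / (1 + p)]. *)
pose p := cpow w alpha^-1.
have thp : - (pi / 2) < alpha^-1 * th < pi / 2.
  have -> : alpha^-1 * th = th / alpha by rewrite mulrC.
  by rewrite ltr_pdivlMr // ltr_pdivrMr //; apply/andP; split; lra.
have pp : cmod p = cmod w `^ alpha^-1.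
  by rewrite /p cpowE cmodM cmod_cis mulr1 cmod_nneg // powR_ge0.
have pc : carg p = alpha^-1 * th.
  by rewrite /p cpowE carg_cis // powR_gt0.
have pR : 0 < complex.Re p.
  by rewrite /p cpowE cReMr /= mulr_gt0 ?powR_gt0 // cos_gt0_pihalf.
clearbody p.
have p1 : 1 + p != 0.
  apply/eqP => /(congr1 (@complex.Re R)); rewrite cReD /=; lra.
exists ((1 - p) / (1 + p)).
  rewrite /disc /= cmodM cmodV ltr_pdivrMr ?cmod_gt0 // mul1r.
  rewrite -(ltr_pXn2r (n := 2)) // ?nnegrE ?cmod_ge0 // !sqr_cmod.
  rewrite !(cReD, cImD, cReN, cImN) /=.
  rewrite -subr_gt0; have -> : (1 + complex.Re p) ^+ 2 + (0 + complex.Im p) ^+ 2 -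
   ((1 - complex.Re p) ^+ 2 + (0 - complex.Im p) ^+ 2) = 4 * complex.Re p by ring.
  by rewrite mulr_gt0.
rewrite /sector_map.
have two0 : (2 : R[i]) != 0 by rewrite pnatr_eq0.
have -> : (1 - (1 - p) / (1 + p)) / (1 + (1 - p) / (1 + p)) = p.
  have e1 : 1 - (1 - p) / (1 + p) = 2 * p / (1 + p) by field.
  have e2 : 1 + (1 - p) / (1 + p) = 2 / (1 + p) by field.
  by rewrite e1 e2; field; exact: p1.
rewrite cpowE pp pc -powRrM mulVf ?gt_eqF // powRr1 ?ltW //.
by rewrite mulrA mulfV ?gt_eqF // mul1r -polar_form.
Qed.

End Sector.

(** * The second coefficient in a half-plane *)

Section SecondCoefficient.
Context {R : realType} {n : nat}.
Implicit Types (h : 'C[R]_n -> 'C[R]_n) (z w u : 'C[R]_n) (i j : 'I_n).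

Lemma Mcal_g_Re h alpha z : 0 < alpha <= 1 -> Mcal_g (sector_map alpha) h ->
  eball z -> z != 0 ->
  0 < complex.Re (herm (h z) z) /\
  0 < complex.Re (cis ((1 - alpha) * (pi / 2)) * herm (h z) z).
Proof.
move=> ha [_ _ hg] bz z0; have zp : 0 < enorm z by rewrite enorm_gt0.
have := hg z _ bz z0 (Tset_herm z0) => /(sector_halfplane ha).
rewrite /= /herm_unit mulrCA [_%:C * (_ * herm _ _)]mulrCA mulrA -rmorphM.
by rewrite [cis _ * (_ * _)]mulrCA !cReMr !pmulr_rgt0 // ?mulr_gt0 ?invr_gt0.
Qed.

Lemma Mcal_g_Mcal h alpha : 0 < alpha <= 1 -> Mcal_g (sector_map alpha) h -> Mcal h.
Proof.
move=> ha hg; have [hh nh _] := hg; split=> // z l bz z0 /(Tset_unique z0) ->.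
have [h1 _] := Mcal_g_Re ha hg bz z0.
by rewrite /herm_unit cReMr mulr_gt0 ?invr_gt0 ?enorm_gt0.
Qed.

Variables (h : 'C[R]_n -> 'C[R]_n) (c : R[i]).
Hypothesis Mh : Mcal h.
Hypothesis hc : forall z, eball z -> z != 0 -> 0 <= complex.Re (c * herm (h z) z).

(* Averaging [herm (h z) z] along [z = x v e_j + y v ^ 2 e_i] over the circles [|v| = r] kills every term of [h] but the
   linear one and [z_j ^ 2 e_i]. *)
Lemma Re_coef2_radius i j (x : R) (y : R[i]) (r : R) : i != j ->
  0 <= x -> x ^+ 2 + cmod y ^+ 2 <= 1 -> 0 < r -> r < 1 ->
  0 <= complex.Re (c * ((r ^+ 2 * x ^+ 2)%:C +
    (r ^+ 4)%:C * (y^*%C * (y + coef2 h i j * (x ^+ 2)%:C)))).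
Proof.
move=> ij x0 xy r0 r1; have [hh [h0 Jh] _] := Mh.
have ji : (j == i) = false by rewrite eq_sym; apply/negbTE.
pose zeta (v : R[i]) : 'C[R]_n := (x%:C * v) *: evec j + (y * v ^+ 2) *: evec i.
have zj v : zeta v 0 j = x%:C * v.
  by rewrite !mxE !eqxx ji /= mulr0 addr0 mulr1.
have zi v : zeta v 0 i = y * v ^+ 2.
  by rewrite !mxE !eqxx (negbTE ij) /= mulr0 add0r mulr1.
have zk v k : k != i -> k != j -> zeta v 0 k = 0.
  by move=> ki kj; rewrite !mxE (negbTE ki) (negbTE kj) !andbF !mulr0 addr0.
have x1 : x <= 1.
  rewrite -(ler_pXn2r (n := 2)) ?nnegrE // expr1n.
  by have := sqr_ge0 (cmod y); lra.
have y1 : cmod y <= 1.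
  rewrite -(ler_pXn2r (n := 2)) ?nnegrE ?cmod_ge0 // expr1n.
  by have := sqr_ge0 x; lra.
have sumE (G : 'I_n -> R) : (forall k, k != i -> k != j -> G k = 0) ->
    \sum_(k < n) G k = G j + G i.
  move=> G0; rewrite (bigD1 j) //= (bigD1 i) //= big1 ?addr0 //.
  by move=> k /andP[kj ki]; exact: G0.
have csumE (G : 'I_n -> R[i]) : (forall k, k != i -> k != j -> G k = 0) ->
    \sum_(k < n) G k = G j + G i.
  move=> G0; rewrite (bigD1 j) //= (bigD1 i) //= big1 ?addr0 //.
  by move=> k /andP[kj ki]; exact: G0.
have nz v : cmod v <= 1 -> enorm (zeta v) <= cmod v.
  move=> v1; rewrite -(ler_pXn2r (n := 2)) ?nnegrE ?enorm_ge0 ?cmod_ge0 //.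
  rewrite sqr_enorm sumE; last by move=> k ki kj; rewrite zk // cmod0 expr0n.
  rewrite zj zi (cmodM x%:C) (cmodM y) cmodX cmod_nneg // !exprMn.
  have v2 : cmod v ^+ 2 <= 1 by rewrite exprn_ile1 ?cmod_ge0.
  have v4 : (cmod v ^+ 2) ^+ 2 <= cmod v ^+ 2.
    by rewrite -[leRHS]mulr1 expr2 ler_wpM2l ?sqr_ge0.
  have h1 : cmod y ^+ 2 * (cmod v ^+ 2) ^+ 2 <= cmod y ^+ 2 * cmod v ^+ 2.
    by rewrite ler_wpM2l ?sqr_ge0.
  have h2 : (x ^+ 2 + cmod y ^+ 2) * cmod v ^+ 2 <= 1 * cmod v ^+ 2.
    by rewrite ler_wpM2r ?sqr_ge0.
  by rewrite mulrDl mul1r in h2; lra.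
pose phi k v := h (zeta v) 0 k.
have dphi k v : cmod v < 1 -> cdiff (phi k) v.
  move=> v1; have [l dl] : hdiff (fun z => h z 0 k) (zeta v).
    by apply: (Hol_comp k hh); apply: le_lt_trans (nz v (ltW v1)) v1.
  exists (\sum_(m < n) (x%:C *: evec j + (y * (2%:R * v ^+ 1)) *: evec i) 0 m * l 0 m).
  apply: (hderiv_comp (g := zeta)) dl => m.
  have := cderivD (cderivM (cderivZ x%:C (cderiv_id v)) (cderiv_cst ((evec j : 'C[R]_n) 0 m) v))
    (cderivM (cderivZ y (cderivX v 1)) (cderiv_cst ((evec i : 'C[R]_n) 0 m) v)).
  rewrite !mulr0 !addr0 mulr1.
  have -> : (x%:C *: evec j + (y * (2%:R * v ^+ 1)) *: evec i) 0 m =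
    x%:C * (evec j : 'C[R]_n) 0 m + y * (2%:R * v ^+ 1) * (evec i : 'C[R]_n) 0 m.
    by rewrite mxE [X in X + _]mxE [X in _ + X]mxE.
  congr cderiv; apply/funext => s.
  by rewrite /zeta !mxE.
(* On [|v| = r] this is [<h(zeta v), zeta v>], with [v^*] rewritten as [r ^ 2 / v]. In this form it
   is holomorphic off 0, and its average is its limit [L] at 0. *)
pose B v := (r ^+ 2)%:C * (x%:C * (phi j v / v)) +
  (r ^+ 4)%:C * (y^*%C * (phi i v / v ^+ 2)).
pose L := (r ^+ 2 * x ^+ 2)%:C + (r ^+ 4)%:C * (y^*%C * (y + coef2 h i j * (x ^+ 2)%:C)).
have dB v : 0 < cmod v -> cmod v < 1 -> cdiff B v.
  rewrite cmod_gt0 => v0 v1.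
  have [l dl] := dphi j v v1; have [m dm] := dphi i v v1.
  have d1 := cderivM dl (cderivV v0).
  have v20 : v ^+ 2 != 0 by rewrite expf_neq0.
  have d2 := cderivM dm (cderiv_comp (cderivX v 1) (cderivV v20)).
  by eexists; exact: (cderivD (cderivZ (r ^+ 2)%:C (cderivZ x%:C d1))
    (cderivZ (r ^+ 4)%:C (cderivZ y^*%C d2))).
have [C1 C10 o1] := @Mcal_order1 R n; have [C2 C20 o2] := @Mcal_order2 R n.
have BL : tends0 B L.
  move=> e e0; pose K := C1 + (C2 + C2).
  have K0 : 0 < K by rewrite !addr_gt0.
  exists (Num.min (1 / 64) (e / K)); first by rewrite lt_min !divr_gt0.
  move=> v vp; rewrite lt_min (ltr_pdivlMr _ _ K0) => /andP[v64 ve].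
  have v0 : v != 0 by rewrite -cmod_gt0.
  have v1 : cmod v <= 1 by lra.
  have nzv := nz v v1.
  have nz2 : enorm (zeta v) ^+ 2 <= cmod v ^+ 2.
    by rewrite ler_pXn2r // nnegrE ?enorm_ge0 ?cmod_ge0.
  have nz3 : enorm (zeta v) ^+ 3 <= cmod v ^+ 3.
    by rewrite ler_pXn2r // nnegrE ?enorm_ge0 ?cmod_ge0.
  have b1 : cmod (phi j v / v - x%:C) <= C1 * cmod v.
    rewrite -(ler_pM2r vp) -cmodM.
    have -> : (phi j v / v - x%:C) * v = phi j v - zeta v 0 j.
      by rewrite zj; field.
    have nz32 : enorm (zeta v) < 1 / 32 by lra.
    apply: le_trans (o1 h (zeta v) j Mh nz32) _.
    by rewrite -mulrA -expr2 ler_pM2l.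
  have b2 : cmod (phi i v / v ^+ 2 - (y + coef2 h i j * (x ^+ 2)%:C)) <= (C2 + C2) * cmod v.
    have v2p : 0 < cmod v ^+ 2 by rewrite exprn_gt0.
    rewrite -(ler_pM2r v2p) -[in leLHS](cmodX v) -cmodM.
    have -> : (phi i v / v ^+ 2 - (y + coef2 h i j * (x ^+ 2)%:C)) * v ^+ 2 =
       phi i v - zeta v 0 i - coef2 h i j * zeta v 0 j ^+ 2.
      by rewrite zj zi rmorphXn /=; field.
    have nz64 : enorm (zeta v) < 1 / 64 by lra.
    apply: le_trans (o2 h (zeta v) i j Mh ij nz64) _.
    have -> : zeta v - zeta v 0 j *: evec j = (y * v ^+ 2) *: evec i.
      by rewrite zj /zeta addrC addrA addNr add0r.
    rewrite enormZ enorm_evec mulr1 cmodM cmodX.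
    have t1 : cmod y * cmod v ^+ 2 <= cmod v ^+ 2 by rewrite ler_piMl ?sqr_ge0.
    have -> : (C2 + C2) * cmod v * cmod v ^+ 2 = C2 * cmod v * cmod v ^+ 2 + C2 * cmod v ^+ 3.
      by ring.
    apply: lerD; last by rewrite ler_pM2l.
    apply: ler_pM => //; first by rewrite mulr_ge0 ?enorm_ge0 // ltW.
      by rewrite mulr_ge0 ?cmod_ge0 ?sqr_ge0.
    by rewrite ler_pM2l.
  have -> : B v - L = (r ^+ 2 * x)%:C * (phi j v / v - x%:C) +
     (r ^+ 4)%:C * y^*%C * (phi i v / v ^+ 2 - (y + coef2 h i j * (x ^+ 2)%:C)).
    by rewrite /B /L !rmorphM /= ; ring.
  apply: le_trans (cmodD _ _) _; rewrite !cmodM cmod_conj.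
  have rx0 : 0 <= r ^+ 2 * x by rewrite mulr_ge0 ?sqr_ge0.
  have r40 : 0 <= r ^+ 4 by rewrite exprn_ge0 // ltW.
  rewrite !cmod_nneg //.
  have rx1 : r ^+ 2 * x <= 1 by rewrite mulr_ile1 ?sqr_ge0 // exprn_ile1 // ltW.
  have r41 : r ^+ 4 * cmod y <= 1 by rewrite mulr_ile1 ?cmod_ge0 // exprn_ile1 // ltW.
  have t1 : r ^+ 2 * x * cmod (phi j v / v - x%:C) <= 1 * (C1 * cmod v).
    by apply: ler_pM; rewrite ?cmod_ge0.
  have t2 : r ^+ 4 * cmod y * cmod (phi i v / v ^+ 2 - (y + coef2 h i j * (x ^+ 2)%:C))
      <= 1 * ((C2 + C2) * cmod v).
    by apply: ler_pM => //; [apply: mulr_ge0 => //; exact: cmod_ge0|exact: cmod_ge0].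
  have ve' : cmod v * (C1 + (C2 + C2)) < e := ve.
  by lra.
have cB : ccirc r B.
  by apply: diff_ccirc; [exact: ltW|move=> w wr; apply: dB; rewrite wr].
rewrite -/L -(cavg_mean dB BL r0 r1) -cavgZ //.
apply: Re_cavg_ge0; first exact: ltW.
  by apply: ccircM => //; exact: ccirc_cst.
move=> v vr; have v0 : v != 0 by rewrite -cmod_gt0 vr.
have -> : B v = herm (h (zeta v)) (zeta v).
  rewrite /herm csumE; last by move=> k ki kj; rewrite zk // conjc0 mulr0.
  rewrite zj zi -!/(phi _ v) /B.
  have -> : (x%:C * v)^*%C = x%:C * v^*%C by rewrite rmorphM /= oppr0.
  have -> : (y * v ^+ 2)^*%C = y^*%C * v^*%C ^+ 2 by rewrite rmorphM rmorphXn.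
  have -> : (r ^+ 4)%:C = ((r ^+ 2)%:C) ^+ 2 :> R[i] by rewrite -rmorphXn -exprM.
  rewrite -vr -mulcJ; move: (v^*%C) (y^*%C) => vb yb; by field.
have [z0|z0] := eqVneq (zeta v) 0.
  by rewrite z0 hermC herm0l conjc0 mulr0.
apply: hc => //; rewrite /eball /=; apply: (le_lt_trans _ r1).
by rewrite -vr; apply: nz; rewrite vr ltW.
Qed.

(** The limit of [Re_coef2_radius] as [r] tends to 1, after division by [r ^ 2]. *)
Lemma Re_coef2_sphere i j (x : R) (y : R[i]) : i != j ->
  0 <= x -> x ^+ 2 + cmod y ^+ 2 <= 1 ->
  0 <= complex.Re (c * ((x ^+ 2)%:C + y^*%C * (y + coef2 h i j * (x ^+ 2)%:C))).
Proof.
move=> ij x0 xy.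
set Y := y^*%C * _; set X := (x ^+ 2)%:C.
pose a := complex.Re (c * X); pose b := complex.Re (c * Y).
have main (r : R) : 0 < r -> r < 1 -> 0 <= a + r ^+ 2 * b.
  move=> r0 r1; have := Re_coef2_radius ij x0 xy r0 r1; rewrite -/Y.
  have -> : c * ((r ^+ 2 * x ^+ 2)%:C + (r ^+ 4)%:C * Y) =
    (r ^+ 2)%:C * (c * X + (r ^+ 2)%:C * (c * Y)).
    have -> : (r ^+ 4)%:C = ((r ^+ 2)%:C) ^+ 2 :> R[i] by rewrite -rmorphXn -exprM.
    by rewrite rmorphM /= /X; ring.
  by rewrite cReMr pmulr_rge0 ?exprn_gt0 // cReD cReMr.
rewrite mulrDr cReD -/a -/b leNgt; apply/negP => ab.
have [b0|b0] := leP 0 b.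
  have := main (1 / 2) ltac:(lra) ltac:(lra).
  have : (1 / 2) ^+ 2 * b <= 1 * b by rewrite ler_wpM2r //; lra.
  lra.
(* If [a + b] and [b] were negative, then at [r = 1 - d] the value would be below [(a + b) / 2]. *)
pose d := Num.min (1 / 2) ((a + b) / (4 * b)).
have b4 : 4 * b < 0 by lra.
have d0 : 0 < d.
  by rewrite lt_min; apply/andP; split; [lra|rewrite nmulr_lgt0 // invr_lt0].
have d1 : d <= 1 / 2 by rewrite ge_min lexx.
have d2 : (a + b) <= d * (4 * b) by rewrite -ler_ndivlMr // ge_min lexx orbT.
have := main (1 - d) ltac:(lra) ltac:(lra).
have -> : a + (1 - d) ^+ 2 * b = (a + b) - d * (4 * b) / 2 + d ^+ 2 * b by field.
have : d ^+ 2 * b < 0 by rewrite pmulr_rlt0 // exprn_gt0.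
lra.
Qed.

Lemma coef2_le i j : i != j ->  cmod c = 1 ->
  cmod (coef2 h i j) <= 3 * Num.sqrt 3 / 2 * complex.Re c.
Proof.
move=> ij c1; set q := coef2 h i j.
have [u u1 eu] := unimodular_align (c * q).
have s3 : 0 < Num.sqrt 3 :> R by rewrite sqrtr_gt0.
have ss3 : Num.sqrt 3 ^+ 2 = 3 :> R by rewrite sqr_sqrtr.
(* The maximum point of [x ^ 2 * |y|] on the sphere; the argument of [y] is chosen so that the term
   with [q] becomes negative real. *)
pose x : R := Num.sqrt (2 / 3).
have x2 : x ^+ 2 = 2 / 3 by rewrite sqr_sqrtr //; lra.
pose y : R[i] := - (Num.sqrt 3)^-1%:C * u^*%C.
have cy : cmod y ^+ 2 = 1 / 3.
  rewrite cmodM cmodN cmod_conj u1 mulr1 cmod_nneg ?invr_ge0 ?ltW //.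
  by rewrite exprVn ss3 div1r.
have h1 : x ^+ 2 + cmod y ^+ 2 <= 1 by rewrite x2 cy; lra.
have := Re_coef2_sphere ij (sqrtr_ge0 _) h1; rewrite -/q -/x.
have yb : y^*%C = - (Num.sqrt 3)^-1%:C * u.
  by rewrite /y rmorphM /= conjcK oppr0.
have -> : c * ((x ^+ 2)%:C + y^*%C * (y + q * (x ^+ 2)%:C)) =
  ((x ^+ 2)%:C + y * y^*%C) * c + - ((Num.sqrt 3)^-1 * x ^+ 2)%:C * (u * (c * q)).
  by rewrite rmorphM yb; ring.
rewrite mulcJ eu.
set N := (Num.sqrt 3)^-1 * x ^+ 2.
have -> : ((x ^+ 2)%:C + (cmod y ^+ 2)%:C) * c + - N%:C * (cmod (c * q))%:C =
  (x ^+ 2 + cmod y ^+ 2)%:C * c + (- (N * cmod (c * q)))%:C.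
  by rewrite rmorphD rmorphN rmorphM /=; ring.
rewrite cReD cReMr /N /= cmodM c1 mul1r cy x2.
have -> : 2 / 3 + 1 / 3 = 1 :> R by lra.
rewrite mul1r => h2.
have : (Num.sqrt 3)^-1 * (2 / 3) * cmod q <= complex.Re c by lra.
rewrite -(ler_pM2l (x := 3 * Num.sqrt 3 / 2)); last by rewrite !mulr_gt0.
congr (_ <= _); field; exact: lt0r_neq0.
Qed.

End SecondCoefficient.

Section SectorCoefficient.
Context {R : realType} {n : nat}.

Lemma cos_half_angle (alpha : R) : cos ((1 - alpha) * (pi / 2)) = sin (alpha * pi / 2).
Proof.
have -> : (1 - alpha) * (pi / 2) = - (alpha * pi / 2 - pi / 2) by field.
by rewrite cosN cosBpihalf.
Qed.

(** The half-plane used is bounded by the line through one ray of the sector; the real part of its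
    unit normal [c] is the distance from 1 to that line. *)
Lemma Mcal_g_coef2 (h : 'C[R]_n -> 'C[R]_n) (alpha : R) (i j : 'I_n) :
  0 < alpha <= 1 -> Mcal_g (sector_map alpha) h -> i != j ->
  cmod (coef2 h i j) <= sharp_bound alpha.
Proof.
move=> ha hg ij; have Mh := Mcal_g_Mcal ha hg.
have := @coef2_le R n h (cis ((1 - alpha) * (pi / 2))) Mh _ i j ij (cmod_cis _).
rewrite /= cos_half_angle; apply => z bz z0.
by have [_ /ltW] := Mcal_g_Re ha hg bz z0.
Qed.

End SectorCoefficient.

(** * Loewner flows *)

Section AlmostEverywhere.
Context {R : realType}.
Implicit Types (u : R -> R) (a b s t x y d e L : R).

Local Notation mu := (@lebesgue_measure R).

Definition rderiv u t d := forall e, 0 < e -> exists2 r, 0 < r &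
  forall s, `|s - t| < r -> `|u s - u t - d * (s - t)| <= e * `|s - t|.

Definition loc_lip u a b := forall t, a <= t -> t <= b -> exists L, exists2 r, 0 < r &
  forall x y, a <= x -> x <= b -> a <= y -> y <= b -> `|x - t| < r -> `|y - t| < r ->
    `|u y - u x| <= L * `|y - x|.

(** Compactness of the segment: on adjacent intervals the larger of two Lipschitz constants serves
    for the union, so [cousin] applies. *)
Lemma loc_lip_lip u a b : a <= b -> loc_lip u a b -> exists2 L, 0 <= L &
  forall x y, a <= x -> x <= y -> y <= b -> `|u y - u x| <= L * (y - x).
Proof.
move=> ab lu; pose P s s' := exists2 L, 0 <= L &
  forall x y, s <= x -> x <= y -> y <= s' -> `|u y - u x| <= L * (y - x).
apply: (cousin (P := P)) => //.
- move=> p q r _ pq qr _ [L L0 hL] [L' L'0 hL']; exists (Num.max L L').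
    by rewrite le_max L0.
  move=> x y px xy yr.
  have w1 v w : v <= w -> L * (w - v) <= Num.max L L' * (w - v).
    by move=> vw; rewrite ler_wpM2r ?subr_ge0 // le_max lexx.
  have w2 v w : v <= w -> L' * (w - v) <= Num.max L L' * (w - v).
    by move=> vw; rewrite ler_wpM2r ?subr_ge0 // le_max lexx orbT.
  have [yq|/ltW qy] := leP y q; first exact: le_trans (hL x y px xy yq) (w1 _ _ xy).
  have [qx|/ltW xq] := leP q x; first exact: le_trans (hL' x y qx xy yr) (w2 _ _ xy).
  have -> : u y - u x = (u y - u q) + (u q - u x) by ring.
  apply: le_trans (ler_normD _ _) _.
  have := hL x q px xq (lexx _); have := hL' q y (lexx _) qy yr.
  have := w1 _ _ xq; have := w2 _ _ qy.
  have -> : Num.max L L' * (y - x) = Num.max L L' * (y - q) + Num.max L L' * (q - x) by ring.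
  lra.
- move=> t t0 t1; have [L [r r0 hr]] := lu t t0 t1.
  exists r => // s s' as_ st ts' s'b h1 h2; exists (Num.max L 0).
    by rewrite le_max lexx orbT.
  move=> x y sx xy ys'.
  apply: (@le_trans _ _ (L * `|y - x|)).
    by apply: hr; try lra; rewrite ltr_norml; apply/andP; split; lra.
  rewrite ger0_norm ?subr_ge0 // ler_wpM2r ?subr_ge0 // le_max lexx //.
Qed.

(* An open set of small measure containing the exceptional null set absorbs the increase of [u] there. *)
Lemma ae_nonincreasing u a b : a <= b -> loc_lip u a b ->
  {ae mu, forall t, a <= t -> t <= b -> exists2 d, d <= 0 & rderiv u t d} ->
  u b <= u a.
Proof.
move=> ab /(loc_lip_lip ab)[L L0 hL] [N [mN N0 hN]].
apply/ler_addgt0Pl => e e0.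
pose e1 := e / 2 / (b - a + 1); pose e2 := e / 2 / (L + 1).
have ba0 : 0 < b - a + 1 by lra.
have L10 : 0 < L + 1 by lra.
have e10 : 0 < e1 by rewrite !divr_gt0.
have e20 : 0 < e2 by rewrite !divr_gt0.
have Noo : (mu N < +oo)%E by rewrite N0.
have [U [oU NU muU]] := lebesgue_regularity_outer mN Noo e20.
have mU : measurable U by exact: measurable_realfun.open_measurable.
have muU' : (mu U < e2%:E)%E.
  have -> : (mu U = mu N + mu (U `\` N))%E.
    rewrite -{1}(setDUK NU); apply: measureU => //; first exact: measurableD.
    by rewrite setDIK.
  by rewrite N0 add0e.
(* [sg x], the measure of [U] below [x], is nondecreasing, bounded by [e2], and grows by at least
   the length over an interval contained in [U]. *)
pose V x := U `&` `]-oo, x[%classic.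
have mV x : measurable (V x) by apply: measurableI.
have Vfin x : (mu (V x) < +oo)%E.
  have VU : (mu (V x) <= mu U)%E.
    by apply: le_measure; [by apply: mem_set; exact: mV|by apply: mem_set; exact: mU|exact: subIsetl].
  by apply: le_lt_trans VU _; apply: lt_trans muU' (ltry _).
have Vnum x : mu (V x) \is a fin_num by rewrite ge0_fin_numE.
pose sg x := fine (mu (V x)).
have sg0 x : 0 <= sg x by rewrite fine_ge0.
have sge x : sg x <= e2.
  rewrite -lee_fin fineK //; apply: le_trans (ltW muU').
  by apply: le_measure; [by apply: mem_set; exact: mV|by apply: mem_set; exact: mU|exact: subIsetl].
have sgm x y : x <= y -> sg x <= sg y.
  move=> xy; apply: fine_le => //; apply: le_measure; [by apply: mem_set; exact: mV|by apply: mem_set; exact: mV|].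
  by apply: setIS => z /=; rewrite !in_itv /= => zx; exact: lt_le_trans xy.
have sgU x y : x <= y -> (forall z, x <= z -> z < y -> U z) -> y - x <= sg y - sg x.
  move=> xy hU; rewrite lerBrDl.
  have -> : y - x = fine (mu `[x, y[).
    by rewrite lebesgue_measure_itv /= lte_fin; case: ltP => //= yx; lra.
  have Vxy : V x `|` `[x, y[ `<=` V y.
    move=> z [[Uz /=]|/=]; rewrite !in_itv /=.
      by move=> zx; split => //=; rewrite in_itv /=; exact: lt_le_trans xy.
    by move=> /andP[xz zy]; split=> /=; [exact: hU|rewrite in_itv].
  have fxy : mu `[x, y[ \is a fin_num.
    by rewrite lebesgue_measure_itv /=; case: ifP.
  rewrite -fineD //; apply: fine_le => //; first by rewrite fin_numD Vnum.
  have dj : V x `&` `[x, y[ = set0.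
    apply/seteqP; split=> z //= [[_ /=]]; rewrite !in_itv /= => zx /andP[xz _].
    by have := lt_le_trans zx xz; rewrite ltxx.
  have := measureU mu (mV x) (measurable_itv `[x, y[) dj => <-.
  by apply: le_measure; [by apply: mem_set; apply: measurableU; [exact: mV|exact: measurable_itv]|by apply: mem_set; exact: mV|].
(* An additive bound: around a point outside [N] the sign of the derivative makes the first term
   suffice; around a point of [N] the Lipschitz bound is paid for by the second. *)
pose P s s' := u s' - u s <= e1 * (s' - s) + L * (sg s' - sg s).
have : P a b.
  apply: (cousin (P := P)) => // [x y z _ xy yz _|t ta tb].
    rewrite /P; lra.
  have [Nt|nNt] := pselect (N t).
    have := oU t (NU _ Nt); rewrite nbhs_ballP => -[r /= r0 hr].
    exists r => // s s' as_ st ts' s'b h1 h2; rewrite /P.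
    have ss' : s <= s' by exact: le_trans st ts'.
    have := hL s s' as_ ss' s'b => h3.
    have h4 : u s' - u s <= L * (s' - s) by exact: le_trans (ler_norm _) h3.
    have h5 : s' - s <= sg s' - sg s.
      apply: sgU => // z sz zs'; apply: hr; rewrite /ball /=.
      by rewrite ltr_norml; apply/andP; split; lra.
    have h6 : L * (s' - s) <= L * (sg s' - sg s) by rewrite ler_wpM2l.
    have h7 : 0 <= e1 * (s' - s) by rewrite mulr_ge0 ?subr_ge0 // ltW.
    lra.
  have [d d0 hd] : exists2 d, d <= 0 & rderiv u t d.
    by apply: contrapT => hc; apply: nNt; apply: hN => /= hc'; apply: hc; exact: hc'.
  have [r r0 hr] := hd e1 e10.
  exists r => // s s' as_ st ts' s'b h1 h2; rewrite /P.
  have k1 : u s' - u t <= e1 * (s' - t).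
    have := hr s'; rewrite ger0_norm ?subr_ge0 // => /(_ h2) /(le_trans (ler_norm _)).
    have : d * (s' - t) <= 0 by rewrite mulr_le0_ge0 // subr_ge0.
    lra.
  have k2 : u t - u s <= e1 * (t - s).
    have := hr s; rewrite ler0_norm ?subr_le0 // opprB => /(_ h1).
    rewrite -normrN => /(le_trans (ler_norm _)).
    have : d * (t - s) <= 0 by rewrite mulr_le0_ge0 // subr_ge0.
    lra.
  have k3 : 0 <= L * (sg s' - sg s).
    by rewrite mulr_ge0 // subr_ge0 sgm // (le_trans st).
  lra.
rewrite /P => h.
have h1 : e1 * (b - a) <= e / 2.
  rewrite /e1 mulrAC ler_pdivrMr // ler_wpM2l //; lra.
have h2 : L * (sg b - sg a) <= e / 2.
  apply: (@le_trans _ _ (L * e2)).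
    by rewrite ler_wpM2l //; have := sg0 a; have := sge b; lra.
  rewrite /e2 mulrA ler_pdivrMr // mulrC ler_wpM2l //; lra.
lra.
Qed.

End AlmostEverywhere.

(** * Calculus of curves in a real parameter *)

Section RealDerivative.
Context {R : realType} {n : nat}.
Implicit Types (u g : R -> R) (a b s t x y d e L : R) (v : R -> 'C[R]_n).

Lemma rderiv_is_derive u t d : rderiv u t d -> is_derive t 1 u d.
Proof.
move=> du.
have h : s^-1 *: (u (s *: (1 : R) + t) - u t) @[s --> 0^'] --> d.
  apply/cvgrPdist_le => e e0; have [r r0 hr] := du e e0.
  exists r => // s /=; rewrite sub0r normrN => sr s0.
  have := hr (s + t); rewrite addrK => /(_ sr) hs.
  have sp : 0 < `|s| by rewrite normr_gt0.
  rewrite /GRing.scale /= mulr1 -(ler_pM2r sp) -normrM.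
  have -> : (d - s^-1 * (u (s + t) - u t)) * s = - (u (s + t) - u t - d * s) by field.
  by rewrite normrN.
by split; [apply/cvg_ex; exists d|exact: cvg_lim h].
Qed.

Lemma rderivD u g t d e : rderiv u t d -> rderiv g t e ->
  rderiv (fun s => u s + g s) t (d + e).
Proof.
move=> /rderiv_is_derive du /rderiv_is_derive dg.
exact: is_derive_eps (is_deriveD du dg).
Qed.

Lemma rderivM u g t d e : rderiv u t d -> rderiv g t e ->
  rderiv (fun s => u s * g s) t (u t * e + g t * d).
Proof.
move=> /rderiv_is_derive du /rderiv_is_derive dg.
have := is_derive_eps (is_deriveM du dg); exact.
Qed.

Lemma rderiv_cst t (c : R) : rderiv (fun=> c) t 0.
Proof.
by move=> e e0; exists 1 => // s _; rewrite subrr mul0r subr0 normr0 mulr_ge0 // ltW.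
Qed.

Lemma rderivZ u t d (c : R) : rderiv u t d -> rderiv (fun s => c * u s) t (c * d).
Proof.
by move=> du; have := rderivM (rderiv_cst t c) du; rewrite mulr0 addr0.
Qed.

Lemma rderiv_expR (k t : R) : rderiv (fun s => expR (k * s)) t (k * expR (k * t)).
Proof.
apply: is_derive_eps.
have h : is_derive t 1 (fun s : R => k * s) k.
  apply: rderiv_is_derive => e e0; exists 1 => // s _.
  have -> : k * s - k * t - k * (s - t) = 0 by ring.
  by rewrite normr0 mulr_ge0 // ltW.
have := @is_derive1_comp R expR (fun s => k * s) t (expR (k * t)) k (is_derive_expR _) h.
by rewrite mulrC.
Qed.

Lemma rderiv_sum (I : Type) (r : seq I) (F : I -> R -> R) (D : I -> R) t :
  (forall i, rderiv (F i) t (D i)) ->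
  rderiv (fun s => \sum_(i <- r) F i s) t (\sum_(i <- r) D i).
Proof.
move=> dF; elim: r => [|i r IH].
  rewrite big_nil; have := rderiv_cst t 0; congr rderiv.
  by apply/funext => s; rewrite big_nil.
rewrite big_cons; have := rderivD (dF i) IH; congr rderiv.
by apply/funext => s; rewrite big_cons.
Qed.

Lemma loc_lip_cst (c a b : R) : loc_lip (fun=> c) a b.
Proof.
move=> t _ _; exists 0, 1 => // x y *; by rewrite subrr normr0 mul0r.
Qed.

Lemma loc_lipD u g a b : loc_lip u a b -> loc_lip g a b ->
  loc_lip (fun s => u s + g s) a b.
Proof.
move=> lu lg t ta tb; have [L [r r0 h]] := lu t ta tb; have [L' [r' r'0 h']] := lg t ta tb.
exists (L + L'), (Num.min r r'); first by rewrite lt_min r0.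
move=> x y ax xb ay yb; rewrite !lt_min => /andP[x1 x2] /andP[y1 y2].
rewrite opprD addrACA; apply: le_trans (ler_normD _ _) _; rewrite mulrDl.
by apply: lerD; [exact: h|exact: h'].
Qed.

Lemma loc_lipM u g a b : loc_lip u a b -> loc_lip g a b ->
  loc_lip (fun s => u s * g s) a b.
Proof.
move=> lu lg t ta tb; have [L [r r0 h]] := lu t ta tb; have [L' [r' r'0 h']] := lg t ta tb.
pose A := `|u t| + `|L|; pose B := `|g t| + `|L'|.
exists (A * `|L'| + B * `|L|), (Num.min 1 (Num.min r r')).
  by rewrite !lt_min ltr01 r0.
move=> x y ax xb ay yb; rewrite !lt_min => /andP[x0 /andP[x1 x2]] /andP[y0 /andP[y1 y2]].
have tt : `|t - t| < r by rewrite subrr normr0.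
have tt' : `|t - t| < r' by rewrite subrr normr0.
have bu z : a <= z -> z <= b -> `|z - t| < 1 -> `|z - t| < r -> `|u z| <= A.
  move=> az zb z1 zr; have := h t z ta tb az zb tt zr => hh.
  have -> : u z = u t + (u z - u t) by ring.
  apply: le_trans (ler_normD _ _) _; rewrite lerD2l; apply: le_trans hh _.
  apply: le_trans (ler_wpM2r _ (ler_norm L)) _ => //.
  by rewrite ler_piMr // ltW.
have bg z : a <= z -> z <= b -> `|z - t| < 1 -> `|z - t| < r' -> `|g z| <= B.
  move=> az zb z1 zr; have := h' t z ta tb az zb tt' zr => hh.
  have -> : g z = g t + (g z - g t) by ring.
  apply: le_trans (ler_normD _ _) _; rewrite lerD2l; apply: le_trans hh _.
  apply: le_trans (ler_wpM2r _ (ler_norm L')) _ => //.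
  by rewrite ler_piMr // ltW.
have -> : u y * g y - u x * g x = u y * (g y - g x) + g x * (u y - u x) by ring.
apply: le_trans (ler_normD _ _) _; rewrite !normrM mulrDl -!mulrA.
apply: lerD; apply: ler_pM => //.
- exact: bu.
- by apply: le_trans (h' x y ax xb ay yb x2 y2) _; rewrite ler_wpM2r // ler_norm.
- exact: bg.
- by apply: le_trans (h x y ax xb ay yb x1 y1) _; rewrite ler_wpM2r // ler_norm.
Qed.

Lemma loc_lip_expR (k a b : R) : loc_lip (fun s => expR (k * s)) a b.
Proof.
move=> t ta tb; pose B := `|k| * (`|a| + `|b|).
exists (expR B * `|k|), 1 => // x y ax xb ay yb _ _.
have bd z : a <= z -> z <= b -> expR (k * z) <= expR B.
  move=> az zb; rewrite ler_expR; apply: le_trans (ler_norm _) _.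
  rewrite normrM ler_wpM2l // ler_norml; apply/andP; split.
    by have := ler_norm (- a); rewrite normrN; have := normr_ge0 b; lra.
  by have := ler_norm b; have := normr_ge0 a; lra.
have main p q : a <= p -> p <= b -> a <= q -> q <= b -> expR (k * p) <= expR (k * q) ->
    `|expR (k * q) - expR (k * p)| <= expR B * `|k| * `|q - p|.
  move=> ap pb aq qb pq; rewrite ger0_norm ?subr_ge0 // -mulrA -normrM mulrBr.
  have e : expR (k * p) = expR (k * q) * expR (k * p - k * q) by rewrite -expRD addrC subrK.
  have h1 : 1 + (k * p - k * q) <= expR (k * p - k * q) by exact: expR_ge1Dx.
  have h2 : expR (k * q) * (1 + (k * p - k * q)) <= expR (k * p).
    by rewrite e ler_pM2l ?expR_gt0.
  rewrite ler_expR in pq.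
  rewrite ger0_norm ?subr_ge0 //.
  have h3 : expR (k * q) * (k * q - k * p) <= expR B * (k * q - k * p).
    by rewrite ler_wpM2r ?subr_ge0 //; exact: bd.
  have e4 : expR (k * q) * (1 + (k * p - k * q)) =
    expR (k * q) - expR (k * q) * (k * q - k * p) by ring.
  lra.
have [h|/ltW h] := leP (expR (k * x)) (expR (k * y)); first exact: main.
by rewrite distrC [`|y - x|]distrC; exact: main.
Qed.

Lemma loc_lip_sum (I : Type) (r : seq I) (F : I -> R -> R) a b :
  (forall i, loc_lip (F i) a b) -> loc_lip (fun s => \sum_(i <- r) F i s) a b.
Proof.
move=> lF; elim: r => [|i r IH].
  have := @loc_lip_cst 0 a b; congr loc_lip.
  by apply/funext => s; rewrite big_nil.
have := loc_lipD (lF i) IH; congr loc_lip.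
by apply/funext => s; rewrite big_cons.
Qed.

(** The factor [c] covers real parts ([c = 1]), imaginary parts ([c = - 'i]) and the rotations used
    to estimate moduli. *)
Lemma loc_lip_Re v (c : R[i]) (k : 'I_n) b : locally_lipschitz v ->
  loc_lip (fun s => complex.Re (c * v s 0 k)) 0 b.
Proof.
move=> lv t t0 _; have [L] := lv t t0.
move=> [[P Q] /= [/nbhs_ballP[r /= r0 hr] /nbhs_ballP[r' /= r'0 hr']] hPQ].
exists (cmod c * L), (Num.min r r'); first by rewrite lt_min r0.
move=> x y x0 _ y0 _; rewrite !lt_min => /andP[x1 x2] /andP[y1 y2].
rewrite -cReN -cReD -mulrBr; apply: le_trans (absRe_le _) _.
rewrite cmodM -mulrA ler_wpM2l ?cmod_ge0 //.
have := hPQ (y, x) _; rewrite /= => /(_ _ y0 x0) h.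
apply: le_trans (h _); last first.
  by split; [apply: hr|apply: hr']; rewrite /ball /= distrC.
by have := le_cmod_enorm (v y - v x) k; rewrite !mxE.
Qed.

Lemma rderiv_Re v t (w : 'C[R]_n) (c : R[i]) (k : 'I_n) : has_rderiv v t w ->
  rderiv (fun s => complex.Re (c * v s 0 k)) t (complex.Re (c * w 0 k)).
Proof.
move=> dv e e0; pose e' := e / (cmod c + 1).
have c0 := cmod_ge0 c.
have c1 : 0 < cmod c + 1 by lra.
have e'0 : 0 < e' by rewrite divr_gt0.
pose A := [set z : 'C[R]_n | enorm (z - w) < e'].
have : nbhs w A by apply/nbhs_enormP; exists e'.
move=> /dv [r /= r0 hr]; exists r => // s sr.
have [->|st] := eqVneq s t; first by rewrite !subrr mulr0 subrr normr0 mulr0.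
have := hr s; rewrite /= distrC => /(_ sr st); rewrite /A /= => h.
have sp : 0 < `|s - t| by rewrite normr_gt0 subr_eq0.
have -> : complex.Re (c * v s 0 k) - complex.Re (c * v t 0 k) -
    complex.Re (c * w 0 k) * (s - t) =
  complex.Re (c * ((s - t)%:C * (((s - t)^-1%:C *: (v s - v t) - w) 0 k))).
  have -> : (s - t)%:C * (((s - t)^-1%:C *: (v s - v t) - w) 0 k) =
    v s 0 k - v t 0 k - (s - t)%:C * w 0 k.
    rewrite !mxE mulrBr mulrA -rmorphM mulfV ?mul1r //.
    by rewrite subr_eq0.
  have -> : c * (v s 0 k - v t 0 k - (s - t)%:C * w 0 k) =
    c * v s 0 k - c * v t 0 k - (s - t)%:C * (c * w 0 k) by ring.
  by rewrite !cReD !cReN cReMr; ring.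
apply: le_trans (absRe_le _) _; rewrite !cmodM cmod_real mulrCA mulrC ler_pM2r //.
have := le_cmod_enorm ((s - t)^-1%:C *: (v s - v t) - w) k => h2.
apply: (@le_trans _ _ (cmod c * e')).
  by rewrite ler_wpM2l //; apply: le_trans h2 (ltW h).
rewrite /e' mulrA ler_pdivrMr // mulrC ler_wpM2l //; lra.
Qed.

End RealDerivative.

Section Decay.
Context {R : realType} {n : nat}.

Local Notation mu := (@lebesgue_measure R).

(** The derivative of [expR t * y_k] is [expR t * (y_k + d_k)]. For each rotation [c] the function
    [u], which adds the tail [M / nu * expR (- nu * t)] of the integral of the bound, is
    nonincreasing. *)
Lemma ae_decay_bound (y : R -> 'C[R]_n) (d : R -> 'C[R]_n) (k : 'I_n) (M nu T : R) :
  0 <= T -> 0 <= M -> 0 < nu -> locally_lipschitz y ->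
  {ae mu, forall t, 0 <= t -> has_rderiv y t (d t) /\
     cmod ((expR t)%:C * (y t 0 k + d t 0 k)) <= M * expR (- nu * t)} ->
  cmod ((expR T)%:C * y T 0 k - y 0 0 k) <= M / nu.
Proof.
move=> T0 M0 nu0 ly aey; apply: cmod_le_Re => c c1.
pose u t := expR (1 * t) * complex.Re (c * y t 0 k) + M / nu * expR (- nu * t).
have lu : loc_lip u 0 T.
  apply: loc_lipD; last first.
    by apply: loc_lipM; [exact: loc_lip_cst|exact: loc_lip_expR].
  by apply: loc_lipM; [exact: loc_lip_expR|exact: loc_lip_Re].
have : u T <= u 0.
  apply: ae_nonincreasing => //.
  have [N [mN N0 hN]] := aey; exists N; split=> // t nt; apply: hN => /= ht.
  apply: nt => t0 _; have [dy hy] := ht t0.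
  exists (expR (1 * t) * complex.Re (c * d t 0 k) +
     complex.Re (c * y t 0 k) * (1 * expR (1 * t)) + M / nu * (- nu * expR (- nu * t))).
    rewrite !mul1r.
    have h1 : complex.Re (c * ((expR t)%:C * (y t 0 k + d t 0 k))) <= M * expR (- nu * t).
      by apply: le_trans (Re_le_cmod _) _; rewrite cmodM c1 mul1r.
    rewrite mulrCA cReMr mulrDr cReD in h1.
    have -> : M / nu * (- nu * expR (- nu * t)) = - (M * expR (- nu * t)).
      by field; rewrite gt_eqF.
    lra.
  apply: rderivD; last by apply: rderivZ; exact: rderiv_expR.
  by apply: rderivM; [exact: rderiv_expR|exact: rderiv_Re].
rewrite /u !mulr0 expR0 mulr1 !mul1r => h.
rewrite mulrBr mulrCA cReD cReN cReMr.
have : 0 <= M / nu * expR (- nu * T).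
  by rewrite mulr_ge0 ?expR_ge0 // divr_ge0 // ltW.
lra.
Qed.

End Decay.

(** * A priori estimates for Loewner flows *)

Section LoewnerEstimates.
Context {R : realType} {n : nat}.
Implicit Types (h : 'C[R]_n -> R -> 'C[R]_n) (z w : 'C[R]_n) (y : R -> 'C[R]_n).

Local Notation mu := (@lebesgue_measure R).

(** The square norm has derivative [- 2 Re <h(y), y>] almost everywhere, so its product with
    [expR (lam * t)] is nonincreasing. *)
Lemma flow_energy h z y (lam T : R) : 0 <= T -> loewner_solution h z y ->
  (forall t, 0 <= t ->
     lam * enorm (y t) ^+ 2 <= 2 * complex.Re (herm (h (y t) t) (y t))) ->
  enorm (y T) ^+ 2 * expR (lam * T) <= enorm z ^+ 2.
Proof.
move=> T0 [ly by_ dy y0] hlam.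
pose E t := \sum_(k < n) (complex.Re (1 * y t 0 k) * complex.Re (1 * y t 0 k) +
   complex.Re (- 'i%C * y t 0 k) * complex.Re (- 'i%C * y t 0 k)).
have EE t : E t = enorm (y t) ^+ 2.
  rewrite sqr_enorm; apply: eq_bigr => k _.
  by rewrite mul1r cRe_i sqr_cmod !expr2.
have lE : loc_lip E 0 T.
  by apply: loc_lip_sum => k; apply: loc_lipD; apply: loc_lipM; exact: loc_lip_Re.
have := @ae_nonincreasing R (fun t => E t * expR (lam * t)) 0 T T0.
rewrite mulr0 expR0 mulr1 !EE y0; apply.
  by apply: loc_lipM => //; exact: loc_lip_expR.
have [N [mN N0 hN]] := dy; exists N; split=> // t nt; apply: hN => /= ht.
apply: nt => t0 _; have {}ht := ht t0.
set d := - h (y t) t in ht.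
have dE : rderiv E t (2 * complex.Re (herm d (y t))).
  have -> : 2 * complex.Re (herm d (y t)) = \sum_(k < n)
    ((complex.Re (1 * y t 0 k) * complex.Re (1 * d 0 k) +
      complex.Re (1 * y t 0 k) * complex.Re (1 * d 0 k)) +
     (complex.Re (- 'i%C * y t 0 k) * complex.Re (- 'i%C * d 0 k) +
      complex.Re (- 'i%C * y t 0 k) * complex.Re (- 'i%C * d 0 k))).
    rewrite /herm cRe_sum mulr_sumr; apply: eq_bigr => k _.
    by rewrite !mul1r !cRe_i cReM cReC cImC; ring.
  by apply: rderiv_sum => k; apply: rderivD; apply: rderivM; exact: rderiv_Re.
exists (E t * (lam * expR (lam * t)) + expR (lam * t) * (2 * complex.Re (herm d (y t)))).
  have -> : herm d (y t) = - herm (h (y t) t) (y t).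
    by rewrite /d -scaleN1r hermZl mulN1r.
  rewrite EE cReN.
  have -> : enorm (y t) ^+ 2 * (lam * expR (lam * t)) +
     expR (lam * t) * (2 * - complex.Re (herm (h (y t) t) (y t))) =
    expR (lam * t) * (lam * enorm (y t) ^+ 2 - 2 * complex.Re (herm (h (y t) t) (y t))).
    by ring.
  by rewrite pmulr_rle0 ?expR_gt0 // subr_le0 hlam.
by apply: rderivM => //; exact: rderiv_expR.
Qed.

Lemma flow_nonincreasing h z y (T : R) : 0 <= T -> Herglotz h ->
  loewner_solution h z y -> enorm (y T) <= enorm z.
Proof.
move=> T0 [hM _] sol; have [ly by_ dy y0] := sol.
have := @flow_energy h z y 0 T T0 sol.
rewrite mul0r expR0 mulr1 ler_pXn2r ?nnegrE ?enorm_ge0 //; apply=> t t0.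
rewrite mul0r mulr_ge0 //; have [->|yn] := eqVneq (y t) 0.
  by rewrite hermC herm0l conjc0.
exact: ltW (Mcal_Re (hM t t0) (by_ t t0) yn).
Qed.

(** The norm never exceeds its initial value, so [Mcal_herm] gives a rate valid for all time. *)
Lemma flow_decay h z y (T : R) : 0 <= T -> Herglotz h -> enorm z <= 1 / 8 ->
  loewner_solution h z y ->
  enorm (y T) <= enorm z * expR (- (1 - 8 * enorm z) * T).
Proof.
move=> T0 hh z8 sol; have := @flow_energy h z y (2 * (1 - 8 * enorm z)) T T0 sol.
set k := 1 - 8 * enorm z => /(_ _) en.
have e2 : expR (2 * k * T) = expR (k * T) ^+ 2.
  by rewrite -expRM_natl; congr expR; ring.
have {}en : enorm (y T) * expR (k * T) <= enorm z.
  rewrite -(ler_pXn2r (n := 2)) ?nnegrE ?mulr_ge0 ?enorm_ge0 ?expR_ge0 //.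
  rewrite exprMn -e2; apply: en => t t0.
  have yz := flow_nonincreasing t0 hh sol.
  have [b _] := Mcal_herm (hh.1 t t0) (le_trans yz z8).
  have := Re_le_cmod ((enorm (y t) ^+ 2)%:C - herm (h (y t) t) (y t)).
  rewrite cmod_distC cReD cReN /= => b'.
  have b3 : enorm (y t) ^+ 3 <= enorm z * enorm (y t) ^+ 2.
    by rewrite exprS ler_wpM2r ?sqr_ge0.
  have -> : 2 * k * enorm (y t) ^+ 2 =
    2 * enorm (y t) ^+ 2 - 16 * (enorm z * enorm (y t) ^+ 2) by rewrite /k; ring.
  lra.
by rewrite mulNr expRN -ler_pdivrMr ?invr_gt0 ?expR_gt0 // invrK.
Qed.

Lemma ae_and (P Q : R -> Prop) :
  {ae mu, forall t, P t} -> {ae mu, forall t, Q t} -> {ae mu, forall t, P t /\ Q t}.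
Proof.
move=> [N [mN N0 hN]] [N' [mN' N'0 hN']]; exists (N `|` N'); split.
- exact: measurableU.
- by rewrite measureU0.
- move=> t nt; have [Pt|nPt] := pselect (P t); last by left; exact: hN.
  by right; apply: hN' => /= Qt; apply: nt.
Qed.

(* With [delta = enorm z] the flow decays like [expR (- (1 - 8 delta) t)], so only the coefficients of
   [z_j ^ 2] contribute at order [delta ^ 2]. *)
Lemma flow_second_order (B : R) (i j : 'I_n) : 0 <= B -> i != j ->
  exists2 C : R, 0 < C & forall h (v : R[i]) y (T : R), Herglotz h -> 0 <= T ->
    cmod v < 1 / 64 ->
    {ae mu, forall t, 0 <= t -> cmod (coef2 (h^~ t) i j) <= B} ->
    loewner_solution h (v *: evec j) y ->
    cmod ((expR T)%:C * y T 0 i) * (1 - 16 * cmod v) <=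
      B * cmod v ^+ 2 + C * cmod v ^+ 3.
Proof.
move=> B0 ij; have [C1 C10 o1] := @Mcal_order1 R n; have [C2 C20 o2] := @Mcal_order2 R n.
pose C3 := C2 * (n%:R * (2 * C1)) + C2.
have C30 : 0 < C3 by rewrite ltr_wpDl // !mulr_ge0 // ltW.
exists C3 => // h v y T hh T0; set dl := cmod v => v64 aeB sol.
have [ly by_ dy y0] := sol.
have dl0 : 0 <= dl by exact: cmod_ge0.
have z_dl : enorm (v *: evec j) = dl by rewrite enormZ enorm_evec mulr1.
(* Since [nu = 2 * kp - 1], the square of the flow times [expR t] decays at the rate [nu]. *)
pose kp := 1 - 8 * dl; pose nu := 1 - 16 * dl.
have nu2 : 1 / 2 <= nu by rewrite /nu; lra.
have nu0 : 0 < nu by lra.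
have ydec t : 0 <= t -> enorm (y t) <= dl * expR (- kp * t).
  move=> t0; have := @flow_decay h _ y t t0 hh _ sol; rewrite z_dl; apply; lra.
have ydl t : 0 <= t -> enorm (y t) <= dl.
  by move=> t0; rewrite -z_dl; exact: flow_nonincreasing sol.
(* Off the axis the flow starts at 0 and is driven by terms of order [dl ^ 2]; this makes the mixed
   error of [Mcal_order2] cubic in [dl]. *)
have yk t k : 0 <= t -> k != j -> cmod (y t 0 k) <= 2 * C1 * dl ^+ 2 * expR (- t).
  move=> t0 kj.
  have h1 : cmod ((expR t)%:C * y t 0 k - y 0 0 k) <= C1 * dl ^+ 2 / nu.
    apply: (@ae_decay_bound R n y (fun t => - h (y t) t)) => //.
      by rewrite mulr_ge0 ?sqr_ge0 // ltW.
    have [N [mN N0 hN]] := dy; exists N; split=> // s ns; apply: hN => /= hs.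
    apply: ns => s0; split; first exact: hs.
    rewrite !mxE cmodM cmod_nneg ?expR_ge0 // cmod_distC.
    have y32 : enorm (y s) < 1 / 32 by have := ydl s s0; lra.
    have b := o1 _ _ k (hh.1 s s0) y32.
    have b2 : enorm (y s) ^+ 2 <= (dl * expR (- kp * s)) ^+ 2.
      rewrite ler_pXn2r ?nnegrE ?enorm_ge0 ?mulr_ge0 ?expR_ge0 //; exact: ydec.
    have -> : C1 * dl ^+ 2 * expR (- nu * s) = expR s * (C1 * (dl * expR (- kp * s)) ^+ 2).
      have -> : - nu * s = s + (- kp * s + - kp * s) by rewrite /nu /kp; ring.
      by rewrite !expRD; ring.
    by rewrite ler_pM2l ?expR_gt0 //; apply: le_trans b _; rewrite ler_pM2l.
  rewrite y0 !mxE (negbTE kj) andbF mulr0 subr0 in h1.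
  rewrite cmodM cmod_nneg ?expR_ge0 // in h1.
  rewrite expRN ler_pdivlMr ?expR_gt0 // mulrC; apply: le_trans h1 _.
  rewrite ler_pdivrMr //.
  have : 2 * C1 * dl ^+ 2 * (1 / 2) <= 2 * C1 * dl ^+ 2 * nu.
    by apply: ler_wpM2l => //; rewrite !mulr_ge0 ?sqr_ge0 // ltW.
  lra.
have w' t : 0 <= t -> enorm (y t - y t 0 j *: evec j) <= n%:R * (2 * C1) * dl ^+ 2 * expR (- t).
  move=> t0; apply: le_trans (enorm_le_sum _) _.
  have -> : n%:R * (2 * C1) * dl ^+ 2 * expR (- t) =
     \sum_(k < n) 2 * C1 * dl ^+ 2 * expR (- t).
    by rewrite sumr_const card_ord -mulr_natl; ring.
  apply: ler_sum => k _; rewrite !mxE /=.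
  have [->|kj] := eqVneq k j.
    by rewrite mulr1 subrr cmod0 !mulr_ge0 ?expR_ge0 ?sqr_ge0 // ltW.
  by rewrite mulr0 subr0; exact: yk.
have main : cmod ((expR T)%:C * y T 0 i - y 0 0 i) <= (B * dl ^+ 2 + C3 * dl ^+ 3) / nu.
  apply: (@ae_decay_bound R n y (fun t => - h (y t) t)) => //.
    by rewrite addr_ge0 // mulr_ge0 ?sqr_ge0 ?exprn_ge0 // ltW.
  have [N [mN N0 hN]] := ae_and dy aeB; exists N; split=> // s ns; apply: hN => /= -[hs qs].
  apply: ns => s0; split; first exact: hs.
  have {}qs := qs s0; set q := coef2 _ i j in qs.
  rewrite !mxE cmodM cmod_nneg ?expR_ge0 // cmod_distC.
  have y64 : enorm (y s) < 1 / 64 by have := ydl s s0; lra.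
  have b := o2 _ _ i j (hh.1 s s0) ij y64; rewrite -/q in b.
  have yj : cmod (y s 0 j) <= dl * expR (- kp * s).
    by apply: le_trans (le_cmod_enorm _ _) _; exact: ydec.
  have yd := ydec s s0; have wd := w' s s0.
  have ys0 := enorm_ge0 (y s).
  have K0 : 0 <= dl * expR (- kp * s) by rewrite mulr_ge0 ?expR_ge0.
  have b1 : cmod (q * y s 0 j ^+ 2) <= B * (dl * expR (- kp * s)) ^+ 2.
    rewrite cmodM cmodX; apply: ler_pM; rewrite ?cmod_ge0 ?exprn_ge0 ?cmod_ge0 //.
    by rewrite ler_pXn2r ?nnegrE ?cmod_ge0.
  have b2 : C2 * enorm (y s) * enorm (y s - y s 0 j *: evec j) <=
    C2 * (dl * expR (- kp * s)) * (n%:R * (2 * C1) * dl ^+ 2 * expR (- s)).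
    apply: ler_pM; rewrite ?mulr_ge0 ?enorm_ge0 ?ler_pM2l // ltW //.
  have b3 : C2 * enorm (y s) ^+ 3 <= C2 * (dl * expR (- kp * s)) ^+ 3.
    by rewrite ler_pM2l // ler_pXn2r ?nnegrE.
  have tot : cmod (h (y s) s 0 i - y s 0 i) <= B * (dl * expR (- kp * s)) ^+ 2 +
     C2 * (dl * expR (- kp * s)) * (n%:R * (2 * C1) * dl ^+ 2 * expR (- s)) +
     C2 * (dl * expR (- kp * s)) ^+ 3.
    have -> : h (y s) s 0 i - y s 0 i =
      (h (y s) s 0 i - y s 0 i - q * y s 0 j ^+ 2) + q * y s 0 j ^+ 2 by ring.
    by apply: le_trans (cmodD _ _) _; lra.
  (* The quadratic, mixed and cubic terms, multiplied by [expR s], all decay at least at the rate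
     [nu]. *)
  have es1 : expR s * expR (- kp * s) ^+ 2 = expR (- nu * s).
    rewrite expr2 -!expRD; congr expR; rewrite /nu /kp; ring.
  have es2 : expR s * (expR (- kp * s) * expR (- s)) <= expR (- nu * s).
    rewrite -!expRD ler_expR.
    have -> : s + (- kp * s + - s) = - nu * s - 8 * (dl * s) by rewrite /nu /kp; ring.
    by rewrite lerBlDr lerDl !mulr_ge0.
  have es3 : expR s * expR (- kp * s) ^+ 3 <= expR (- nu * s).
    rewrite !exprS expr0 mulr1 -!expRD ler_expR.
    have -> : s + (- kp * s + (- kp * s + - kp * s)) = - nu * s - kp * s by rewrite /nu /kp; ring.
    by rewrite lerBlDr lerDl mulr_ge0 // /kp; lra.
  apply: le_trans (ler_wpM2l (expR_ge0 s) tot) _.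
  have d3 : 0 <= dl ^+ 3 by rewrite exprn_ge0.
  have t2 : C2 * (n%:R * (2 * C1)) * dl ^+ 3 * (expR s * (expR (- kp * s) * expR (- s))) <=
    C2 * (n%:R * (2 * C1)) * dl ^+ 3 * expR (- nu * s).
    by apply: ler_wpM2l => //; rewrite !mulr_ge0 // ltW.
  have t3 : C2 * dl ^+ 3 * (expR s * expR (- kp * s) ^+ 3) <= C2 * dl ^+ 3 * expR (- nu * s).
    by apply: ler_wpM2l => //; rewrite mulr_ge0 // ltW.
  have -> : expR s * (B * (dl * expR (- kp * s)) ^+ 2 +
     C2 * (dl * expR (- kp * s)) * (n%:R * (2 * C1) * dl ^+ 2 * expR (- s)) +
     C2 * (dl * expR (- kp * s)) ^+ 3) =
    B * dl ^+ 2 * (expR s * expR (- kp * s) ^+ 2) +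
    C2 * (n%:R * (2 * C1)) * dl ^+ 3 * (expR s * (expR (- kp * s) * expR (- s))) +
    C2 * dl ^+ 3 * (expR s * expR (- kp * s) ^+ 3) by ring.
  rewrite es1 /C3.
  have -> : (B * dl ^+ 2 + (C2 * (n%:R * (2 * C1)) + C2) * dl ^+ 3) * expR (- nu * s) =
    B * dl ^+ 2 * expR (- nu * s) + C2 * (n%:R * (2 * C1)) * dl ^+ 3 * expR (- nu * s) +
    C2 * dl ^+ 3 * expR (- nu * s) by ring.
  lra.
rewrite y0 !mxE (negbTE ij) andbF mulr0 subr0 in main.
by rewrite -/nu -ler_pdivlMr.
Qed.

End LoewnerEstimates.

(** * Second order coefficients of the two families *)

Section SecondDerivative.
Context {R : realType} {n : nat}.
Implicit Types (f : 'C[R]_n -> 'C[R]_n) (z : 'C[R]_n) (i j k : 'I_n).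

Lemma Hol_axis f i j : Hol f -> hol_disc (fun v => f (v *: evec j) 0 i) 0 1.
Proof.
move=> hf v v1; have := @hol_slice _ _ (fun x => f x 0 i) 1 0 (evec j) 1 (Hol_comp i hf).
rewrite enorm_evec enorm0 mulr1 add0r lexx => /(_ isT ltr01 v v1).
by congr cdiff; apply/funext => x; rewrite add0r.
Qed.

Lemma derive_dird f z i j : Hol f -> eball z ->
  'D_(evec j) (fun z => f z 0 i) z = dird (fun z => f z 0 i) z (evec j).
Proof.
move=> hf bz; apply: cderiv_derive; apply: derP; apply: (@hdiff_slice _ _ (fun z => f z 0 i)).
by rewrite scale0r addr0; exact: (Hol_comp i hf bz).
Qed.

Lemma dird_axis f i j (v : R[i]) : Hol f -> cmod v < 1 ->
  dird (fun z => f z 0 i) (v *: evec j) (evec j) = der (fun v => f (v *: evec j) 0 i) v.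
Proof.
move=> hf v1; apply/esym/derE.
have := @dirdP _ _ (fun z => f z 0 i) 1 0 (evec j) v (Hol_comp i hf).
rewrite add0r enormZ enorm_evec mulr1 => /(_ v1).
by congr cderiv; apply/funext => x; rewrite add0r.
Qed.

(** The inner directional derivative agrees with [der] along the axis near 0, which is all that the
    outer one sees. *)
Lemma derive2_coef2 f i j : Hol f ->
  2^-1 * 'D_(evec j) ('D_(evec j) (fun z => f z 0 i)) 0 = coef2 f i j.
Proof.
move=> hf; rewrite mulrC; congr (_ / _); apply: cderiv_derive.
have h1 := hol_der (Hol_axis i j hf).
have c0 : cmod (0 - 0 : R[i]) < 1 by rewrite subrr cmod0.
have e (v : R[i]) : cmod v < 1 -> der (fun v => f (v *: evec j) 0 i) v =
    'D_(evec j) (fun z => f z 0 i) (0 + v *: evec j).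
  move=> v1; rewrite add0r derive_dird //; last by rewrite /eball /= enormZ enorm_evec mulr1.
  by rewrite dird_axis.
apply: cderiv_local (derP (h1 0 c0)).
  by apply: e; rewrite cmod0.
by exists 1 => // v; rewrite subr0; exact: e.
Qed.

Lemma Hol_locally_bounded f : Hol f -> f 0 = 0 ->
  exists2 rho : R, 0 < rho & rho <= 1 /\ forall z k, enorm z < rho -> cmod (f z 0 k) <= 1.
Proof.
move=> hf f0; have b0 : eball (0 : 'C[R]_n) by rewrite /eball /= enorm0.
have := differentiable_continuous (hf 0 b0) => cf.
have : nbhs (f 0) [set w : 'C[R]_n | enorm (w - f 0) < 1].
  by apply/nbhs_enormP; exists 1.
move=> /cf /nbhs_enormP[d d0 hd]; exists (Num.min d 1).
  by rewrite lt_min d0 ltr01.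
split=> [|z k]; first by rewrite ge_min lexx orbT.
rewrite lt_min => /andP[zd _]; have := hd z; rewrite subr0 => /(_ zd) /=.
rewrite f0 subr0 => h; apply: le_trans (le_cmod_enorm _ k) (ltW h).
Qed.

Lemma compactly_cvg_point (F : R -> 'C[R]_n -> 'C[R]_n) f z :
  {family compactly_in eball, F t @[t --> +oo] --> f} -> eball z ->
  forall e : R, 0 < e -> exists T0, forall t, T0 <= t -> enorm (F t z - f z) < e.
Proof.
move=> Ff bz e e0.
have cz : compactly_in eball [set z] by split; [move=> _ ->|exact: compact_set1].
have /fam_cvgP/(_ [set z] cz) := Ff.
rewrite uniform_set1 => h.
have : nbhs (f z) [set w : 'C[R]_n | enorm (w - f z) < e].
  by apply/nbhs_enormP; exists e.
move=> /h [T0 [_ hT]]; exists (T0 + 1) => t Tt.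
by have := hT t; apply; apply: lt_le_trans Tt; rewrite ltrDl.
Qed.

End SecondDerivative.

(** * The coefficient bound for [SS_zero] *)

Section ParametricRepresentation.
Context {R : realType} {n : nat}.

(** At [d e_j] the flow estimate passes to the limit in time by pointwise convergence; it is
    compared with the expansion of [f] on the axis, divided by [d ^ 2], and [d] tends to 0. *)
Lemma S_zero_coef2 (f : 'C[R]_n -> 'C[R]_n) (alpha : R) (i j : 'I_n) : 0 < alpha <= 1 ->
  SS_zero alpha f -> i != j -> cmod (coef2 f i j) <= sharp_bound alpha.
Proof.
move=> ha [hf nf [h [v [hh hg hv fl]]]] ij.
have [rho rho0 [rho1 hrho]] := Hol_locally_bounded hf (proj1 nf).
(* The maximum supplies the nonnegativity asked for by [flow_second_order]. *)
pose B := Num.max (sharp_bound alpha) 0.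
have B0 : 0 <= B by rewrite le_max lexx orbT.
suff : cmod (coef2 f i j) <= B.
  rewrite le_max => /orP[//|c0].
  have [q0|q0] := eqVneq (coef2 f i j) 0; last first.
    by move: c0; rewrite leNgt cmod_gt0 q0.
  have p0 := pi_gt0 R; case/andP: ha => a0 a1.
  rewrite q0 cmod0 /sharp_bound mulr_ge0 ?divr_ge0 ?mulr_ge0 ?sqrtr_ge0 //.
  apply: sin_ge0_pi; apply/andP; split; first by rewrite !mulr_ge0 // ltW.
  rewrite -mulrA; apply: (@le_trans _ _ (1 * (pi / 2))); last by lra.
  by rewrite ler_wpM2r //; lra.
have [C C0 hC] := @flow_second_order R n B i j B0 ij.
have aeB : {ae (@lebesgue_measure R), forall t, 0 <= t -> cmod (coef2 (h^~ t) i j) <= B}.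
  have [N [mN N0 hN]] := hg; exists N; split=> // t nt; apply: hN => /= ht; apply: nt => t0.
  by rewrite le_max (Mcal_g_coef2 ha (ht t0) ij).
set q := coef2 f i j.
pose C4 := 64 * 1 / rho ^+ 3.
have C40 : 0 <= C4 by apply: divr_ge0; [rewrite mulr1|apply: exprn_ge0; exact: ltW].
(* Three losses of order [d ^ 3]: the flow estimate, the expansion of [f] on the axis, and the
   factor [1 - 16 * d]. *)
pose K := C + C4 + 16 * cmod q.
have K0 : 0 <= K by rewrite /K; have := cmod_ge0 q; lra.
have small (d : R) : 0 < d -> d < 1 / 64 -> d < rho / 4 -> cmod q <= B + K * d.
  move=> d0 d64 dr.
  have cd : cmod d%:C = d by rewrite cmod_nneg // ltW.
  pose z : 'C[R]_n := d%:C *: evec j.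
  have zd : enorm z = d by rewrite enormZ enorm_evec mulr1 cd.
  have bz : eball z by rewrite /eball /= zd; lra.
  have lim : cmod (f z 0 i) * (1 - 16 * d) <= B * d ^+ 2 + C * d ^+ 3.
    apply/ler_addgt0Pl => e e0.
    have [T0 hT] := compactly_cvg_point fl bz e0.
    pose T := Num.max T0 0.
    have T0T : T0 <= T by rewrite le_max lexx.
    have TT : 0 <= T by rewrite le_max lexx orbT.
    have h1 := hT T T0T.
    have cd64 : cmod d%:C < 1 / 64 by rewrite cd.
    have h2 := hC h d%:C (v z) T hh TT cd64 aeB (proj1 (hv z bz)).
    rewrite cd in h2.
    have h3 := le_cmod_enorm ((expR T)%:C *: v z T - f z) i.
    have e1 : ((expR T)%:C *: v z T - f z) 0 i = (expR T)%:C * v z T 0 i - f z 0 i.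
      by rewrite !mxE.
    rewrite e1 cmod_distC in h3.
    have h4 : cmod (f z 0 i) <= e + cmod ((expR T)%:C * v z T 0 i).
      have -> : f z 0 i = (f z 0 i - (expR T)%:C * v z T 0 i) + (expR T)%:C * v z T 0 i by ring.
      by apply: le_trans (cmodD _ _) _; lra.
    have h5 : cmod (f z 0 i) * (1 - 16 * d) <=
        (e + cmod ((expR T)%:C * v z T 0 i)) * (1 - 16 * d).
      by rewrite ler_wpM2r //; lra.
    have h6 : e * (1 - 16 * d) <= e * 1 by rewrite ler_wpM2l //; lra.
    by rewrite mulrDl in h5; lra.
  have cr : cmod d%:C < rho / 4 by rewrite cd.
  have := normalized_axis hf nf rho0 rho1 hrho ij cr; rewrite -/z -/q -/C4 cd => ax.
  have c0 := cmod_ge0 q.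
  have h7 : cmod q * d ^+ 2 <= cmod (f z 0 i) + C4 * d ^+ 3.
    have -> : cmod q * d ^+ 2 = cmod (q * d%:C ^+ 2) by rewrite cmodM cmodX cd.
    have -> : q * d%:C ^+ 2 = f z 0 i - (f z 0 i - q * d%:C ^+ 2) by ring.
    by apply: le_trans (cmodB _ _) _; lra.
  have h8 : cmod q * d ^+ 2 * (1 - 16 * d) <= (cmod (f z 0 i) + C4 * d ^+ 3) * (1 - 16 * d).
    by rewrite ler_wpM2r //; lra.
  have h9 : C4 * d ^+ 3 * (1 - 16 * d) <= C4 * d ^+ 3 * 1.
    apply: ler_wpM2l; last by lra.
    by rewrite mulr_ge0 // exprn_ge0 // ltW.
  have d2 : 0 < d ^+ 2 by rewrite exprn_gt0.
  rewrite -(ler_pM2r d2) /K.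
  have -> : (B + (C + C4 + 16 * cmod q) * d) * d ^+ 2 =
    B * d ^+ 2 + C * d ^+ 3 + C4 * d ^+ 3 + 16 * (cmod q * d ^+ 3) by ring.
  rewrite mulrDl in h8.
  have e9 : cmod q * d ^+ 2 * (1 - 16 * d) = cmod q * d ^+ 2 - 16 * (cmod q * d ^+ 3) by ring.
  lra.
apply/ler_addgt0Pl => e e0.
pose d := Num.min (Num.min (1 / 128) (rho / 8)) (e / (K + 1)).
have K1 : 0 < K + 1 by lra.
have d0 : 0 < d by rewrite !lt_min !divr_gt0.
have d1 : d <= 1 / 128 by rewrite !ge_min lexx.
have d2 : d <= rho / 8 by rewrite !ge_min lexx orbT.
have d3 : d * (K + 1) <= e by rewrite -ler_pdivlMr // ge_min lexx orbT.
have := small d d0 ltac:(lra) ltac:(lra).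
have e3 : d * (K + 1) = K * d + d by ring.
lra.
Qed.

End ParametricRepresentation.

(** * The coefficient bound for [SS_star] *)

Section StarlikeMaps.
Context {R : realType} {n : nat}.
Implicit Types (f g h : 'C[R]_n -> 'C[R]_n) (z u w : 'C[R]_n) (i j k : 'I_n).

Lemma jacobian_slice f z u k : differentiable f z ->
  cderiv (fun v => f (z + v *: u) 0 k) 0 ((u *m 'J f z) 0 k).
Proof.
move=> df; have dH' := differentiable_hderiv k df.
have dH : hderiv (fun w => f w 0 k) (z + 0 *: u) (\row_m ('J f z) m k).
  by rewrite scale0r addr0.
have -> : (u *m 'J f z) 0 k = \sum_(m < n) u 0 m * (\row_m ('J f z) m k) 0 m.
  by rewrite mxE; apply: eq_bigr => m _; rewrite mxE.
apply: (hderiv_comp (H := fun w => f w 0 k) (g := fun v => z + v *: u)) dH => m.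
have := cderivD (cderiv_cst (z 0 m) 0) (cderivM (cderiv_id 0) (cderiv_cst (u 0 m) 0)).
rewrite mul1r mulr0 addr0 add0r; apply: cderiv_local; first by rewrite !mxE.
by exists 1 => // w _; rewrite !mxE.
Qed.

(** Differentiating [g (f w) = w] along lines through [z] exhibits the Jacobian of the local inverse
    as an inverse matrix. *)
Lemma locally_biholomorphic_unitmx f z : locally_biholomorphic f -> eball z ->
  'J f z \in unitmx.
Proof.
move=> hf bz; have [U [g [[oU Uz _] [df _ gf dg]]]] := hf z bz.
have dfz := df z Uz; have dgz : differentiable g (f z) by apply: dg; exists z.
suff h : 'J f z *m 'J g (f z) = 1%:M.
  have [h1 _] := mulmx1_unit h; exact: h1.
apply/row_matrixP => k; rewrite !rowE mulmxA mulmx1.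
set u := delta_mx 0 k; apply/rowP => m.
have dcomp : cderiv (fun v => g (f (z + v *: u)) 0 m) 0 ((u *m 'J f z *m 'J g (f z)) 0 m).
  have dH' := differentiable_hderiv m dgz.
  have dH : hderiv (fun w => g w 0 m) (f (z + 0 *: u)) (\row_l ('J g (f z)) l m).
    by rewrite scale0r addr0.
  have -> : (u *m 'J f z *m 'J g (f z)) 0 m =
      \sum_(l < n) (u *m 'J f z) 0 l * (\row_l ('J g (f z)) l m) 0 l.
    by rewrite [LHS]mxE; apply: eq_bigr => l _; congr (_ * _); rewrite [RHS]mxE.
  apply: (hderiv_comp (H := fun w => g w 0 m) (g := fun v => f (z + v *: u))) dH => l.
  exact: jacobian_slice.
have did : cderiv (fun v => g (f (z + v *: u)) 0 m) 0 (u 0 m).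
  have /nbhs_enormP[d d0 hd] : nbhs z U by exact: open_nbhs_nbhs.
  have := cderivD (cderiv_cst (z 0 m) 0) (cderivM (cderiv_id 0) (cderiv_cst (u 0 m) 0)).
  rewrite mul1r mulr0 addr0 add0r; apply: cderiv_local.
    by rewrite scale0r addr0 gf // mul0r addr0.
  have un : 0 < enorm u + 1 by have := enorm_ge0 u; lra.
  exists (d / (enorm u + 1)); first by rewrite divr_gt0.
  move=> v; rewrite subr0 ltr_pdivlMr // => vd; rewrite gf.
    by rewrite [RHS]mxE; congr (_ + _); rewrite [RHS]mxE.
  apply: hd; rewrite addrC addKr enormZ; apply: le_lt_trans vd.
  by rewrite ler_wpM2l ?cmod_ge0 //; lra.
exact: cderiv_unique dcomp did.
Qed.

Lemma jacobian_dird f z i k : differentiable f z ->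
  ('J f z) k i = dird (fun w => f w 0 i) z (evec k).
Proof.
move=> df; apply/esym/derE.
have <- : (evec k *m 'J f z) 0 i = ('J f z) k i by rewrite /evec -rowE [LHS]mxE.
exact: jacobian_slice.
Qed.

(* Comparing the [v ^ 2] terms of [f = h *m 'J f] along the axis [v *: evec j]. *)
Lemma starlike_coef2 f h i j : Hol f -> normalized f -> Mcal h -> i != j ->
  (forall z, eball z -> f z = h z *m 'J f z) -> coef2 h i j = - coef2 f i j.
Proof.
move=> hf nf Mh ij fh.
have [rho rho0 [rho1 hrho]] := Hol_locally_bounded hf (proj1 nf).
have [C1 C10 o1] := @Mcal_order1 R n; have [C2 C20 o2] := @Mcal_order2 R n.
set p := coef2 f i j; set q := coef2 h i j.
pose C4 := 64 * 1 / rho ^+ 3.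
have C40 : 0 <= C4 by apply: divr_ge0; [rewrite mulr1|apply: exprn_ge0; exact: ltW].
pose s := rho / 4; have s0 : 0 < s by rewrite divr_gt0.
pose K1 := 1 / s ^+ 2.
have K10 : 0 <= K1 by apply: divr_ge0 => //; exact: sqr_ge0.
pose phi (v : R[i]) := f (v *: evec j) 0 i.
have hphi : hol_disc phi 0 1 := Hol_axis i j hf.
have d0 : cdiff (der phi) 0 by apply: (hol_der hphi); rewrite subrr cmod0.
have dphi0 : der phi 0 = 0.
  have := @dird_axis R n f i j 0 hf; rewrite cmod0 => /(_ ltr01) <-.
  by rewrite scale0r normalized_dird // mxE (negbTE ij) andbF.
pose K := C1 * (2 * cmod p + 1) + C2 * (1 + K1) + cmod q * K1 + n%:R * (C1 * K1) + C4.
have K0 : 0 <= K.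
  have h1 : 0 <= C1 * (2 * cmod p + 1) by rewrite mulr_ge0 ?(ltW C10) // addr_ge0 // mulr_ge0 ?cmod_ge0.
  have h2 : 0 <= C2 * (1 + K1) by rewrite mulr_ge0 ?(ltW C20) // addr_ge0.
  have h3 : 0 <= cmod q * K1 by rewrite mulr_ge0 ?cmod_ge0.
  have h4 : 0 <= n%:R * (C1 * K1).
    by apply: mulr_ge0; [exact: ler0n|apply: mulr_ge0; [exact: ltW|]].
  by rewrite /K; lra.
apply/eqP; rewrite -subr_eq0 opprK -cmod_eq0 eq_le cmod_ge0 andbT.
apply/ler_addgt0Pl => e e0; rewrite addr0.
pose e1 := Num.min 1 (e / 2).
have e10 : 0 < e1 by rewrite lt_min ltr01 divr_gt0 //.
have e11 : e1 <= 1 by rewrite ge_min lexx.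
have e12 : e1 <= e / 2 by rewrite ge_min lexx orbT.
have dd0 := derP d0; have [r r0 hr] := dd0 e1 e10.
pose d := Num.min (Num.min (1 / 128) (rho / 8)) (Num.min (r / 2) (e / 2 / (K + 1))).
have KK : 0 < K + 1 by lra.
have dp : 0 < d by rewrite !lt_min !divr_gt0.
have d1 : d <= 1 / 128 by rewrite !ge_min lexx.
have d2 : d <= rho / 8 by rewrite !ge_min lexx orbT.
have d3 : d <= r / 2 by rewrite !ge_min lexx !orbT.
have d4 : d * (K + 1) <= e / 2 by rewrite -ler_pdivlMr // !ge_min lexx !orbT.
have cd : cmod d%:C = d by rewrite cmod_nneg // ltW.
pose z : 'C[R]_n := d%:C *: evec j.
have zd : enorm z = d by rewrite enormZ enorm_evec mulr1 cd.
have bz : eball z by rewrite /eball /= zd; lra.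
pose J k := ('J f z) k i.
have Jd k : cmod (J k - (k == i)%:R) <= K1 * d.
  rewrite /J jacobian_dird; last exact: hf.
  have -> : (k == i)%:R = dird (fun w => f w 0 i) 0 (evec k).
    by rewrite normalized_dird // mxE eqxx /= eq_sym.
  apply: le_trans (dird_lipschitz (s := s) _ (hol_ballW rho1 (Hol_comp i hf))
    (fun z zr => hrho z i zr) s0 _ _) _.
  - by rewrite enorm0 /s; lra.
  - by rewrite zd /s; lra.
  by rewrite subr0 zd enorm_evec mulr1.
(* Differentiability of [der phi] at 0, with value 0 and slope [2 * p]. *)
have Jj : cmod (J j - 2 * p * d%:C) <= e1 * d.
  rewrite /J jacobian_dird; last exact: hf.
  rewrite dird_axis // ?cd; last by lra.
  have := hr d%:C; rewrite dphi0 !subr0 cd => /(_ _) hdd.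
  have -> : 2 * p * d%:C = der (der phi) 0 * d%:C by rewrite /p /coef2 -/phi; field.
  by apply: hdd; lra.
have hk k : cmod (h z 0 k - z 0 k) <= C1 * d ^+ 2.
  by have := o1 h z k Mh; rewrite zd; apply; lra.
have hi : cmod (h z 0 i - q * d%:C ^+ 2) <= C2 * d ^+ 3.
  have := o2 h z i j Mh ij; rewrite zd -/q => /(_ _).
  have -> : z 0 i = 0 by rewrite !mxE (negbTE ij) andbF mulr0.
  have -> : z 0 j = d%:C by rewrite !mxE !eqxx mulr1.
  rewrite subrr enorm0 mulr0 add0r subr0; apply; lra.
have zk k : k != j -> z 0 k = 0 by move=> kj; rewrite !mxE (negbTE kj) andbF mulr0.
have zj : z 0 j = d%:C by rewrite !mxE !eqxx mulr1.
have fi : cmod (f z 0 i - p * d%:C ^+ 2) <= C4 * d ^+ 3.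
  have cr : cmod d%:C < rho / 4 by rewrite cd; lra.
  by have := normalized_axis hf nf rho0 rho1 hrho ij cr; rewrite -/z -/p -/C4 cd.
have ji : j != i by rewrite eq_sym.
(* At order [d ^ 2] the left side has coefficient [p], the index [j] contributes [2 * p], the index
   [i] contributes [q], and the rest is smaller. Hence [p = 2 * p + q]. *)
have fE : f z 0 i = h z 0 j * J j + (h z 0 i * J i +
    \sum_(k < n | (k != j) && (k != i)) h z 0 k * J k).
  by rewrite {1}(fh z bz) mxE (bigD1 j) //= (bigD1 i).
have dd : 0 < d ^+ 2 by rewrite exprn_gt0.
clearbody p q J.
have b1 : cmod (h z 0 j * J j - 2 * p * d%:C ^+ 2) <=
    C1 * (2 * cmod p + 1) * d ^+ 3 + e1 * d ^+ 2.
  have -> : h z 0 j * J j - 2 * p * d%:C ^+ 2 =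
    (h z 0 j - z 0 j) * J j + d%:C * (J j - 2 * p * d%:C) by rewrite zj; ring.
  apply: le_trans (cmodD _ _) _; rewrite !cmodM cd; apply: lerD; last first.
    have -> : e1 * d ^+ 2 = d * (e1 * d) by ring.
    by rewrite ler_pM2l.
  have -> : C1 * (2 * cmod p + 1) * d ^+ 3 = C1 * d ^+ 2 * ((2 * cmod p + 1) * d) by ring.
  apply: ler_pM; rewrite ?cmod_ge0 ?hk //.
  have -> : J j = 2 * p * d%:C + (J j - 2 * p * d%:C) by ring.
  apply: le_trans (cmodD _ _) _.
  have -> : (2 * cmod p + 1) * d = 2 * cmod p * d + d by ring.
  have -> : cmod (2 * p * d%:C) = 2 * cmod p * d.
    rewrite !cmodM cd; congr (_ * _ * _).
    by have := @cmod_nneg R 2 ltac:(lra); rewrite rmorph_nat.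
  rewrite lerD2l; apply: le_trans Jj _; rewrite -[leRHS]mul1r ler_pM2r //.
have b2 : cmod (h z 0 i * J i - q * d%:C ^+ 2) <=
    C2 * (1 + K1) * d ^+ 3 + cmod q * K1 * d ^+ 3.
  have J1 := Jd i; rewrite eqxx in J1.
  have -> : h z 0 i * J i - q * d%:C ^+ 2 =
    (h z 0 i - q * d%:C ^+ 2) * J i + q * d%:C ^+ 2 * (J i - 1) by ring.
  apply: le_trans (cmodD _ _) _; rewrite cmodM [X in _ + X]cmodM [cmod (q * _)]cmodM cmodX cd.
  apply: lerD; last first.
    have -> : cmod q * K1 * d ^+ 3 = cmod q * d ^+ 2 * (K1 * d) by ring.
    by rewrite ler_wpM2l // mulr_ge0 ?cmod_ge0 ?sqr_ge0.
  have -> : C2 * (1 + K1) * d ^+ 3 = C2 * d ^+ 3 * (1 + K1) by ring.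
  apply: ler_pM; rewrite ?cmod_ge0 //.
  have -> : J i = 1 + (J i - 1) by ring.
  apply: le_trans (cmodD _ _) _; rewrite cmod1 lerD2l; apply: le_trans J1 _.
  by rewrite -[leRHS]mulr1 ler_wpM2l //; lra.
have b3 : cmod (\sum_(k < n | (k != j) && (k != i)) h z 0 k * J k) <= n%:R * (C1 * K1) * d ^+ 3.
  apply: le_trans (cmod_sum _ _ _) _.
  apply: (@le_trans _ _ (\sum_(k < n) C1 * K1 * d ^+ 3)); last first.
    have -> : n%:R * (C1 * K1) * d ^+ 3 = n%:R * (C1 * K1 * d ^+ 3) by ring.
    by rewrite sumr_const card_ord mulr_natl.
  rewrite big_mkcond; apply: ler_sum => k _.
  have c0 : 0 <= C1 * K1 * d ^+ 3.
    apply: mulr_ge0; last by apply: exprn_ge0; exact: ltW.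
    by apply: mulr_ge0; [exact: ltW|].
  case: ifP => // /andP[kj ki].
  have -> : C1 * K1 * d ^+ 3 = C1 * d ^+ 2 * (K1 * d) by ring.
  have := hk k; have := Jd k; rewrite zk // (negbTE ki) !subr0 => h1 h2.
  by rewrite cmodM; apply: ler_pM; rewrite ?cmod_ge0.
have tot : cmod (q + p) * d ^+ 2 <= K * d ^+ 3 + e1 * d ^+ 2.
  have -> : cmod (q + p) * d ^+ 2 = cmod ((q + p) * d%:C ^+ 2) by rewrite cmodM cmodX cd.
  have -> : (q + p) * d%:C ^+ 2 = (f z 0 i - p * d%:C ^+ 2) -
    ((h z 0 j * J j - 2 * p * d%:C ^+ 2) + ((h z 0 i * J i - q * d%:C ^+ 2) +
    \sum_(k < n | (k != j) && (k != i)) h z 0 k * J k)) by rewrite fE; ring.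
  apply: le_trans (cmodB _ _) _.
  have t1 := cmodD (h z 0 j * J j - 2 * p * d%:C ^+ 2) ((h z 0 i * J i - q * d%:C ^+ 2) +
    \sum_(k < n | (k != j) && (k != i)) h z 0 k * J k).
  have t2 := cmodD (h z 0 i * J i - q * d%:C ^+ 2)
    (\sum_(k < n | (k != j) && (k != i)) h z 0 k * J k).
  have -> : K * d ^+ 3 = C1 * (2 * cmod p + 1) * d ^+ 3 + C2 * (1 + K1) * d ^+ 3 +
     cmod q * K1 * d ^+ 3 + n%:R * (C1 * K1) * d ^+ 3 + C4 * d ^+ 3 by rewrite /K; ring.
  lra.
have : cmod (q + p) <= K * d + e1.
  rewrite -(ler_pM2r dd); apply: le_trans tot _.
  by rewrite le_eqVlt; apply/orP; left; apply/eqP; ring.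
have e3 : d * (K + 1) = K * d + d by ring.
lra.
Qed.

Lemma S_star_coef2 f (alpha : R) i j : 0 < alpha <= 1 ->
  SS_star alpha f -> i != j -> cmod (coef2 f i j) <= sharp_bound alpha.
Proof.
move=> ha [hf nf bf hg] ij.
have Mh := Mcal_g_Mcal ha hg.
have := Mcal_g_coef2 ha hg ij; rewrite (starlike_coef2 hf nf Mh ij) ?cmodN //.
move=> z bz; rewrite -mulmxA mulVmx ?mulmx1 //.
exact: locally_biholomorphic_unitmx.
Qed.

End StarlikeMaps.

Lemma is_diff_near (K : numFieldType) (V W : normedModType K) (f : V -> W)
    (L : {linear V -> W}) z : continuous L ->
  (forall eps : K, 0 < eps ->
     \forall u \near (0 : V), `|f (u + z) - f z - L u| <= eps * `|u|) ->
  is_diff z f L.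
Proof.
move=> cL fL.
have e : f \o shift z = cst (f z) + L +o_ 0 id.
  apply/eqaddoP => eps eps0; apply: filterS (fL eps eps0) => u.
  by rewrite -addrA -opprD.
have dE := diff_unique cL e.
by apply: DiffDef => //; apply/diff_locallyP; rewrite dE.
Qed.

(** * The extremal maps *)

Section Shear.
Context {R : realType} {n : nat}.
Implicit Types (f g : 'C[R]_n -> 'C[R]_n) (z u w : 'C[R]_n) (J : 'M[R[i]]_n).

Lemma mulmx_bound J : exists2 K : R, 0 < K & forall u, enorm (u *m J) <= K * enorm u.
Proof.
pose K := \sum_(k < n) enorm (row k J).
exists (K + 1).
  by rewrite ltr_wpDl // sumr_ge0 // => k _; exact: enorm_ge0.
move=> u; rewrite {1}(row_sum_delta u) mulmx_suml.
apply: le_trans (enorm_sum _ _ _) _.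
apply: (@le_trans _ _ (K * enorm u)); last first.
  by rewrite ler_wpM2r ?enorm_ge0 // lerDl.
rewrite /K mulr_suml; apply: ler_sum => k _.
by rewrite -scalemxAl -rowE enormZ mulrC ler_wpM2l ?enorm_ge0 ?le_cmod_enorm.
Qed.

Lemma is_diff_mulmx f z J :
  (forall eps : R, 0 < eps -> exists2 d, 0 < d & forall u, enorm u < d ->
     enorm (f (u + z) - f z - u *m J) <= eps * enorm u) ->
  is_diff z f (mulmxr J).
Proof.
move=> df; have [K K0 hK] := mulmx_bound J.
have cJ : continuous (mulmxr J : 'C[R]_n -> 'C[R]_n).
  move=> w A /nbhs_enormP[d d0 hd]; apply/nbhs_enormP.
  exists (d / K); first by rewrite divr_gt0.
  move=> x; rewrite ltr_pdivlMr // mulrC => xd; apply: hd => /=.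
  by rewrite -mulmxBl; apply: le_lt_trans (hK _) xd.
apply: is_diff_near => // eps eps0.
have er : eps = (complex.Re eps)%:C.
  by move: eps0; rewrite ltcE => /andP[/eqP /= i0 _]; case: eps i0 => a b /= ->.
have r0 : 0 < complex.Re eps by rewrite -ltcR -er.
have n1 : 0 < n.+1%:R :> R by rewrite ltr0n.
have e0 : 0 < complex.Re eps / n.+1%:R by rewrite divr_gt0.
have [d d0 hd] := df _ e0; apply/nbhs_enormP; exists d => // u.
rewrite subr0 => /hd h; apply: le_trans (norm_le_enorm _) _.
have ru : `|u| = (complex.Re `|u|)%:C.
  have : 0 <= `|u| by exact: normr_ge0.
  by rewrite lecE => /andP[/eqP /= i0 _]; case: `|u| i0 => a b /= ->.
have h2 : enorm u <= n.+1%:R * complex.Re `|u|.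
  have := @enorm_le_norm R n u (complex.Re `|u|); rewrite -ru lexx => /(_ isT).
  move=> /le_trans; apply; rewrite ler_wpM2r ?ler_nat //.
  by rewrite -ler0c -ru normr_ge0.
rewrite er ru -rmorphM lecR; apply: le_trans h _.
by rewrite mulrAC ler_pdivrMr // -mulrA ler_pM2l // mulrC.
Qed.

Lemma is_diff_jacobian f z J : is_diff z f (mulmxr J) -> 'J f z = J.
Proof.
move=> df; have e : 'd f z = mulmxr J :> ('C[R]_n -> 'C[R]_n) := diff_val.
by apply/row_matrixP => k; rewrite !rowE /jacobian mul_rV_lin1 e.
Qed.

Variables i j : 'I_n.
Hypothesis ij : i != j.

(** With a complex parameter the family contains both signs of [Theta], their inverses and the
    vector fields that generate them. *)
Definition shear (a : R[i]) z : 'C[R]_n := z + (a * z 0 j ^+ 2) *: evec i.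

Definition shear_jac (a : R[i]) z : 'M[R[i]]_n := 1%:M + (2 * a * z 0 j) *: delta_mx j i.

Lemma shear_j a z : shear a z 0 j = z 0 j.
Proof. by rewrite !mxE eq_sym (negbTE ij) andbF mulr0 addr0. Qed.

Lemma shear_i a z : shear a z 0 i = z 0 i + a * z 0 j ^+ 2.
Proof. by rewrite !mxE !eqxx mulr1. Qed.

Lemma shear_k a z k : k != i -> shear a z 0 k = z 0 k.
Proof. by move=> ki; rewrite !mxE (negbTE ki) andbF mulr0 addr0. Qed.

Lemma shearK a z : shear (- a) (shear a z) = z.
Proof. by rewrite {1}/shear shear_j /shear mulNr scaleNr addrK. Qed.

Lemma mul_shear_jac a z u : u *m shear_jac a z = u + (2 * a * z 0 j * u 0 j) *: evec i.
Proof.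
rewrite /shear_jac mulmxDr mulmx1 -scalemxAr -scalerA; congr (_ + _ *: _).
apply/rowP => k; rewrite [LHS]mxE (bigD1 j) //= big1; last first.
  by move=> l lj; rewrite mxE (negbTE lj) mulr0.
by rewrite addr0 !mxE !eqxx.
Qed.

Lemma is_diff_shear a z : is_diff z (shear a) (mulmxr (shear_jac a z)).
Proof.
apply: is_diff_mulmx => e e0; have a1 : 0 < cmod a + 1 by have := cmod_ge0 a; lra.
exists (e / (cmod a + 1)); first by rewrite divr_gt0.
move=> u; rewrite ltr_pdivlMr // => ue.
have -> : shear a (u + z) - shear a z - u *m shear_jac a z = (a * u 0 j ^+ 2) *: evec i.
  apply/rowP => k; rewrite mul_shear_jac !mxE.
  by case: (k == i); rewrite ?andbT ?andbF /= ?mulr0 ?mulr1; ring.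
rewrite enormZ enorm_evec mulr1 cmodM cmodX.
have uj := le_cmod_enorm u j; have u0 := cmod_ge0 (u 0 j).
have h1 : cmod (u 0 j) ^+ 2 <= enorm u ^+ 2 by rewrite ler_pXn2r ?nnegrE ?enorm_ge0.
have h2 : cmod a * cmod (u 0 j) ^+ 2 <= (cmod a + 1) * enorm u ^+ 2.
  by apply: ler_pM; rewrite ?cmod_ge0 ?sqr_ge0 // lerDl.
apply: le_trans h2 _; rewrite expr2 mulrA ler_wpM2r ?enorm_ge0 //.
by rewrite mulrC ltW.
Qed.

Lemma differentiable_shear a z : differentiable (shear a) z.
Proof. by have [] := is_diff_shear a z. Qed.

Lemma jacobian_shear a z : 'J (shear a) z = shear_jac a z.
Proof. exact: is_diff_jacobian (is_diff_shear a z). Qed.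

Lemma Hol_shear a : Hol (shear a).
Proof. by move=> z _; exact: differentiable_shear. Qed.

Lemma normalized_shear a : normalized (shear a).
Proof.
split; first by rewrite /shear mxE expr0n mulr0 scale0r addr0.
by rewrite jacobian_shear /shear_jac mxE mulr0 scale0r addr0.
Qed.

Lemma shear_jac_unit a z : shear_jac a z \in unitmx.
Proof.
have h : shear_jac a z *m shear_jac (- a) z = 1%:M.
  apply/row_matrixP => k; rewrite !rowE mulmxA mulmx1 !mul_shear_jac.
  set u := delta_mx 0 k.
  have -> : (u + (2 * a * z 0 j * u 0 j) *: evec i) 0 j = u 0 j.
    by rewrite mxE [X in _ + X]mxE [X in _ * X]mxE eq_sym (negbTE ij) andbF mulr0 addr0.
  by rewrite -addrA -scalerDl mulrN !mulNr subrr scale0r addr0.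
by have [h1 _] := mulmx1_unit h; exact: h1.
Qed.

(** The Jacobian adds [2 * a * z_j ^ 2] to the component [i], which turns the coefficient [- a] into
    [a]. *)
Lemma shear_field a : (fun z => shear a z *m invmx ('J (shear a) z)) = shear (- a).
Proof.
apply/funext => z; rewrite jacobian_shear.
have <- : shear (- a) z *m shear_jac a z = shear a z.
  rewrite mul_shear_jac shear_j /shear -addrA -scalerDl; congr (_ + _ *: _); ring.
by rewrite -mulmxA mulmxV ?mulmx1 // shear_jac_unit.
Qed.

Lemma open_eball : open (eball : set 'C[R]_n).
Proof.
rewrite openE => z; rewrite /eball /= => z1; apply/nbhs_enormP.
exists (1 - enorm z); first by lra.
move=> w wz; have -> : w = (w - z) + z by rewrite subrK.
by apply: le_lt_trans (enormD _ _) _; lra.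
Qed.

(** The whole ball serves as neighbourhood: its image is the preimage of the ball under the global
    inverse [shear (- a)], hence open. *)
Lemma locally_biholomorphic_shear a : locally_biholomorphic (shear a).
Proof.
move=> z bz; exists eball, (shear (- a)); split; first by split=> //; exact: open_eball.
split=> [w _| | w _|w _]; [exact: differentiable_shear| |exact: shearK|exact: differentiable_shear].
have -> : shear a @` eball = shear (- a) @^-1` eball.
  apply/seteqP; split=> [_ [w bw <-]|w bw] /=; first by rewrite shearK.
  by exists (shear (- a) w) => //; rewrite -{1}(opprK a) shearK.
apply: open_comp; last exact: open_eball.
by move=> w _; apply: differentiable_continuous; exact: differentiable_shear.
Qed.

(** The inequality of means for [A / 2], [A / 2], [x ^ 2], squared; the defect factors with
    [(x ^ 2 - A / 2) ^ 2]. *)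
Lemma cube_amgm (A x N : R) : 0 <= A -> 0 <= x -> 0 <= N -> A + x ^+ 2 <= N ^+ 2 ->
  3 * Num.sqrt 3 / 2 * (A * x) <= N ^+ 3.
Proof.
move=> A0 x0 N0 h; have s0 : 0 <= Num.sqrt 3 :> R by exact: sqrtr_ge0.
rewrite -(ler_pXn2r (n := 2)) ?nnegrE ?exprn_ge0 ?mulr_ge0 ?invr_ge0 //.
have -> : (3 * Num.sqrt 3 / 2 * (A * x)) ^+ 2 = 27 / 4 * A ^+ 2 * x ^+ 2.
  by rewrite !exprMn sqr_sqrtr //; field.
have -> : (N ^+ 3) ^+ 2 = (N ^+ 2) ^+ 3 by rewrite -!exprM.
have h3 : (A + x ^+ 2) ^+ 3 <= (N ^+ 2) ^+ 3.
  by rewrite lerXn2r ?nnegrE ?addr_ge0 ?sqr_ge0.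
apply: le_trans h3; rewrite -subr_ge0.
have -> : (A + x ^+ 2) ^+ 3 - 27 / 4 * A ^+ 2 * x ^+ 2 =
  (x ^+ 2 + 4 * A) * (x ^+ 2 - A / 2) ^+ 2 by field.
by rewrite mulr_ge0 ?addr_ge0 ?sqr_ge0 ?mulr_ge0.
Qed.

Lemma sqr_enorm_ij z : cmod (z 0 j) ^+ 2 + cmod (z 0 i) ^+ 2 <= enorm z ^+ 2.
Proof.
rewrite sqr_enorm (bigD1 j) //= (bigD1 i) //= addrA lerDl.
by apply: sumr_ge0 => k _; exact: sqr_ge0.
Qed.

Lemma sharp_bound_sin (alpha : R) : 0 < alpha <= 1 ->
  0 < sin (alpha * pi / 2) /\ sin (alpha * pi / 2) <= 1.
Proof.
move=> /andP[a0 a1]; have p0 := pi_gt0 R; split; last exact: sin_le1.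
apply: sin_gt0_pi; apply/andP; split; first by rewrite !mulr_gt0.
rewrite -mulrA; apply: (@le_lt_trans _ _ (1 * (pi / 2))); last by lra.
by rewrite ler_wpM2r //; lra.
Qed.

Lemma Mcal_g_shear (alpha : R) a : 0 < alpha <= 1 -> cmod a = sharp_bound alpha ->
  Mcal_g (sector_map alpha) (shear a).
Proof.
move=> ha ca; split; [exact: Hol_shear|exact: normalized_shear|].
move=> z l bz z0 /(Tset_unique z0) ->; apply: disc_in_sector => //.
have [s0 s1] := sharp_bound_sin ha.
have zp : 0 < enorm z by rewrite enorm_gt0.
have z2 : 0 < enorm z ^+ 2 by rewrite exprn_gt0.
have e : (enorm z)^-1%:C * herm_unit z (shear a z) - 1 =
    (enorm z ^+ 2)^-1%:C * (a * z 0 j ^+ 2 * (z 0 i)^*%C).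
  rewrite /herm_unit /shear hermDl herm_id hermZl.
  have -> : herm (evec i) z = (z 0 i)^*%C.
    rewrite /herm (bigD1 i) //= big1 ?addr0; first by rewrite mxE !eqxx mul1r.
    by move=> k ki; rewrite mxE (negbTE ki) andbF mul0r.
  rewrite mulrA -rmorphM -invfM -expr2 mulrDr -rmorphM mulVf ?gt_eqF //.
  by rewrite rmorph1; ring.
rewrite e cmodM cmod_nneg ?invr_ge0 ?(ltW z2) // (cmodM (a * _)) (cmodM a) cmodX cmod_conj ca.
rewrite mulrC ltr_pdivrMr // /sharp_bound.
have := cube_amgm (sqr_ge0 (cmod (z 0 j))) (cmod_ge0 (z 0 i)) (enorm_ge0 z) (sqr_enorm_ij z).
set A := _ * (_ * _) => hA.
have -> : 3 * Num.sqrt 3 / 2 * sin (alpha * pi / 2) * cmod (z 0 j) ^+ 2 * cmod (z 0 i) =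
  sin (alpha * pi / 2) * A by rewrite /A; ring.
(* Strictness comes from [|z| ^ 3 < |z| ^ 2] inside the ball. *)
rewrite ltr_pM2l //; apply: le_lt_trans hA _.
by rewrite exprS -[ltRHS]mul1r ltr_pM2r.
Qed.

Lemma S_star_shear (alpha : R) a : 0 < alpha <= 1 -> cmod a = sharp_bound alpha ->
  SS_star alpha (shear a).
Proof.
move=> ha ca; split; [exact: Hol_shear|exact: normalized_shear
  |exact: locally_biholomorphic_shear|].
by rewrite shear_field; apply: Mcal_g_shear => //; rewrite cmodN.
Qed.

Lemma coef2_shear a : coef2 (shear a) i j = a.
Proof.
have e : (fun v : R[i] => shear a (v *: evec j) 0 i) = (fun v => a * v ^+ 2).
  apply/funext => v; rewrite shear_i !mxE !eqxx (negbTE ij) andbF !mulr0 add0r.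
  by rewrite mulr1.
rewrite /coef2 e.
have -> : der (fun v => a * v ^+ 2) = (fun v => a * (2%:R * v ^+ 1)).
  by apply/funext => v; apply: derE; apply: cderivZ; exact: cderivX.
have -> : der (fun v => a * (2%:R * v ^+ 1)) 0 = a * (2%:R * 1).
  by apply: derE; do 2!apply: cderivZ; exact: cderiv_id.
by field.
Qed.

Lemma bounded_shear a z : eball z -> enorm (shear a z) <= 1 + cmod a.
Proof.
rewrite /eball /= => z1; apply: le_trans (enormD _ _) _.
rewrite enormZ enorm_evec mulr1 cmodM cmodX; apply: lerD; first exact: ltW.
rewrite ler_piMr ?cmod_ge0 // exprn_ile1 ?cmod_ge0 //.
by apply: le_trans (le_cmod_enorm _ _) (ltW z1).
Qed.

End Shear.

(** * The explicit flow of a shear *)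

Section ShearFlow.
Context {R : realType} {n : nat}.
Implicit Types (z w : 'C[R]_n) (a : R[i]) (s t y : R).

(** Here [s] stands for [expR (- t)] and [y] for [sqrt 3 * |z_i|]; the left side bounds the square
    norm of the flow for the critical coefficient. *)
Lemma shear_flow_poly s y : 0 <= s -> s <= 1 -> 0 <= y -> y ^+ 2 <= 3 ->
  s ^+ 2 * (1 + (1 - s) * (y * (3 - y ^+ 2)) +
    (1 - s) ^+ 2 * (3 / 4 * (3 - y ^+ 2) ^+ 2)) <= 1.
Proof.
move=> s0 s1 y0 y3; pose u := 1 - s; have u0 : 0 <= u by rewrite /u; lra.
have s2 : 0 <= s ^+ 2 by exact: sqr_ge0.
have u2 : 0 <= u ^+ 2 by exact: sqr_ge0.
have su : 0 <= s * u by exact: mulr_ge0.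
(* The difference of the two sides vanishes at [s = 1]; [H0] concerns its quotient by [1 - s]. *)
suff H0 : 0 <= 1 + s - s ^+ 2 * (y * (3 - y ^+ 2)) -
    s ^+ 2 * u * (3 / 4 * (3 - y ^+ 2) ^+ 2).
  rewrite -subr_ge0; have := mulr_ge0 u0 H0; congr (0 <= _); rewrite /u; ring.
have s21 : s ^+ 2 <= 1 by rewrite exprn_ile1.
(* For [y >= 1] both [y * (3 - y ^ 2)] and [3 - y ^ 2] are at most 2, their values at [y = 1], and
   [u ^ 2 * (1 + 3 * s)] remains. *)
have [y1|y1] := leP 1 y.
  have h1 : y * (3 - y ^+ 2) <= 2.
    have -> : y * (3 - y ^+ 2) = 2 - (y - 1) ^+ 2 * (y + 2) by ring.
    by rewrite lerBlDr lerDl mulr_ge0 ?sqr_ge0 //; lra.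
  have yy : 1 <= y ^+ 2 by rewrite expr_ge1 //; lra.
  have h2 : (3 - y ^+ 2) ^+ 2 <= 2 ^+ 2.
    by rewrite ler_pXn2r // ?nnegrE; lra.
  have t1 : s ^+ 2 * (y * (3 - y ^+ 2)) <= s ^+ 2 * 2 by rewrite ler_wpM2l.
  have t2 : s ^+ 2 * u * (3 / 4 * (3 - y ^+ 2) ^+ 2) <= s ^+ 2 * u * 3.
    by rewrite ler_wpM2l ?mulr_ge0 //; lra.
  have h3 : 0 <= u ^+ 2 * (1 + 3 * s) by rewrite mulr_ge0 //; lra.
  have e : 1 + s - s ^+ 2 * 2 - s ^+ 2 * u * 3 = u ^+ 2 * (1 + 3 * s) by rewrite /u; ring.
  lra.
(* Expansion around the critical value [y = 1]: after rewriting, only [3 * (p - u) ^ 2 - p ^ 3] can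
   be negative. *)
pose p := 1 - y; have p0 : 0 <= p by rewrite /p; lra.
have p1 : p <= 1 by rewrite /p; lra.
have -> : 1 + s - s ^+ 2 * (y * (3 - y ^+ 2)) - s ^+ 2 * u * (3 / 4 * (3 - y ^+ 2) ^+ 2) =
  s ^+ 2 * (3 * (p - u) ^+ 2 - p ^+ 3) + u ^+ 2 * (1 + 3 * (s * u)) +
  s ^+ 2 * p ^+ 2 * u * (3 / 4 * (p * (4 - p))) by rewrite /p /u; field.
have h1 : 0 <= s ^+ 2 * p ^+ 2 * u * (3 / 4 * (p * (4 - p))).
  apply: mulr_ge0; first by rewrite !mulr_ge0 ?sqr_ge0.
  by apply: mulr_ge0; [lra|apply: mulr_ge0; lra].
rewrite addr_ge0 //.
(* Completing a square bounds the bracket below by [- u ^ 2] for [p <= 3 / 4], and by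
   [- 3 / 2 * u ^ 2] otherwise, which is enough for [s <= 9 / 10]. In the remaining case [u] is
   small against [p] and the bracket is nonnegative. *)
have [p34|p34] := leP p (3 / 4).
  have q1 : p ^+ 3 <= 3 / 4 * p ^+ 2 by rewrite exprS ler_wpM2r ?sqr_ge0.
  have q2 : - u ^+ 2 <= 3 * (p - u) ^+ 2 - p ^+ 3.
    have := sqr_ge0 (3 / 2 * p - 2 * u).
    have -> : (3 / 2 * p - 2 * u) ^+ 2 = 3 * (p - u) ^+ 2 - 3 / 4 * p ^+ 2 + u ^+ 2 by field.
    lra.
  have q3 : s ^+ 2 * - u ^+ 2 <= s ^+ 2 * (3 * (p - u) ^+ 2 - p ^+ 3) by rewrite ler_wpM2l.
  have q4 : 0 <= u ^+ 2 * (1 + 3 * (s * u) - s ^+ 2) by rewrite mulr_ge0 //; lra.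
  have -> : u ^+ 2 * (1 + 3 * (s * u)) = u ^+ 2 * (1 + 3 * (s * u) - s ^+ 2) - s ^+ 2 * - u ^+ 2.
    by ring.
  lra.
have q1 : p ^+ 3 <= 1 * p ^+ 2 by rewrite exprS ler_wpM2r ?sqr_ge0.
have [s9|s9] := leP s (9 / 10).
  have q2 : - (3 / 2 * u ^+ 2) <= 3 * (p - u) ^+ 2 - p ^+ 3.
    have := sqr_ge0 (p - 3 / 2 * u).
    have -> : (p - 3 / 2 * u) ^+ 2 =
      (3 * (p - u) ^+ 2 - p ^+ 2 + 3 / 2 * u ^+ 2) / 2 by field.
    lra.
  have q3 : s ^+ 2 * - (3 / 2 * u ^+ 2) <= s ^+ 2 * (3 * (p - u) ^+ 2 - p ^+ 3).
    by rewrite ler_wpM2l.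
  have q5 : s ^+ 2 <= 9 / 10 * s by rewrite expr2 ler_wpM2r.
  have q4 : 0 <= u ^+ 2 * (1 + 3 * (s * u) - 3 / 2 * s ^+ 2).
    rewrite mulr_ge0 //; have -> : s * u = s - s ^+ 2 by rewrite /u; ring.
    lra.
  have -> : u ^+ 2 * (1 + 3 * (s * u)) =
    u ^+ 2 * (1 + 3 * (s * u) - 3 / 2 * s ^+ 2) - s ^+ 2 * - (3 / 2 * u ^+ 2) by field.
  lra.
have q2 : 0 <= 3 * (p - u) ^+ 2 - p ^+ 3.
  have q3 : 0 <= p * (2 * p - 6 * u) by apply: mulr_ge0 => //; rewrite /u; lra.
  have -> : 3 * (p - u) ^+ 2 - p ^+ 3 = p * (2 * p - 6 * u) + (1 * p ^+ 2 - p ^+ 3) + 3 * u ^+ 2.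
    by ring.
  lra.
have q3 : 0 <= s ^+ 2 * (3 * (p - u) ^+ 2 - p ^+ 3) by exact: mulr_ge0.
have q4 : 0 <= u ^+ 2 * (1 + 3 * (s * u)) by rewrite mulr_ge0 //; lra.
lra.
Qed.

Variables i j : 'I_n.
Hypothesis ij : i != j.

(** All components but [i] decay like [expR (- t)]; then [v_i' = - v_i + a v_j ^ 2] is linear with a
    known source, and its solution gives the difference of exponentials. *)
Definition shear_flow a z t : 'C[R]_n := (expR (- t))%:C *: z +
  (a * (expR (- t) - expR (- (2 * t)))%:C * z 0 j ^+ 2) *: evec i.

Lemma shear_flow_j a z t : shear_flow a z t 0 j = (expR (- t))%:C * z 0 j.
Proof. by rewrite !mxE eq_sym (negbTE ij) andbF mulr0 addr0. Qed.

(** The norm is estimated by the moduli of [a], [z_i], [z_j]; replacing [|z_j| ^ 2] by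
    [1 - |z_i| ^ 2] leads to [shear_flow_poly]. Strictness comes from the term [s ^ 2 * |z| ^ 2]. *)
Lemma shear_flow_ball a z t : cmod a <= 3 * Num.sqrt 3 / 2 -> 0 <= t -> eball z ->
  eball (shear_flow a z t).
Proof.
move=> ak t0 z1; rewrite /eball /=.
pose s := expR (- t); have s0 : 0 < s by exact: expR_gt0.
have s1 : s <= 1 by rewrite -expR0 ler_expR; lra.
have es : expR (- (2 * t)) = s ^+ 2 by rewrite -expRM_natl; congr expR; ring.
have s30 : 0 <= Num.sqrt 3 :> R by exact: sqrtr_ge0.
have s3 : Num.sqrt 3 ^+ 2 = 3 :> R by rewrite sqr_sqrtr.
pose A := cmod (z 0 j) ^+ 2; pose x := cmod (z 0 i); pose N := enorm z.
have A0 : 0 <= A by exact: sqr_ge0.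
have x0 : 0 <= x by exact: cmod_ge0.
have N0 : 0 <= N by exact: enorm_ge0.
have N1 : N < 1 by [].
have AN : A + x ^+ 2 <= N ^+ 2 by exact: sqr_enorm_ij.
have N2 : N ^+ 2 < 1 by rewrite exprn_ilt1.
pose y := Num.sqrt 3 * x.
have y2 : y ^+ 2 = 3 * x ^+ 2 by rewrite exprMn s3.
have y3 : y ^+ 2 <= 3 by rewrite y2; lra.
have y0 : 0 <= y by exact: mulr_ge0.
have c0 := cmod_ge0 a.
have B1 : cmod a * A <= Num.sqrt 3 / 2 * (3 - y ^+ 2).
  have -> : Num.sqrt 3 / 2 * (3 - y ^+ 2) = 3 * Num.sqrt 3 / 2 * (1 - x ^+ 2).
    by rewrite y2; field.
  by apply: ler_pM => //; lra.
have B0 : 0 <= cmod a * A by exact: mulr_ge0.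
have b1 : 2 * x * (cmod a * A) <= y * (3 - y ^+ 2).
  have -> : y * (3 - y ^+ 2) = 2 * x * (Num.sqrt 3 / 2 * (3 - y ^+ 2)) by rewrite /y; field.
  by rewrite ler_wpM2l // mulr_ge0.
have b2 : (cmod a * A) ^+ 2 <= 3 / 4 * (3 - y ^+ 2) ^+ 2.
  have -> : 3 / 4 * (3 - y ^+ 2) ^+ 2 = (Num.sqrt 3 / 2 * (3 - y ^+ 2)) ^+ 2.
    by rewrite -{1}s3; field.
  by rewrite ler_pXn2r // nnegrE; apply: le_trans B1.
have u0 : 0 <= 1 - s by lra.
rewrite -(ltr_pXn2r (n := 2)) ?nnegrE ?enorm_ge0 // expr1n.
rewrite /shear_flow es -/s sqr_enormD !enormZ enorm_evec mulr1 hermZl hermZr.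
have -> : herm z (evec i) = z 0 i.
  rewrite /herm (bigD1 i) //= big1 ?addr0; first by rewrite mxE !eqxx conjc1 mulr1.
  by move=> k ki; rewrite mxE (negbTE ki) andbF conjc0 mulr0.
set b := a * (s - s ^+ 2)%:C * z 0 j ^+ 2.
have cb : cmod b = s * (1 - s) * (cmod a * A).
  rewrite /b (cmodM (a * _)) (cmodM a) cmodX cmod_nneg.
    by rewrite /A; ring.
  have -> : s - s ^+ 2 = s * (1 - s) by ring.
  by rewrite mulr_ge0 // ltW.
rewrite cReMr cmod_nneg ?(ltW s0) //.
have r1 : complex.Re (b^*%C * z 0 i) <= cmod b * x.
  by apply: le_trans (Re_le_cmod _) _; rewrite cmodM cmod_conj.
have po := shear_flow_poly (ltW s0) s1 y0 y3.
have t1 : 2 * (s * complex.Re (b^*%C * z 0 i)) <= s ^+ 2 * (1 - s) * (y * (3 - y ^+ 2)).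
  have k1 : s * complex.Re (b^*%C * z 0 i) <= s * (cmod b * x) by rewrite ler_pM2l.
  have k2 : s ^+ 2 * (1 - s) * (2 * x * (cmod a * A)) <= s ^+ 2 * (1 - s) * (y * (3 - y ^+ 2)).
    by rewrite ler_wpM2l // mulr_ge0 // sqr_ge0.
  have e : 2 * (s * (cmod b * x)) = s ^+ 2 * (1 - s) * (2 * x * (cmod a * A)) by rewrite cb; ring.
  lra.
have t2 : cmod b ^+ 2 <= s ^+ 2 * (1 - s) ^+ 2 * (3 / 4 * (3 - y ^+ 2) ^+ 2).
  have -> : cmod b ^+ 2 = s ^+ 2 * (1 - s) ^+ 2 * (cmod a * A) ^+ 2 by rewrite cb; ring.
  by rewrite ler_wpM2l // mulr_ge0 ?sqr_ge0.
have t3 : s ^+ 2 * N ^+ 2 < s ^+ 2 * 1 by rewrite ltr_pM2l ?exprn_gt0.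
rewrite exprMn -/N.
have e : s ^+ 2 * (1 + (1 - s) * (y * (3 - y ^+ 2)) + (1 - s) ^+ 2 * (3 / 4 * (3 - y ^+ 2) ^+ 2)) =
  s ^+ 2 * 1 + s ^+ 2 * (1 - s) * (y * (3 - y ^+ 2)) +
  s ^+ 2 * (1 - s) ^+ 2 * (3 / 4 * (3 - y ^+ 2) ^+ 2) by ring.
rewrite e in po; move: po t1 t2 t3.
move: (s ^+ 2 * (1 - s) * _) (s ^+ 2 * (1 - s) ^+ 2 * _) (s ^+ 2 * 1) (s ^+ 2 * N ^+ 2) => X Y Z W.
lra.
Qed.

Lemma expR_lipschitz (k s t : R) : 0 <= k -> 0 <= s -> 0 <= t ->
  `|expR (- (k * s)) - expR (- (k * t))| <= k * `|s - t|.
Proof.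
move=> k0; wlog st : s t / s <= t => [hw s0 t0|s0 t0].
  have [/hw|/ltW ts] := leP s t; first exact.
  by rewrite distrC [`|s - t|]distrC; exact: hw.
have ks : 0 <= k * s by exact: mulr_ge0.
have kst : k * s <= k * t by rewrite ler_wpM2l.
rewrite ger0_norm; last by rewrite subr_ge0 ler_expR lerN2.
rewrite ler0_norm ?subr_le0 // opprB.
have e : expR (- (k * t)) = expR (- (k * s)) * expR (- (k * (t - s))).
  by rewrite -expRD; congr expR; ring.
have h := expR_ge1Dx (- (k * (t - s))).
have E0 := expR_gt0 (- (k * s)).
have E1 : expR (- (k * s)) <= 1 by rewrite -expR0 ler_expR; lra.
have kts : 0 <= k * (t - s) by rewrite mulr_ge0 // subr_ge0.
have h1 : expR (- (k * s)) * (1 - k * (t - s)) <= expR (- (k * t)).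
  by rewrite e ler_pM2l.
have h2 : expR (- (k * s)) * (k * (t - s)) <= 1 * (k * (t - s)) by rewrite ler_wpM2r.
rewrite mulrBr mulr1 in h1; lra.
Qed.

Lemma shear_flow_lipschitz a z : locally_lipschitz (shear_flow a z).
Proof.
move=> t0 _; pose c := cmod (a * z 0 j ^+ 2); exists (enorm z + c * 3).
exists (setT, setT); first by split; exact: filterT.
move=> [s t] _ /= s0 t0'.
have -> : shear_flow a z s - shear_flow a z t =
    (expR (- (1 * s)) - expR (- (1 * t)))%:C *: z +
    ((a * z 0 j ^+ 2) * ((expR (- (1 * s)) - expR (- (1 * t)))%:C -
       (expR (- (2 * s)) - expR (- (2 * t)))%:C)) *: evec i.
  by apply/rowP => k; rewrite !mxE !mul1r !rmorphB /=; ring.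
have h1 := expR_lipschitz ler01 s0 t0'.
have h2 := expR_lipschitz (ler0n R 2) s0 t0'.
apply: le_trans (enormD _ _) _; rewrite !enormZ enorm_evec mulr1.
have -> : (enorm z + c * 3) * `|s - t| = enorm z * `|s - t| + c * (3 * `|s - t|) by ring.
apply: lerD.
  by rewrite cmod_real mulrC ler_wpM2l ?enorm_ge0 //; lra.
rewrite cmodM ler_wpM2l ?cmod_ge0 //.
by apply: le_trans (cmodB _ _) _; rewrite !cmod_real; lra.
Qed.

Lemma shear_flow_rderiv a z t :
  has_rderiv (shear_flow a z) t (- shear i j (- a) (shear_flow a z t)).
Proof.
set w := - shear i j (- a) _; rewrite /has_rderiv => A /nbhs_enormP[e e0 hA].
pose c := cmod (a * z 0 j ^+ 2); pose K := enorm z + c * 2 + 1.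
have c0 : 0 <= c by exact: cmod_ge0.
have K0 : 0 < K by rewrite /K; have := enorm_ge0 z; lra.
have eK : 0 < e / K / 2 by rewrite !divr_gt0.
have [r1 r10 h1] := rderiv_expR (-1) t eK.
have [r2 r20 h2] := rderiv_expR (-2) t eK.
exists (Num.min r1 r2); first by rewrite /= lt_min r10.
move=> s /=; rewrite distrC lt_min => /andP[/h1 {}h1 /h2 {}h2] st; apply: hA.
(* [D1] and [D2] are the first order errors of the two exponentials; the error of the flow is linear
   in them. *)
pose D1 := expR (-1 * s) - expR (-1 * t) - -1 * expR (-1 * t) * (s - t).
pose D2 := expR (-2 * s) - expR (-2 * t) - -2 * expR (-2 * t) * (s - t).
have s0 : s - t != 0 by rewrite subr_eq0.
have sp : 0 < `|s - t| by rewrite normr_gt0.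
have eX (k x : R) : - (k * x) = - k * x by rewrite mulNr.
have ew : w = (- expR (-1 * t))%:C *: z +
    (a * z 0 j ^+ 2 * (- expR (-1 * t) + 2 * expR (-2 * t))%:C) *: evec i.
  have e2 : expR (-2 * t) = expR (-1 * t) ^+ 2 by rewrite -expRM_natl; congr expR; ring.
  have f1 : - t = -1 * t by ring.
  have f2 : - (2 * t) = -2 * t by ring.
  rewrite /w /shear shear_flow_j /shear_flow f1 f2 e2.
  by apply/rowP => k; rewrite !mxE; ring.
have -> : (s - t)^-1%:C *: (shear_flow a z s - shear_flow a z t) - w =
   (s - t)^-1%:C *: (D1%:C *: z + (a * z 0 j ^+ 2 * (D1 - D2)%:C) *: evec i).
  have -> : w = (s - t)^-1%:C *: ((s - t)%:C *: w).
    by rewrite scalerA -rmorphM mulVf // scale1r.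
  rewrite -scalerBr; congr (_ *: _); rewrite ew.
  have f1 x : - x = -1 * x :> R by ring.
  have f2 x : - (2 * x) = -2 * x :> R by ring.
  rewrite /shear_flow (f1 s) (f1 t) (f2 s) (f2 t) /D1 /D2.
  by apply/rowP => k; rewrite !mxE; ring.
rewrite enormZ cmod_real normfV mulrC ltr_pdivrMr //.
apply: le_lt_trans (enormD _ _) _; rewrite !enormZ enorm_evec mulr1 cmodM -/c !cmod_real.
have n12 : `|D1 - D2| <= `|D1| + `|D2| by exact: ler_normB.
have k1 : `|D1| * enorm z <= e / K / 2 * `|s - t| * enorm z.
  by rewrite ler_wpM2r ?enorm_ge0.
have k2 : c * `|D1 - D2| <= c * (e / K / 2 * `|s - t| + e / K / 2 * `|s - t|).
  by rewrite ler_wpM2l //; apply: le_trans n12 _; exact: lerD.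
have k3 : e / K / 2 * `|s - t| * (enorm z + c * 2) < e * `|s - t|.
  have -> : e * `|s - t| = e / K / 2 * `|s - t| * (2 * K) by field; rewrite gt_eqF.
  have P0 : 0 < e / K / 2 * `|s - t| by exact: mulr_gt0.
  by rewrite ltr_pM2l // /K; have := enorm_ge0 z; lra.
rewrite !mulrDr in k2 k3; lra.
Qed.

End ShearFlow.

(** * Membership of the shears in [SS_zero] *)

Section ShearParametric.
Context {R : realType} {n : nat}.
Implicit Types (z w : 'C[R]_n) (a : R[i]) (s t : R) (u v : R -> 'C[R]_n).

Local Notation mu := (@lebesgue_measure R).

Lemma has_rderivB u v t w w' : has_rderiv u t w -> has_rderiv v t w' ->
  has_rderiv (fun s => u s - v s) t (w - w').
Proof.
move=> du dv; rewrite /has_rderiv.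
have -> : (fun s => (s - t)^-1%:C *: (u s - v s - (u t - v t))) =
  (fun s => (s - t)^-1%:C *: (u s - u t) - (s - t)^-1%:C *: (v s - v t)).
  by apply/funext => s; apply/rowP => k; rewrite !mxE; ring.
exact: (@cvgB R[i] _ _ _ _ _ _ _ _ du dv).
Qed.

Lemma locally_lipschitzB u v : locally_lipschitz u -> locally_lipschitz v ->
  locally_lipschitz (fun s => u s - v s).
Proof.
move=> lu lv t0 t00; have [L hL] := lu t0 t00; have [L' hL'] := lv t0 t00.
exists (L + L'); apply: filterS2 hL hL' => -[s t] /= h h' s0 t0'.
have -> : u s - v s - (u t - v t) = (u s - u t) - (v s - v t).
  by apply/rowP => k; rewrite !mxE; ring.
apply: le_trans (enormB _ _) _; rewrite mulrDl; apply: lerD; [exact: h|exact: h'].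
Qed.

Lemma lebesgue_measurable_cst (c : R) : lebesgue_measurable_fun `[0, +oo[ (fun=> c).
Proof.
move=> B mB; have [Bc|nBc] := pselect (B c).
  rewrite (_ : _ `&` _ = [set` `[0, +oo[]); last by apply/setIidl.
  by apply: sub_caratheodory; exact: measurable_itv.
rewrite (_ : _ `&` _ = classical_sets.set0); first exact: measurable0.
by apply/seteqP; split=> x //= [].
Qed.

Lemma submxE z w k : (z - w) 0 k = z 0 k - w 0 k.
Proof. by rewrite !mxE. Qed.

(** Uniqueness for [u' = - u] from zero initial value: [ae_decay_bound] with [M = 0]. *)
Lemma ae_decay_zero u d k : locally_lipschitz u ->
  {ae mu, forall s, 0 <= s -> has_rderiv u s (d s)} -> u 0 0 k = 0 ->
  (forall s, 0 <= s -> u s 0 k + d s 0 k = 0) -> forall s, 0 <= s -> u s 0 k = 0.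
Proof.
move=> lu du u0 hk s s0.
have := @ae_decay_bound R n u d k 0 1 s s0 (lexx _) ltr01 lu _.
rewrite u0 subr0 mul0r => h.
have : cmod ((expR s)%:C * u s 0 k) <= 0.
  apply: h; have [N [mN N0 hN]] := du; exists N; split; [exact: mN|exact: N0|move=> r nr].
  apply: hN => /= hr; apply: nr => r0; split; first exact: hr.
  by rewrite hk // mulr0 cmod0 mul0r.
rewrite cmodM cmod_nneg ?expR_ge0 // pmulr_rle0 ?expR_gt0 // => h0.
by apply/eqP; rewrite -cmod_eq0 eq_le h0 cmod_ge0.
Qed.

Variables i j : 'I_n.
Hypothesis ij : i != j.

Lemma shear_flow_solution a z : cmod a <= 3 * Num.sqrt 3 / 2 -> eball z ->
  loewner_solution (fun w _ => shear i j (- a) w) z (shear_flow i j a z).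
Proof.
move=> ak bz; split.
- exact: shear_flow_lipschitz.
- by move=> t t0; apply: shear_flow_ball.
- exists classical_sets.set0; split; [exact: measurable0|exact: measure0|].
  by move=> t nt; apply: nt => _; exact: shear_flow_rderiv.
- by rewrite /shear_flow mulr0 oppr0 expR0 subrr mulr0 mul0r scale0r addr0 scale1r.
Qed.

(** The system is triangular: differences of components other than [i] satisfy [y' = - y] and
    vanish; the quadratic terms in [z_j] then coincide, so the component [i] satisfies the same
    equation. *)
Lemma shear_flow_unique a z u t : cmod a <= 3 * Num.sqrt 3 / 2 -> eball z ->
  loewner_solution (fun w _ => shear i j (- a) w) z u -> 0 <= t ->
  u t = shear_flow i j a z t.
Proof.
move=> ak bz [lu bu du u0] t0.
have [lv bv dv v0] := shear_flow_solution ak bz.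
pose y s := u s - shear_flow i j a z s.
pose d s := - shear i j (- a) (u s) - - shear i j (- a) (shear_flow i j a z s).
have ly : locally_lipschitz y by exact: locally_lipschitzB.
have dy : {ae mu, forall s, 0 <= s -> has_rderiv y s (d s)}.
  have [N [mN N0 hN]] := du; exists N; split; [exact: mN|exact: N0|move=> s ns].
  apply: hN => /= hs; apply: ns => s0.
  exact: (has_rderivB (hs s0) (@shear_flow_rderiv R n i j ij a z s)).
have y0 k : y 0 0 k = 0 by rewrite /y u0 v0 subrr mxE.
have yE s k : y s 0 k = u s 0 k - shear_flow i j a z s 0 k by exact: submxE.
have dE s k : d s 0 k = shear i j (- a) (shear_flow i j a z s) 0 k - shear i j (- a) (u s) 0 k.
  by rewrite /d opprK addrC; exact: submxE.
clearbody y d.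
have yk s k : k != i -> 0 <= s -> y s 0 k = 0.
  move=> ki; apply: (ae_decay_zero ly dy) => // r r0.
  by rewrite dE yE !shear_k //; ring.
have uj s : 0 <= s -> u s 0 j = shear_flow i j a z s 0 j.
  move=> s0; have := yk s j; rewrite eq_sym => /(_ ij s0).
  by rewrite yE => /eqP; rewrite subr_eq0 => /eqP.
have yi s : 0 <= s -> y s 0 i = 0.
  apply: (ae_decay_zero ly dy) => // r r0.
  by rewrite dE yE !shear_i uj //; ring.
apply/rowP => k; apply/eqP; rewrite -subr_eq0 -yE; apply/eqP.
by have [->|ki] := eqVneq k i; [exact: yi|exact: yk].
Qed.

(** The error is exactly [a * expR (- t) * z_j ^ 2] in the direction [e_i], uniformly small on the
    whole ball. *)
Lemma shear_flow_cvg a :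
  {family compactly_in eball,
     (fun z => (expR t)%:C *: shear_flow i j a z t) @[t --> +oo] --> shear i j a}.
Proof.
apply/fam_cvgP => A [Ab _] P /uniform_nbhs[E [entE EP]].
move: entE; rewrite -entourage_ballE => -[e /= e0 he].
have er : e = (complex.Re e)%:C.
  by move: e0; rewrite ltcE => /andP[/eqP /= i0 _]; case: e i0 {he} => x y /= ->.
have r0 : 0 < complex.Re e by rewrite -ltcR -er.
exists (cmod a / complex.Re e); split; first exact: num_real.
move=> t ta; apply: EP => z Az; apply: he; rewrite /= -ball_normE /ball_ /=.
apply: le_lt_trans (norm_le_enorm _) _; rewrite er ltcR.
have -> : shear i j a z - (expR t)%:C *: shear_flow i j a z t =
    (a * (expR (- t))%:C * z 0 j ^+ 2) *: evec i.
  have e1 : (expR t)%:C * (expR (- t))%:C = 1 :> R[i] by rewrite -rmorphM /= expRxMexpNx_1.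
  have e2 : expR (- (2 * t)) = expR (- t) * expR (- t) by rewrite -expRD; congr expR; ring.
  rewrite /shear /shear_flow e2 scalerDr !scalerA e1 scale1r opprD addrACA subrr add0r.
  rewrite -scalerBl; congr (_ *: _).
  have -> : (expR t)%:C * (a * (expR (- t) - expR (- t) * expR (- t))%:C * z 0 j ^+ 2) =
    ((expR t)%:C * (expR (- t))%:C) * (a * (1 - (expR (- t))%:C) * z 0 j ^+ 2).
    by ring.
  by rewrite e1; ring.
have zj : cmod (z 0 j) <= 1 by apply: le_trans (le_cmod_enorm _ _) (ltW (Ab _ Az)).
rewrite enormZ enorm_evec mulr1 (cmodM (a * _)) (cmodM a) cmodX cmod_nneg ?expR_ge0 //.
have E0 := expR_gt0 (- t).
apply: (@le_lt_trans _ _ (cmod a * expR (- t))).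
  by rewrite ler_piMr ?mulr_ge0 ?cmod_ge0 ?(ltW E0) // exprn_ile1 ?cmod_ge0.
rewrite expRN ltr_pdivrMr ?expR_gt0 //.
move: ta; rewrite ltr_pdivrMr // => ta; apply: lt_le_trans ta _.
rewrite mulrC ler_pM2l //; have := expR_ge1Dx t; lra.
Qed.

Lemma sharp_bound_le (alpha : R) : 0 < alpha <= 1 ->
  0 < sharp_bound alpha /\ sharp_bound alpha <= 3 * Num.sqrt 3 / 2.
Proof.
move=> ha; have [s0 s1] := sharp_bound_sin ha.
have s3 : 0 < Num.sqrt 3 :> R by rewrite sqrtr_gt0.
rewrite /sharp_bound; split; first by rewrite !mulr_gt0 // invr_gt0.
by rewrite ler_piMr // !mulr_ge0 ?invr_ge0 // ltW.
Qed.

Lemma S_zero_shear (alpha : R) a : 0 < alpha <= 1 -> cmod a = sharp_bound alpha ->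
  SS_zero alpha (shear i j a).
Proof.
move=> ha ca; have [_ sb] := sharp_bound_le ha.
have ak : cmod a <= 3 * Num.sqrt 3 / 2 by rewrite ca.
have hg : Mcal_g (sector_map alpha) (shear i j (- a)).
  by apply: Mcal_g_shear => //; rewrite cmodN.
split; [exact: Hol_shear|exact: normalized_shear|].
exists (fun w _ => shear i j (- a) w), (shear_flow i j a); split.
- split; first by move=> t _; exact: Mcal_g_Mcal ha hg.
  by move=> z k _; split; exact: lebesgue_measurable_cst.
- exists classical_sets.set0; split; [exact: measurable0|exact: measure0|].
  by move=> t nt; apply: nt.
- move=> z bz; split; first exact: shear_flow_solution.
  by move=> u su t t0; exact: shear_flow_unique.
- exact: shear_flow_cvg.
Qed.

End ShearParametric.

(** * Support points *)

Section SecondDerivativeBound.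
Context {R : realType}.
Implicit Types (F G : R[i] -> R[i]) (a b w c : R[i]) (M rho : R).

Lemma hol_disc_lin F G a rho c : hol_disc F a rho -> hol_disc G a rho ->
  hol_disc (fun w => c * F w + G w) a rho.
Proof.
move=> hF hG w wr; exists (c * der F w + der G w).
by apply: cderivD; [apply: cderivZ; exact: derP (hF _ wr)|exact: derP (hG _ wr)].
Qed.

Lemma der_lin F G a c : cdiff F a -> cdiff G a ->
  der (fun w => c * F w + G w) a = c * der F a + der G a.
Proof. by move=> dF dG; apply: derE; apply: cderivD (derP dG); exact: cderivZ (derP dF). Qed.

Lemma der2_lin F G a rho c : 0 < rho -> hol_disc F a rho -> hol_disc G a rho ->
  der (der (fun w => c * F w + G w)) a = c * der (der F) a + der (der G) a.
Proof.
move=> rho0 hF hG; have aa : cmod (a - a) < rho by rewrite subrr cmod0.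
have e w : cmod (w - a) < rho -> der (fun w => c * F w + G w) w = c * der F w + der G w.
  by move=> wr; exact: der_lin (hF _ wr) (hG _ wr).
apply: derE; apply: cderiv_local (cderivD (cderivZ c (derP (hol_der hF aa))) (derP (hol_der hG aa))).
  by rewrite e.
by exists rho => // w wr; rewrite e.
Qed.

(** Only values on the circle of radius [1 / 2] enter, which gives the factor [4 = (1 / 2) ^ (-2)].
    [taylor2] identifies the limit required by [cavg_coef2]. *)
Lemma cauchy_bound2 F M : hol_disc F 0 1 ->
  (forall w, cmod w = 1 / 2 -> cmod (F w) <= M) -> cmod (der (der F) 0 / 2) <= 4 * M.
Proof.
move=> hF FM; have c0 : cmod (0 - 0 : R[i]) < 1 by rewrite subrr cmod0.
have [d d0 hd] := cderiv_cont (derP (hF _ c0)).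
pose rho := Num.min 1 d / 4.
have m0 : 0 < Num.min 1 d by rewrite lt_min ltr01.
have rho0 : 0 < rho by rewrite divr_gt0.
have r4 : 4 * rho = Num.min 1 d by rewrite /rho; field.
have h4 : hol_disc F 0 (4 * rho).
  by move=> w; rewrite r4 lt_min => /andP[/hF].
pose K := cmod (F 0) + (cmod (der F 0) + 1).
have FK w : cmod (w - 0) < 4 * rho -> cmod (F w) <= K.
  rewrite r4 lt_min => /andP[w1 /hd h].
  have -> : F w = F 0 + (F w - F 0) by ring.
  apply: le_trans (cmodD _ _) _; rewrite lerD2l; apply: le_trans h _.
  rewrite ler_piMr //; last exact: ltW.
  by have := cmod_ge0 (der F 0); lra.
have tay := taylor2 rho0 h4 FK.
set C := K / rho ^+ 3 in tay.
have C0 : 0 <= C.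
  rewrite /C /K divr_ge0 ?exprn_ge0 ?(ltW rho0) //.
  by have := cmod_ge0 (der F 0); have := cmod_ge0 (F 0); lra.
set m := der (der F) 0 / 2 in tay *.
have Fm : tends0 (fun w => (F w - F 0 - der F 0 * w) / w ^+ 2) m.
  move=> e e0; exists (Num.min rho (e / (C + 1))).
    by rewrite lt_min rho0 divr_gt0 //; lra.
  move=> w w0; rewrite lt_min => /andP[wr we].
  have wn : w != 0 by rewrite -cmod_gt0.
  have w2 : 0 < cmod w ^+ 2 by rewrite exprn_gt0.
  have := tay w; rewrite subr0 => /(_ wr) h.
  have -> : (F w - F 0 - der F 0 * w) / w ^+ 2 - m =
    (F w - F 0 - der F 0 * w - m * w ^+ 2) / w ^+ 2 by field.
  rewrite cmodM cmodV cmodX ler_pdivrMr //; apply: le_trans h _.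
  have -> : C * cmod w ^+ 3 = C * cmod w * cmod w ^+ 2 by ring.
  rewrite ler_pM2r //.
  have : (C + 1) * cmod w <= e by rewrite mulrC -ler_pdivlMr ?(ltW we) //; lra.
  by rewrite mulrDl; lra.
have dF w : cmod w < 1 -> cdiff F w by move=> w1; apply: hF; rewrite subr0.
have r0 : 0 < 1 / 2 :> R by lra.
have r1 : 1 / 2 < 1 :> R by lra.
have := cavg_coef2 dF Fm r0 r1 => e.
have : cmod (cavg (1 / 2) (fun w => F w * (w ^+ 2)^*%C)) <= M * (1 / 2) ^+ 2.
  apply: cmod_cavg_le; first exact: ltW.
    apply: ccircM; last by apply: ccirc_conj; exact: ccircX.
    by apply: diff_ccirc; [exact: ltW|move=> w wr; apply: dF; rewrite wr].
  move=> w wr; rewrite cmodM cmod_conj cmodX wr ler_wpM2r ?FM //.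
rewrite e cmodM cmod_nneg; last by rewrite exprn_ge0 // ltW.
by lra.
Qed.

End SecondDerivativeBound.

(** * The coefficient functional and its extremal maps *)

Section Functional.
Context {R : realType} {n : nat}.
Implicit Types (f g p q : 'C[R]_n -> 'C[R]_n) (a c : R[i]) (i j : 'I_n).

Lemma coef2_lin a p q i j : Hol p -> Hol q ->
  coef2 (fun z => a *: p z + q z) i j = a * coef2 p i j + coef2 q i j.
Proof.
move=> hp hq; rewrite /coef2.
have -> : (fun v => (a *: p (v *: evec j) + q (v *: evec j)) 0 i) =
    (fun v => a * p (v *: evec j) 0 i + q (v *: evec j) 0 i).
  by apply/funext => v; rewrite !mxE.
by rewrite (der2_lin a ltr01 (Hol_axis i j hp) (Hol_axis i j hq)) mulrDl mulrA.
Qed.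

(** Closeness on this single compact set controls [coef2]. The parameter interval contains all
    values of [carg], so every [w e_j] with [|w| = 1 / 2] is reached. *)
Definition axis_circle j : set 'C[R]_n :=
  (fun t => ((1 / 2)%:C * cis t) *: evec j) @` `[- pi, pi].

Lemma axis_circle_compact j : compactly_in eball (axis_circle j).
Proof.
split=> [_ [t _ <-]|].
  by rewrite /eball /= enormZ enorm_evec mulr1 cmod_circle //; lra.
apply: continuous_compact; last exact: segment_compact.
apply: continuous_subspaceT => t A /nbhs_enormP[d d0 hd].
have d2 : 0 < d / 2 by rewrite divr_gt0.
have [e e0 he] := ccontin_circle (1 / 2) t d2.
exists e => // s; rewrite /= distrC => /he h; apply: hd.
by rewrite -scalerBl enormZ enorm_evec mulr1; apply: le_lt_trans h _; lra.
Qed.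

Lemma mem_axis_circle j (w : R[i]) : cmod w = 1 / 2 -> axis_circle j (w *: evec j).
Proof.
move=> cw; exists (carg w); last by rewrite -cw -polar_form.
have p0 := pi_gt0 R.
have h := Re_div_cmod w.
have [h0 h1] : 0 <= acos (complex.Re w / cmod w) /\ acos (complex.Re w / cmod w) <= pi.
  by split; [exact: acos_ge0|exact: acos_lepi].
by rewrite /= in_itv /= /carg; case: ifP => _; apply/andP; split; lra.
Qed.

Lemma coef2_dist f g i j M : Hol f -> Hol g ->
  (forall z, axis_circle j z -> cmod (f z 0 i - g z 0 i) <= M) ->
  cmod (coef2 f i j - coef2 g i j) <= 4 * M.
Proof.
move=> hf hg fgM; have hd := hol_disc_lin (-1) (Hol_axis i j hg) (Hol_axis i j hf).
have := der2_lin (-1) ltr01 (Hol_axis i j hg) (Hol_axis i j hf).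
have := cauchy_bound2 (M := M) hd.
have -> : coef2 f i j - coef2 g i j =
  (-1 * der (der (fun v => g (v *: evec j) 0 i)) 0 +
   der (der (fun v => f (v *: evec j) 0 i)) 0) / 2 by rewrite /coef2; ring.
move=> h <-; apply: h => w /(mem_axis_circle j) /fgM.
by rewrite mulN1r addrC.
Qed.

Lemma coef2_continuous i j c :
  {within (Hol : set (ballmaps R n)), continuous (fun f : ballmaps R n => c * coef2 f i j)}.
Proof.
apply/subspace_continuousP => f hf; apply/cvgrPdist_lt => e e0.
have [r er] : exists r, e = r%:C.
  move: e0; rewrite ltcE => /andP[/eqP /= i0 _]; exists (complex.Re e).
  by case: e i0 => x y /= ->.
move: e0; rewrite {e}er ltcR => r0.
have c0 := cmod_ge0 c; have c1 : 0 < 8 * (cmod c + 1) by lra.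
(* [coef2_dist] costs a factor 4; the 8 makes the final inequality strict, and the 1 admits
   [c = 0]. *)
pose M := r / (8 * (cmod c + 1)); have M0 : 0 < M by rewrite divr_gt0.
have MC : 0 < M%:C by rewrite ltcR.
have := fam_nbhs f (entourage_ball _ (PosNum MC)) (axis_circle_compact j).
apply: filterS => g /= fg hg.
have hM z : axis_circle j z -> cmod (f z 0 i - g z 0 i) <= M.
  move=> /fg; rewrite -ball_normE /ball_ /= => h.
  have := le_lt_trans (cmod_le_norm (f z - g z) i) h.
  by rewrite ltcR submxE => /ltW.
rewrite -mulrBr cmodE ltcR cmodM.
have h := coef2_dist hf hg hM.
have h2 : cmod c * cmod (coef2 f i j - coef2 g i j) <= cmod c * (4 * M) by rewrite ler_wpM2l.
have : 8 * (cmod c + 1) * M = r by rewrite /M; field; lra.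
by lra.
Qed.

(** The functional is [c * coef2] with [c] rotating [a] onto [|a|]. The opposite shear, also in [E],
    gives the value [- |a|], so the real part is not constant on [E]. *)
Lemma shear_support (E : set ('C[R]_n -> 'C[R]_n)) i j a : i != j -> a != 0 ->
  (forall q, E q -> cmod (coef2 q i j) <= cmod a) -> E (shear i j a) -> E (shear i j (- a)) ->
  bounded_support_point E (shear i j a).
Proof.
move=> ij a0 Ea Es Es'; have [c c1 ca] := unimodular_align a.
have ap : 0 < cmod a by rewrite cmod_gt0.
split; last by exists (1 + cmod a) => z; exact: bounded_shear.
split=> //; exists (fun f => c * coef2 f i j); split.
- split; last exact: coef2_continuous.
  by move=> b p q hp hq; rewrite coef2_lin //; ring.
- exists (shear i j a), (shear i j (- a)); split; [exact: Es|exact: Es'|].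
  rewrite (coef2_shear ij a) (coef2_shear ij (- a)) mulrN cReN ca => /= h.
  lra.
- move=> q /Ea h; rewrite (coef2_shear ij a) ca /=.
  by apply: le_trans (Re_le_cmod _) _; rewrite cmodM c1 mul1r.
Qed.

End Functional.

Section Theta.
Context {R : realType} {n : nat}.
Variable alpha : R.
Hypothesis ha : 0 < alpha <= 1.

Lemma cmod_theta (b : bool) : cmod ((-1) ^+ b * (sharp_bound alpha)%:C) = sharp_bound alpha.
Proof.
have [s0 _] := sharp_bound_le ha.
by rewrite cmodM cmodX cmodN cmod1 expr1n mul1r cmod_nneg // ltW.
Qed.

Lemma Theta_shear (b : bool) (i j : 'I_n) :
  Theta alpha b i j = shear i j ((-1) ^+ b * (sharp_bound alpha)%:C).
Proof. by []. Qed.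

(** Stated for a general [E], since both families obey the same coefficient bound and contain the
    same shears. *)
Lemma Theta_support (E : set ('C[R]_n -> 'C[R]_n)) (b : bool) (i j : 'I_n) : i != j ->
  (forall q, E q -> cmod (coef2 q i j) <= sharp_bound alpha) ->
  (forall a, cmod a = sharp_bound alpha -> E (shear i j a)) ->
  bounded_support_point E (Theta alpha b i j).
Proof.
move=> ij Ea Es; have [s0 _] := sharp_bound_le ha; have cb := cmod_theta b.
rewrite Theta_shear; apply: shear_support => //.
- by rewrite -cmod_gt0 cb.
- by move=> q /Ea; rewrite cb.
- exact: Es.
- by apply: Es; rewrite cmodN.
Qed.

End Theta.

Local Close Scope complex_scope.

Theorem corollary5p6 (R : realType) (n : nat) (alpha : R)
    (hn : (2 <= n)%N) (halpha : 0 < alpha <= 1) :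
  ((forall f : 'C[R]_n -> 'C[R]_n, SS_zero alpha f ->
      forall i j : 'I_n, i != j ->
        cmod (2^-1 * 'D_(evec j) ('D_(evec j) (fun z => f z 0 i)) 0)
          <= sharp_bound alpha) /\
   (forall i j : 'I_n, i != j ->
      exists2 f : 'C[R]_n -> 'C[R]_n, SS_zero alpha f &
        cmod (2^-1 * 'D_(evec j) ('D_(evec j) (fun z => f z 0 i)) 0)
          = sharp_bound alpha)) /\
  (forall (b : bool) (i j : 'I_n), i != j ->
      SS_star alpha (Theta alpha b i j) /\
      SS_zero alpha (Theta alpha b i j)) /\
  (forall (b : bool) (i j : 'I_n), i != j ->
      bounded_support_point (@SS_zero R n alpha) (Theta alpha b i j) /\
      bounded_support_point (@SS_star R n alpha) (Theta alpha b i j)).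
Proof.
split; [split|split].
- by move=> f sf i j ij; rewrite derive2_coef2; [exact: S_zero_coef2|case: sf].
- move=> i j ij; exists (Theta alpha false i j).
    by rewrite Theta_shear; apply: S_zero_shear => //; exact: cmod_theta.
  by rewrite Theta_shear derive2_coef2; [rewrite (coef2_shear ij) cmod_theta|exact: Hol_shear].
- move=> b i j ij; rewrite Theta_shear; have cb := cmod_theta halpha b.
  by split; [exact: S_star_shear|exact: S_zero_shear].
- move=> b i j ij; split.
  + apply: (Theta_support halpha b ij) => [q sq|a ca]; first exact: S_zero_coef2 halpha sq ij.
    exact: S_zero_shear.
  + apply: (Theta_support halpha b ij) => [q sq|a ca]; first exact: S_star_coef2 halpha sq ij.
    exact: S_star_shear.
Qed.
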